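(* Let $\alpha>1$ and let $m=m_n\in\mathbb{N}$ be a sequence with $\lim_{n\to\infty} m_n/n=\alpha$. For each $n$ let $A\in\mathbb{R}^{m\times n}$ have independent standard normal entries $A_{ij}\sim\mathcal{N}(0,1)$, and let $$\xi^-_{n}=\frac{1}{\sqrt n}\min_{x\in\mathbb{S}^n}\max_{y\in\mathbb{S}^m} y^TAx .$$ For a real $c_3\ge 0$ set $$\hat\gamma_{1,l}=\frac{-c_3+\sqrt{c_3^2+4\alpha}}{4},\qquad \phi_{1,l}(\gamma_1)=-\gamma_1c_3-\frac{\alpha}{2}\log\left(1+\frac{c_3}{2\gamma_1}\right),$$ $$\hat\gamma_2=\frac{c_3+\sqrt{c_3^2+4}}{4},\qquad \phi_2(\gamma_2)=\gamma_2c_3-\frac{1}{2}\log\left(1-\frac{c_3}{2\gamma_2}\right),$$ and for a real $u$ with $u\le \lim_{n\to\infty}\mathbb{E}\,\xi^-_{n}$ set $$\phi_l(u)=-\frac{c_3^2}{2}+\phi_{1,l}(\hat\gamma_{1,l})+\phi_2(\hat\gamma_2)+c_3u ,$$ which also depends on $c_3$. Then $$\limsup_{n\to\infty}\frac{\log \mathbb{P}\left(\xi^-_{n}\le u\right)}{n}\le \inf_{c_3\ge 0}\phi_l(u).$$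
   Context: $\mathbb{S}^k=\{x\in\mathbb{R}^k : \|x\|_2=1\}$ denotes the Euclidean unit sphere in $\mathbb{R}^k$. The quantity $\xi^-_n$ equals $n^{-1/2}\min_{x\in\mathbb{S}^n}\|Ax\|_2$, i.e. $n^{-1/2}\sqrt{\lambda_{\min}(A^TA)}$, where $A^TA$ is the Wishart matrix. The limiting expectation is $\lim_{n\to\infty}\mathbb{E}\,\xi^-_n=\sqrt{\alpha}-1$. The functions $\phi_{1,l},\phi_2$ and the values $\hat\gamma_{1,l},\hat\gamma_2$ depend on $c_3$; the infimum in the conclusion is over $c_3\ge0$ with $u$ fixed. Conventions: $\log 0=-\infty$, and the infimum may be $-\infty$ (this occurs only for $u\le 0$). The paper denotes the negative of this infimum by $\zeta_l(u)$ and calls it the rate function. *)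

(* Defs.v *)
From HB Require Import structures.
From mathcomp Require Import all_boot all_order all_algebra.
From mathcomp Require Import all_classical all_reals all_analysis.

Set Implicit Arguments.
Unset Strict Implicit.
Unset Printing Implicit Defensive.

Import Order.TTheory GRing.Theory Num.Theory.
Import numFieldNormedType.Exports.

Local Open Scope classical_set_scope.
Local Open Scope ring_scope.

(* The norm that the library puts on matrices is the maximum norm. *)
Definition enorm (R : realType) (k : nat) (x : 'cV[R]_k) : R :=
  Num.sqrt (\sum_(i < k) x i 0 ^+ 2).

Definition sphere (R : realType) (k : nat) : set 'cV[R]_k :=
  [set x | enorm x = 1].

(* The spheres are compact, so [inf] and [sup] are an attained minimum and
   maximum as soon as [0 < m] and [0 < n]; over an empty sphere they are 0. *)
Definition xi_minus (R : realType) (m n : nat) (M : 'M[R]_(m, n)) : R :=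
  (Num.sqrt n%:R)^-1 *
  inf [set sup [set (y^T *m M *m x) 0 0 | y in @sphere R m] | x in @sphere R n].

(* Equality is required on measurable sets only: the values of a measure
   elsewhere are unconstrained. *)
Definition standard_normal (d : measure_display) (T : measurableType d)
    (R : realType) (P : probability T R) (X : {RV P >-> R}) : Prop :=
  forall B : set R, measurable B -> distribution P X B = normal_prob 0 1 B.

Definition mutually_independent (d : measure_display) (T : measurableType d)
    (R : realType) (P : probability T R) (I : finType)
    (X : I -> {RV P >-> R}) : Prop :=
  forall (J : {set I}) (B : I -> set R), (forall i, measurable (B i)) ->
    P (\bigcap_(i in [set` J]) (X i @^-1` B i)) =
    (\prod_(i in J) P (X i @^-1` B i))%E.

Definition standard_gaussian_matrix (d : measure_display)
    (T : measurableType d) (R : realType) (P : probability T R) (m n : nat)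
    (A : 'I_m -> 'I_n -> {RV P >-> R}) : Prop :=
  (forall i j, standard_normal (A i j)) /\
  mutually_independent (fun ij : 'I_m * 'I_n => A ij.1 ij.2).

Definition xi_minus_rv (d : measure_display) (T : measurableType d)
    (R : realType) (P : probability T R) (m n : nat)
    (A : 'I_m -> 'I_n -> {RV P >-> R}) : T -> R :=
  fun w => xi_minus (\matrix_(i < m, j < n) A i j w).

Definition gamma1l (R : realType) (alpha c3 : R) : R :=
  (- c3 + Num.sqrt (c3 ^+ 2 + 4 * alpha)) / 4.

Definition phi1l (R : realType) (alpha c3 gamma1 : R) : R :=
  - (gamma1 * c3) - alpha / 2 * ln (1 + c3 / (2 * gamma1)).

Definition gamma2 (R : realType) (c3 : R) : R :=
  (c3 + Num.sqrt (c3 ^+ 2 + 4)) / 4.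

Definition phi2 (R : realType) (c3 gamma : R) : R :=
  gamma * c3 - 1 / 2 * ln (1 - c3 / (2 * gamma)).

(* For [0 < alpha] and [0 <= c3] both logarithms have positive arguments
   ([0 < gamma1l alpha c3] and [c3 < 2 * gamma2 c3]), so the junk values of
   [ln] play no role. *)
Definition phil (R : realType) (alpha c3 u : R) : R :=
  - (c3 ^+ 2 / 2) + phi1l alpha c3 (gamma1l alpha c3)
  + phi2 c3 (gamma2 c3) + c3 * u.

(* Main.v *)
Require Import Defs.
From HB Require Import structures.
From mathcomp Require Import all_boot all_order all_algebra.
From mathcomp Require Import all_classical all_reals all_analysis.
From mathcomp Require Import measurable_realfun ring lra.

Import Order.TTheory GRing.Theory Num.Theory.
Import numFieldNormedType.Exports.

Local Open Scope classical_set_scope.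
Local Open Scope ring_scope.

Set Implicit Arguments.
Unset Strict Implicit.

(** Why the bound holds.

    Fix [c >= 0]; it is enough to bound the upper limit by [phil alpha c u].  For
    [c = 0] that value is [0], so let [c > 0].  The maximum over [y] of the bilinear
    form is the Euclidean norm of [A x], hence [xi_minus] times [sqrt n] is the least
    norm of [A x] over unit vectors [x].

    The heart is Gordon's comparison.  Let [gam], [g] and [h] be a standard Gaussian
    variable and two standard Gaussian vectors, independent of each other and of [A].
    For every finite family of unit vectors, the minimum of [norm (A x) + gam] is
    less likely to be small than the minimum of [norm g + <h, x>], which is at least
    [norm g - norm h].  To prove it, put both processes in one space, with
    coordinates for [A], [gam], [g] and [h], and let [F] be one minus the product
    over [x] of smoothed indicators of [norm (A x + g) + <h, x> + gam > a], the norm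
    being smoothed too.  The means of [F] under the two processes are its heat flows
    along the coordinates of [A] and [gam], and along those of [g] and [h].  The two
    generators differ on [F] by a quantity of constant sign, because their carre du
    champ operators differ by a positive multiple of [(1 - <x, y>) * (1 - <p, q>)], where
    [x], [y] are unit vectors and [p], [q] have norm at most one ([carre_du_champ],
    [soft_all_subharmonic]).  A pointwise comparison of generators passes to the heat
    flows: both flows are semigroups that commute, and over a short time each is given
    by its generator up to a negligible error ([smooths_expansion],
    [smooths_comparison]).

    The heat flow is an iterated Gaussian integral, whereas [A] is a family of
    independent random variables on an arbitrary probability space.  Rounding the
    variables to finitely many values links the two: independence is then a statement
    on finitely many events ([independent_lower_bound]).

    Conditioning on [gam <= - c * sqrt n] and applying an exponential Markov inequality
    with parameter [lam = c * sqrt n] yields [xi_probability]: up to a factor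
    [exp (O (sqrt n))], [P (xi <= u) * P (gam <= - c sqrt n)] is at most
    [exp (n (c u - c ^ 2)) * E exp (lam * norm h) * E exp (- lam * norm g)].
    The Gaussian tail is [exp (- n c ^ 2 / 2)] up to the same kind of factor, which
    leaves [exp (n (c u - c ^ 2 / 2))].  The two expectations are bounded by replacing
    the exponents by quadratic forms.  For every [gamma > 0],
    [lam * norm h <= n * c * gamma + c / (4 * gamma) * norm h ^ 2], and the Gaussian integral
    at [gamma = gamma2 c] contributes [phi2 c (gamma2 c)] to the rate.  As a function of
    [norm g ^ 2], on the other hand, [- norm g] is convex and lies above its tangent lines,
    so no single quadratic form works.  A finite net of values of [gamma] does
    ([gaussian_family]): each of its members contributes at most the maximum of [phi1l],
    which is attained at [gamma1l] ([phi1l_max]), and the size of the net does not depend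
    on [n].

    A finite family of unit vectors suffices because [norm (A x)] is continuous in [x]:
    the event [xi <= u] is expressed by countably many directions ([xi_minus_le]), and
    probabilities are continuous along increasing sequences of events. *)

(** * The standard Gaussian measure on the line *)

Section StandardNormal.
Context {R : realType}.
Local Notation mu := (@lebesgue_measure R).
Local Notation N := (@normal_prob R 0 1).

Lemma ge0_integral_normal_prob (m s : R) (f : R -> \bar R) :
  measurable_fun [set: R] f -> (forall x, 0 <= f x)%E ->
  (\int[normal_prob m s]_x f x =
   \int[mu]_x (f x * (normal_pdf m s x)%:E))%E.
Proof.
move=> mf f0.
have dom := normal_prob_dominates m s.
rewrite -(Radon_Nikodym_SigmaFinite.change_of_variables dom f0 measurableT mf).
have mpdf : measurable_fun [set: R] (fun x => (normal_pdf m s x)%:E).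
  by apply/measurable_EFinP; exact: measurable_normal_pdf.
have irn := Radon_Nikodym_SigmaFinite.f_integrable dom.
have mrn := measurable_int _ irn.
apply: ae_eq_integral => //.
- exact: emeasurable_funM.
- exact: emeasurable_funM.
- apply: ae_eqe_mul2l; apply: integral_ae_eq => // E _ mE.
  by rewrite -Radon_Nikodym_SigmaFinite.f_integral.
Qed.

Lemma continuous_ge0_integral_affine (a b : R) (G : R -> R) :
  0 < a -> continuous G -> (forall x, 0 <= G x) ->
  (\int[mu]_x (G x)%:E = \int[mu]_x (G (a * x + b) * a)%:E)%E.
Proof.
move=> a0 cG G0.
have dF (x : R) : is_derive x 1 (fun x => a * x + b) a.
  by apply: is_derive_eq; rewrite addr0 /GRing.scale /= mulr1.
have F'E : (fun x => a * x + b : R^o)^`()%classic = cst a.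
  by apply/funext => x; rewrite derive1E; exact: derive_val.
rewrite (increasing_ge0_integration_by_substitutionT (F := fun x => a * x + b)) //.
- by rewrite F'E.
- by move=> x y xy; rewrite ltrD2r ltr_pM2l.
- by rewrite F'E => ?; exact: cvg_cst.
- by rewrite F'E; exact: is_cvg_cst.
- by rewrite F'E; exact: is_cvg_cst.
- apply/cvgrNyPle => A; exists ((A - b) / a); split; first exact: num_real.
  by move=> x /= xA; rewrite -lerBrDr mulrC -ler_pdivlMr // ltW.
- apply/cvgryPge => A; exists ((A - b) / a); split; first exact: num_real.
  by move=> x /= xA; rewrite -lerBlDr mulrC -ler_pdivrMr // ltW.
Qed.

Lemma ge0_integral_normal_probN (f : R -> \bar R) :
  measurable_fun [set: R] f -> (forall x, 0 <= f x)%E ->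
  (\int[N]_x f (- x)%R = \int[N]_x f x)%E.
Proof.
move=> mf f0.
have mN : measurable_fun [set: R] (-%R : R -> R) by exact: oppr_measurable.
have mg : measurable_fun [set: R] (fun x => f x * (normal_pdf 0 1 x)%:E)%E.
  apply: emeasurable_funM => //; apply/measurable_EFinP.
  exact: measurable_normal_pdf.
rewrite !ge0_integral_normal_prob //; last exact: measurableT_comp.
have -> : (\int[mu]_x (f x * (normal_pdf 0 1 x)%:E) =
  \int[pushforward mu (-%R : _ -> measurableTypeR R)]_x (f x * (normal_pdf 0 1 x)%:E))%E.
  by apply: eq_measure_integral => //= A mA _; exact/esym/lebesgue_measureN.
have -> := @ge0_integral_pushforward _ _ (measurableTypeR R) (measurableTypeR R) R -%R mN mu setT _ measurableT mg.
  rewrite preimage_setT; apply: eq_integral => x _ /=.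
  by rewrite !normal_pdfE ?oner_eq0 // /normal_fun !subr0 sqrrN.
by move=> y _; rewrite mule_ge0 // lee_fin normal_pdf_ge0.
Qed.

Lemma normal_pdf_gt0E (m s x : R) : 0 < s ->
  normal_pdf m s x = (s * Num.sqrt (pi *+ 2))^-1 *
                     expR (- ((x - m) ^+ 2 / (2 * s ^+ 2))).
Proof.
move=> s0; rewrite normal_pdfE ?gt_eqF // /normal_peak /normal_fun.
rewrite -mulrnAr sqrtrM ?sqr_ge0 // sqrtr_sqr gtr0_norm // mulNr.
by rewrite (mulr_natl _ 2).
Qed.

(** Completing the square: the product of the density of [x] and of the density
    at [w] of a Gaussian variable centred at [s * x] factors the other way round,
    as the density of [w] times a conditional density of [x]. *)
Lemma normal_pdf_disintegration (s t x w : R) : 0 < s -> 0 < t ->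
  let r := Num.sqrt (s ^+ 2 + t ^+ 2) in
  normal_pdf 0 1 x * normal_pdf (s * x) t w =
  normal_pdf 0 r w * normal_pdf (s * w / r ^+ 2) (t / r) x.
Proof.
move=> s0 t0 r.
have st0 : 0 < s ^+ 2 + t ^+ 2 by rewrite addr_gt0 // exprn_gt0.
have r0 : 0 < r by rewrite sqrtr_gt0.
have r2 : r ^+ 2 = s ^+ 2 + t ^+ 2 by rewrite sqr_sqrtr // ltW.
rewrite !normal_pdf_gt0E // ?divr_gt0 //.
set q := Num.sqrt (pi *+ 2).
have q0 : 0 < q by rewrite sqrtr_gt0 pmulrn_rgt0 // pi_gt0.
rewrite mulrACA [RHS]mulrACA -!expRD; congr (_ * expR _); last first.
  by field: r2; rewrite ?gt_eqF.
by field; rewrite !gt_eqF.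
Qed.

Lemma normal_scale (r : R) (g : R -> R) : 0 < r -> continuous g ->
  (forall x, 0 <= g x) ->
  (\int[N]_x (g (r * x))%:E = \int[mu]_x (g x * normal_pdf 0 r x)%:E)%E.
Proof.
move=> r0 cg g0.
rewrite ge0_integral_normal_prob; last by move=> x; rewrite lee_fin.
  rewrite [RHS](@continuous_ge0_integral_affine r 0) //.
  - apply: eq_integral => x _; rewrite addr0 -EFinM; congr EFin.
    rewrite !normal_pdf_gt0E // !subr0.
    have q0 : Num.sqrt (pi *+ 2) != 0 :> R.
      by rewrite gt_eqF // sqrtr_gt0 pmulrn_rgt0 // pi_gt0.
    have -> : (r * x) ^+ 2 / (2 * r ^+ 2) = x ^+ 2 / (2 * 1 ^+ 2) :> R.
      by field; rewrite gt_eqF.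
    by field; rewrite q0 gt_eqF.
  - move=> x; apply: cvgM; first exact: cg.
    by apply: continuous_normal_pdf; rewrite gt_eqF.
  - by move=> x; rewrite mulr_ge0 ?normal_pdf_ge0.
apply/measurable_EFinP; apply: (measurableT_comp (f := g)).
  exact: continuous_measurable_fun.
exact: measurable_funM.
Qed.

(** Stability of the Gaussian law: [s * X + t * Y], with [X] and [Y] independent
    and standard normal, has the law of [sqrt (s ^+ 2 + t ^+ 2) * Z]. *)
Lemma normal_stable (s t : R) (g : R -> R) : 0 < s -> 0 < t -> continuous g ->
  (forall x, 0 <= g x) ->
  (\int[N]_x \int[N]_y (g (s * x + t * y))%:E =
   \int[N]_x (g (Num.sqrt (s ^+ 2 + t ^+ 2) * x))%:E)%E.
Proof.
move=> s0 t0 cg g0; set r := Num.sqrt _.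
have r0 : 0 < r by rewrite sqrtr_gt0 addr_gt0 // exprn_gt0.
have mg : measurable_fun [set: R] g by exact: continuous_measurable_fun.
rewrite normal_scale //.
pose k (x w : R) : R := normal_pdf 0 1 x * (g w * normal_pdf (s * x) t w).
have k0 x w : 0 <= k x w by rewrite !mulr_ge0 ?normal_pdf_ge0.
have inner x : (\int[N]_y (g (s * x + t * y))%:E =
    \int[mu]_w (g w * normal_pdf (s * x) t w)%:E)%E.
  have cg' : continuous (fun y => g (s * x + y)).
    move=> y; apply: (cvg_comp (fun y => s * x + y) g); last exact: cg.
    by apply: cvgD; [exact: cvg_cst|exact: cvg_id].
  have E1 := @normal_scale t (fun y => g (s * x + y)) t0 cg' (fun y => g0 _).
  rewrite E1 {E1}.
  rewrite [RHS](@continuous_ge0_integral_affine 1 (s * x)) //.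
  - apply: eq_integral => y _; rewrite mulr1 mul1r addrC; congr (_ * _)%:E.
    by rewrite !normal_pdf_gt0E // subr0 addrK.
  - move=> y; apply: cvgM; first exact: cg.
    by apply: continuous_normal_pdf; rewrite gt_eqF.
  - by move=> w; rewrite mulr_ge0 ?normal_pdf_ge0.
under eq_integral do rewrite inner.
have mh : measurable_fun setT (fun z : R * R => (g z.2 * normal_pdf (s * z.1) t z.2)%:E).
  apply/measurable_EFinP; apply: measurable_funM; first exact: measurableT_comp.
  rewrite (_ : (fun _ => _) = fun z : R * R => (t * Num.sqrt (pi *+ 2))^-1 *
    expR (- ((z.2 - s * z.1) ^+ 2 / (2 * t ^+ 2)))); last first.
    by apply/funext => z; rewrite normal_pdf_gt0E.
  apply: measurable_funM => //; apply: (measurableT_comp (f := expR)) => //.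
  apply: measurable_funN; apply: measurable_funM => //.
  apply: measurable_funX; apply: measurable_funB => //.
  exact: measurable_funM.
have mk : measurable_fun setT (fun z : R * R => (k z.1 z.2)%:E).
  apply/measurable_EFinP; apply: measurable_funM.
    by apply: (measurableT_comp (f := normal_pdf 0 1)) => //; exact: measurable_normal_pdf.
  by apply/measurable_EFinP.
have h0 x w : (0 <= (g w * normal_pdf (s * x) t w)%:E)%E.
  by rewrite lee_fin mulr_ge0 ?normal_pdf_ge0.
rewrite ge0_integral_normal_prob; last first.
- by move=> x; apply: integral_ge0.
- apply: (measurable_fun_fubini_tonelli_F (m2 := mu) (fun z : R * R => (g z.2 * normal_pdf (s * z.1) t z.2)%:E)) => //.
- transitivity (\int[mu]_x \int[mu]_w (k x w)%:E)%E.
    apply: eq_integral => x _; rewrite muleC -ge0_integralZl //.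
    - by apply/measurable_EFinP; apply: measurable_funM => //; exact: measurable_normal_pdf.
    - by rewrite lee_fin normal_pdf_ge0.
  have k0' (z : R * R) : (0 <= (k z.1 z.2)%:E)%E by rewrite lee_fin.
  have E1 := fubini_tonelli (m1 := mu) (m2 := mu) _ mk k0'.
  etransitivity; first exact: E1.
  apply: eq_integral => w _.
  have Ek x : (k x w)%:E =
      ((g w * normal_pdf 0 r w)%:E * (normal_pdf (s * w / r ^+ 2) (t / r) x)%:E)%E.
    rewrite -EFinM; congr EFin.
    by rewrite /k mulrCA (normal_pdf_disintegration x w s0 t0) mulrA.
  transitivity (\int[mu]_x ((g w * normal_pdf 0 r w)%:E *
      (normal_pdf (s * w / r ^+ 2) (t / r) x)%:E))%E.
    by apply: eq_integral => x _; exact: Ek.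
  have mp : measurable_fun [set: R]
      (fun x => (normal_pdf (s * w / r ^+ 2) (t / r) x)%:E).
    by apply/measurable_EFinP; exact: measurable_normal_pdf.
  have p0 (x : R) : (0 <= (normal_pdf (s * w / r ^+ 2) (t / r) x)%:E)%E.
    by rewrite lee_fin normal_pdf_ge0.
  have c0 : (0 <= (g w * normal_pdf 0 r w)%:E)%E.
    by rewrite lee_fin mulr_ge0 ?normal_pdf_ge0.
  have -> := @ge0_integralZl _ _ R mu setT measurableT _ mp _ (fun x _ => p0 x) c0.
  by rewrite integral_normal_pdf mule1.
Qed.

(** For [k < 1 / 2] the product of [expR (k * x ^+ 2)] and the standard density is a
    multiple of the density of variance [1 / (1 - 2 * k)]. *)
Lemma normal_exp_sqr (k : R) : k < 2^-1 ->
  (\int[N]_x (expR (k * x ^+ 2))%:E = ((Num.sqrt (1 - 2 * k))^-1)%:E)%E.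
Proof.
move=> k2; have d0 : 0 < 1 - 2 * k by lra.
set s := (Num.sqrt (1 - 2 * k))^-1.
have s0 : 0 < s by rewrite invr_gt0 sqrtr_gt0.
have s2 : s ^+ 2 = (1 - 2 * k)^-1 by rewrite exprVn sqr_sqrtr // ltW.
rewrite ge0_integral_normal_prob; last by move=> x; rewrite lee_fin expR_ge0.
  transitivity (\int[mu]_x (s%:E * (normal_pdf 0 s x)%:E))%E.
    apply: eq_integral => x _; rewrite -!EFinM; congr EFin.
    rewrite !normal_pdf_gt0E // !subr0 s2 [LHS]mulrCA -expRD [RHS]mulrA.
    have q0 : Num.sqrt (pi *+ 2) != 0 :> R.
      by rewrite gt_eqF // sqrtr_gt0 pmulrn_rgt0 // pi_gt0.
    congr (_ * expR _); first by field; rewrite q0 gt_eqF.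
    by field; rewrite gt_eqF.
  rewrite ge0_integralZl // ?integral_normal_pdf ?mule1 //.
  - by apply/measurable_EFinP; exact: measurable_normal_pdf.
  - by move=> x _; rewrite lee_fin normal_pdf_ge0.
  - by rewrite lee_fin ltW.
apply/measurable_EFinP; apply: measurableT_comp => //.
by apply: measurable_funM => //; exact: measurable_funX.
Qed.

Lemma normal_exp_integrable (k : R) : k < 2^-1 ->
  N.-integrable setT (EFin \o (fun x => expR (k * x ^+ 2))).
Proof.
move=> k2; apply/integrableP; split.
  apply/measurable_EFinP; apply: measurableT_comp => //.
  by apply: measurable_funM => //; exact: measurable_funX.
under eq_integral => x _ do rewrite /= ger0_norm ?expR_ge0 //.
by rewrite normal_exp_sqr // ltry.
Qed.

Lemma normal_bounded_integrable (g : R -> R) (M : R) :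
  measurable_fun setT g -> (forall x, `|g x| <= M) ->
  N.-integrable setT (EFin \o g).
Proof.
move=> mg gM; apply: measurable_bounded_integrable => //.
  exact: le_lt_trans (probability_le1 N measurableT) (ltry _).
exists M; split; first exact: num_real.
by move=> x Mx y _; apply: le_trans (gM y) _; exact: ltW.
Qed.

Lemma normal_poly_integrable (g : R -> R) (M : R) :
  measurable_fun setT g -> (forall x, `|g x| <= M * (1 + `|x| ^+ 3)) ->
  N.-integrable setT (EFin \o g).
Proof.
move=> mg gM.
have ie : N.-integrable setT (EFin \o (fun x => (35 * M) * expR (4^-1 * x ^+ 2))).
  have k4 : 4^-1 < 2^-1 :> R by rewrite ltf_pV2 ?posrE // ltr_nat.
  by have := integrableZl measurableT (35 * M) (normal_exp_integrable k4).
apply: le_integrable ie => //; first exact/measurable_EFinP.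
move=> x _; rewrite /= lee_fin.
have M0 : 0 <= M.
  have := gM 0; rewrite normr0 expr0n /= addr0 mulr1.
  exact: le_trans (normr_ge0 _).
apply: le_trans (gM x) _; rewrite normrM (ger0_norm (expR_ge0 _)) ger0_norm ?mulr_ge0 //.
rewrite (mulrC 35) -mulrA ler_wpM2l //.
set y := `|x|; have y0 : 0 <= y by rewrite normr_ge0.
have -> : x ^+ 2 = y ^+ 2 by rewrite real_normK // num_real.
have H : 1 + (8^-1 * y ^+ 2) <= expR (8^-1 * y ^+ 2) by exact: expR_ge1Dx.
have -> : expR (4^-1 * y ^+ 2) = expR (8^-1 * y ^+ 2) ^+ 2.
  by rewrite [RHS]expr2 -expRD; congr expR; field.
(* [(1 + y ^ 2 / 8) ^ 2] dominates [1 + y ^ 3] up to the constant [35]. *)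
apply: (@le_trans _ _ (35 * (1 + 8^-1 * y ^+ 2) ^+ 2)).
  have h1 : 0 <= y ^+ 2 by exact: sqr_ge0.
  have h2 : 0 <= (y * (y - 1)) ^+ 2 by exact: sqr_ge0.
  by rewrite -subr_ge0; nra.
rewrite ler_wpM2l // lerXn2r // ?nnegrE ?expR_ge0 //.
by apply: addr_ge0 => //; rewrite mulr_ge0 // sqr_ge0.
Qed.

(** The law is invariant under [x |-> - x], so the positive and the negative parts of
    the identity have the same integral, which is finite. *)
Lemma normal_mean0 : \int[N]_x x = 0.
Proof.
rewrite /Rintegral integralE.
have -> : (\int[N]_x (EFin^\-)%E x = \int[N]_x (EFin^\+)%E x)%E.
  have mp : measurable_fun [set: R] (EFin^\+)%E.
    by apply: measurable_funepos; exact/measurable_EFinP.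
  rewrite -(ge0_integral_normal_probN mp); last by move=> x; exact: funepos_ge0.
  by apply: eq_integral => x _; rewrite funenegE funeposE EFinN.
have : (\int[N]_x (EFin^\+)%E x \is a fin_num)%E.
  apply: integrable_pos_fin_num => //.
  apply: (@normal_poly_integrable (fun x => x) 1) => // x.
  rewrite mul1r; set y := `|x|; have y0 : 0 <= y by rewrite normr_ge0.
  have : 0 <= y * (y - 1) ^+ 2 by rewrite mulr_ge0 // sqr_ge0.
  have : 0 <= (y - 1) ^+ 2 by exact: sqr_ge0.
  nra.
by move=> f; rewrite subee.
Qed.

(** The interval of length one that ends at [- c] already carries enough mass, since
    the density is at least [expR (- (c + 1) ^+ 2 / 2)] there up to normalization. *)
Lemma normal_lower_tail (c : R) : 0 <= c ->
  (((Num.sqrt (pi *+ 2))^-1 * expR (- ((c + 1) ^+ 2 / 2)))%:E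
    <= N `]-oo, (- c)%R])%E.
Proof.
move=> c0; set K := _^-1 * _.
apply: (@le_trans _ _ (N `[(- c - 1)%R, (- c)%R])); last first.
  by apply: le_measure; rewrite ?inE //; apply: subset_itvr; rewrite bnd_simp.
rewrite /normal_prob.
apply: (@le_trans _ _ (\int[mu]_(x in `[(- c - 1)%R, (- c)%R]) K%:E)%E).
  rewrite integral_cst //= lebesgue_measure_itv /= lte_fin.
  have -> : - c - 1 < - c by lra.
  by rewrite -EFinD -EFinM lee_fin (_ : - c - (- c - 1) = 1) ?mulr1 //; lra.
apply: ge0_le_integral => //.
- by move=> x _; rewrite lee_fin mulr_ge0 ?expR_ge0 ?invr_ge0 ?sqrtr_ge0.
- by apply/measurable_EFinP; apply: measurable_funTS; exact: measurable_normal_pdf.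
- move=> x; rewrite /= in_itv /= => /andP[h1 h2]; rewrite lee_fin normal_pdf_gt0E //.
  rewrite mul1r subr0 expr1n mulr1 ler_wpM2l ?invr_ge0 ?sqrtr_ge0 //.
  by rewrite ler_expR; nra.
Qed.

End StandardNormal.

(** * Gaussian means of bounded Lipschitz functions *)

Section GaussMean.
Context {R : realType}.
Local Notation N := (@normal_prob R 0 1).

Definition bounded_lipschitz1 (M : R) (g : R -> R) :=
  (forall x, `|g x| <= M) /\ (forall x y, `|g x - g y| <= M * `|x - y|).

Definition gmean (g : R -> R) : R := \int[N]_x g x.

Lemma lipschitz_continuous (M : R) (g : R -> R) :
  (forall x y, `|g x - g y| <= M * `|x - y|) -> continuous g.
Proof.
move=> gL x; apply/cvgrPdist_le => e e0.
have M0 : 0 <= M by have := gL 1 0; rewrite subr0 normr1 mulr1; apply: le_trans.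
near=> y; apply: le_trans (gL x y) _.
have xy : `|x - y| <= e / (M + 1).
  near: y; apply: cvgr_dist_le; [exact: cvg_id | by rewrite divr_gt0 // ltr_wpDl].
apply: (le_trans (ler_wpM2l M0 xy)).
rewrite mulrA ler_pdivrMr ?ltr_wpDl // mulrDr mulr1 mulrC lerDl; exact: ltW.
Unshelve. all: end_near. Qed.

Lemma bl1_measurable M g : bounded_lipschitz1 M g -> measurable_fun setT g.
Proof.
by move=> [_ gL]; apply: continuous_measurable_fun; exact: lipschitz_continuous gL.
Qed.

Lemma bl1_integrable M g : bounded_lipschitz1 M g -> N.-integrable setT (EFin \o g).
Proof.
by move=> gM; exact: normal_bounded_integrable (bl1_measurable gM) gM.1.
Qed.

Lemma normal_integrable_cst (c : R) : N.-integrable setT (EFin \o cst c).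
Proof. by apply: (@normal_bounded_integrable _ (cst c) `|c|). Qed.

Lemma gmean_cst (c : R) : gmean (fun=> c) = c.
Proof.
rewrite /gmean Rintegral_cst // -[RHS]mulr1; congr (_ * _).
exact: (congr1 fine (@probability_setT _ _ _ (normal_prob 0 1))).
Qed.

Lemma gmean_le g h : N.-integrable setT (EFin \o g) ->
  N.-integrable setT (EFin \o h) -> (forall x, g x <= h x) -> gmean g <= gmean h.
Proof. by move=> ig ih gh; apply: le_Rintegral. Qed.

Lemma gmeanD g h : N.-integrable setT (EFin \o g) ->
  N.-integrable setT (EFin \o h) -> gmean (fun x => g x + h x) = gmean g + gmean h.
Proof. by move=> ig ih; rewrite /gmean RintegralD. Qed.

Lemma gmeanB g h : N.-integrable setT (EFin \o g) ->
  N.-integrable setT (EFin \o h) -> gmean (fun x => g x - h x) = gmean g - gmean h.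
Proof. by move=> ig ih; rewrite /gmean RintegralB. Qed.

Lemma gmeanZ c g : N.-integrable setT (EFin \o g) ->
  gmean (fun x => c * g x) = c * gmean g.
Proof. by move=> ig; rewrite /gmean RintegralZl. Qed.

Lemma gmean_dist g h k : N.-integrable setT (EFin \o g) ->
  N.-integrable setT (EFin \o h) -> N.-integrable setT (EFin \o k) ->
  (forall x, `|g x - h x| <= k x) -> `|gmean g - gmean h| <= gmean k.
Proof.
move=> ig ih ik gh; rewrite -gmeanB //.
have igh : N.-integrable setT (EFin \o (fun x => g x - h x)).
  by have := integrableB measurableT ig ih.
apply: (le_trans (le_normr_Rintegral _ igh)) => //.
by apply: gmean_le => //; exact: integrable_norm.
Qed.

Lemma EFin_gmean g : N.-integrable setT (EFin \o g) ->
  (gmean g)%:E = (\int[N]_x (g x)%:E)%E.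
Proof. by move=> ig; rewrite /gmean /Rintegral fineK //; exact: integrable_fin_num. Qed.

Lemma bl1_affine M g a b : `|a| <= 1 -> bounded_lipschitz1 M g ->
  bounded_lipschitz1 M (fun x => g (b + a * x)).
Proof.
move=> a1 [gM gL]; split=> [x|x y]; first exact: gM.
have M0 : 0 <= M by apply: le_trans (gM 0).
apply: (le_trans (gL _ _)); rewrite opprD addrACA subrr add0r -mulrBr normrM.
by rewrite ler_wpM2l // ler_piMl.
Qed.

Lemma gmean_bl1 M (g : R -> R -> R) : (forall x, bounded_lipschitz1 M (g x)) ->
  (forall y, bounded_lipschitz1 M (g ^~ y)) ->
  bounded_lipschitz1 M (fun x => gmean (g x)).
Proof.
move=> g1 g2; split=> [x|x x'].
  have := @gmean_dist (g x) (cst 0) (cst M); rewrite !gmean_cst subr0; apply.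
  - exact: bl1_integrable (g1 x).
  - exact: normal_integrable_cst.
  - exact: normal_integrable_cst.
  - by move=> y /=; rewrite subr0; exact: (g1 x).1.
have := @gmean_dist (g x) (g x') (cst (M * `|x - x'|)); rewrite gmean_cst; apply.
- exact: bl1_integrable (g1 x).
- exact: bl1_integrable (g1 x').
- exact: normal_integrable_cst.
- by move=> y /=; exact: (g2 y).2.
Qed.

Lemma bl1_integrableDc M g c : bounded_lipschitz1 M g ->
  N.-integrable setT (EFin \o (fun x => g x + c)).
Proof.
move=> gM.
by have := integrableD measurableT (bl1_integrable gM) (normal_integrable_cst c).
Qed.

Lemma gmeanDc M g c : bounded_lipschitz1 M g ->
  gmean (fun x => g x + c) = gmean g + c.
Proof.
move=> gM; rewrite -[X in _ + X](gmean_cst c) -gmeanD //.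
  exact: bl1_integrable gM.
exact: normal_integrable_cst.
Qed.

Lemma gmean_stable M (g : R -> R) (s t : R) : 0 < s <= 1 -> 0 < t <= 1 ->
  bounded_lipschitz1 M g ->
  Num.sqrt (s ^+ 2 + t ^+ 2) <= 1 ->
  gmean (fun x => gmean (fun y => g (s * x + t * y))) =
  gmean (fun x => g (Num.sqrt (s ^+ 2 + t ^+ 2) * x)).
Proof.
move=> /andP[s0 s1] /andP[t0 t1] gM; set r := Num.sqrt _ => r1.
have r0 : 0 < r by rewrite sqrtr_gt0 addr_gt0 // exprn_gt0.
have bg x : bounded_lipschitz1 M (fun y => g (s * x + t * y)).
  by apply: bl1_affine => //; rewrite gtr0_norm.
have bg2 y : bounded_lipschitz1 M (fun x => g (s * x + t * y)).
  rewrite (_ : (fun _ => _) = fun x => g (t * y + s * x)).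
    by apply: bl1_affine => //; rewrite gtr0_norm.
  by apply/funext => x; rewrite addrC.
have bgg : bounded_lipschitz1 M (fun x => gmean (fun y => g (s * x + t * y))).
  exact: gmean_bl1.
have bgr : bounded_lipschitz1 M (fun x => g (r * x)).
  have := @bl1_affine M g r 0; under eq_fun do rewrite add0r.
  by apply => //; rewrite gtr0_norm.
(* [normal_stable] is about nonnegative functions, hence the shift by [M]. *)
apply: (@addIr _ M).
rewrite -(gmeanDc M bgg) -(gmeanDc M bgr).
apply: EFin_inj; rewrite (EFin_gmean (bl1_integrableDc M bgg)).
rewrite (EFin_gmean (bl1_integrableDc M bgr)).
have cg : continuous (fun x => g x + M).
  move=> x; apply: cvgD; last exact: cvg_cst.
  exact: lipschitz_continuous gM.2 x.
have g0 x : 0 <= g x + M by have := gM.1 x; rewrite ler_norml => /andP[]; lra.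
rewrite -(normal_stable s0 t0 cg g0).
apply: eq_integral => x _; rewrite -(gmeanDc M (bg x)).
by rewrite (EFin_gmean (bl1_integrableDc M (bg x))).
Qed.

End GaussMean.

(** * Finite-valued approximation of a Gaussian variable *)

Import HBSimple.
Section Discretization.
Context {R : realType}.
Local Notation N := (@normal_prob R 0 1).

(** The distance that controls a bounded Lipschitz function: the truncation at [1] makes
    it integrable against every probability. *)
Definition trunc_dist (x y : R) : R := Num.min 1 `|x - y|.

Lemma trunc_dist_ge0 x y : 0 <= trunc_dist x y.
Proof. by rewrite /trunc_dist le_min ler01 normr_ge0. Qed.

Lemma trunc_dist_le1 x y : trunc_dist x y <= 1.
Proof. by rewrite /trunc_dist ge_min lexx. Qed.

Lemma measurable_trunc_dist (q : R -> R) : measurable_fun setT q ->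
  measurable_fun setT (fun x => trunc_dist x (q x)).
Proof.
move=> mq; apply: measurable_minr => //; apply: measurableT_comp => //.
exact: measurable_funB.
Qed.

Lemma trunc_dist_integrable (q : R -> R) : measurable_fun setT q ->
  N.-integrable setT (EFin \o (fun x => trunc_dist x (q x))).
Proof.
move=> mq; apply: (@normal_bounded_integrable _ _ 1).
  exact: measurable_trunc_dist.
by move=> x; rewrite ger0_norm ?trunc_dist_ge0 ?trunc_dist_le1.
Qed.

(** Simple functions converge pointwise to the identity, and dominated convergence turns
    this into convergence in mean because [trunc_dist] is bounded. *)
Lemma exists_discretization (e : R) : 0 < e ->
  exists q : R -> R, exists s : seq R, [/\ measurable_fun setT q, uniq s,
    (forall x, q x \in s) & gmean (fun x => trunc_dist x (q x)) <= e].
Proof.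
move=> e0.
have mid : measurable_fun [set: R] (EFin : R -> \bar R) by exact/measurable_EFinP.
have [g gid] := @approximation_sfun _ _ R EFin setT measurableT mid.
have cg0 : (fun n => (gmean (fun x => trunc_dist x (g n x)))%:E) @ \oo --> (0%R)%:E.
  have := @dominated_convergence _ _ R N setT measurableT
    (fun n x => (trunc_dist x (g n x))%:E) (cst 0%E) (cst 1%E) _ _ _ _ _.
  case => //.
  - by move=> n; apply/measurable_EFinP; exact: measurable_trunc_dist.
  - apply: aeW => x _.
    apply: cvg_EFin; first by apply: nearW.
    have /fine_cvgP[_ /cvgrPdist_le gx] := gid x I.
    apply/cvgrPdist_le => e1 e10; have := gx _ e10; apply: filterS => n.
    move=> /= ge; rewrite sub0r normrN ger0_norm ?trunc_dist_ge0 //; apply: le_trans ge.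
    by rewrite /trunc_dist ge_min lexx orbT.
  - by have := normal_integrable_cst (1 : R).
  - apply: aeW => x n _ /=; rewrite lee_fin ger0_norm ?trunc_dist_ge0 //.
    exact: trunc_dist_le1.
  move=> _ _; rewrite integral0.
  apply: cvg_trans; rewrite (_ : (fun n => _) = (fun n => \int[N]_x (trunc_dist x (g n x))%:E)%E) //.
  by apply/funext => n; rewrite EFin_gmean //; exact: trunc_dist_integrable.
have /fine_cvgP[_ /cvgrPdist_le/(_ e e0)] := cg0.
case=> n _ /(_ n (leqnn n)) /=; rewrite sub0r normrN => ge.
exists (g n), (finmap.enum_fset (fset_set (range (g n)))); split => //.
- exact: finmap.fset_uniq.
- by move=> x; rewrite in_fset_set ?inE //; exists x.
- exact: le_trans (ler_norm _) ge.
Qed.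

End Discretization.

Section FiniteRange.
Context {d : measure_display} {T : measurableType d} {R : realType}.
Variable P : probability T R.

Lemma Rintegral_finite_range (S : eqType) (q : T -> S) (s : seq S) (g : S -> R) :
  (forall c, measurable (q @^-1` [set c])) -> uniq s -> (forall x, q x \in s) ->
  \int[P]_x g (q x) = \sum_(c <- s) g c * fine (P (q @^-1` [set c])).
Proof.
move=> mq us qs.
have E x : g (q x) = \sum_(c <- s) g c * \1_(q @^-1` [set c]) x.
  rewrite (bigD1_seq (q x)) //= big1 ?addr0.
    by rewrite indicE mem_set // mulr1.
  by move=> c cq; rewrite indicE memNset ?mulr0 //= => /esym/eqP; rewrite (negbTE cq).
rewrite /Rintegral; under eq_integral do rewrite E -sumEFin.
rewrite integral_sum //; last first.
  move=> c; under eq_fun do rewrite EFinM; apply: integrableZl => //.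
  exact: integrable_indic.
transitivity (fine (\sum_(c <- s) (g c * fine (P (q @^-1` [set c])))%:E)%E).
  congr fine; apply: eq_bigr => c _.
  under eq_integral do rewrite EFinM.
  rewrite integralZl //; last exact: integrable_indic.
  by rewrite integral_indic // setIT EFinM fineK //; exact: fin_num_measure.
by rewrite sumEFin.
Qed.

End FiniteRange.

(** * Heat flow along the coordinates *)

Section GaussianSmoothing.
Context {R : realType} {I : finType}.
Implicit Types (F G : (I -> R) -> R) (z : I -> R) (i j : I) (s t a b M : R).
Local Notation N := (@normal_prob R 0 1).

Definition nudge i a z : I -> R := fun j => z j + (if j == i then a else 0).

Lemma nudgeC i j a b z : nudge i a (nudge j b z) = nudge j b (nudge i a z).
Proof. by apply/funext => k; rewrite /nudge addrAC. Qed.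

Lemma nudgeD i a b z : nudge i a (nudge i b z) = nudge i (b + a) z.
Proof. by apply/funext => k; rewrite /nudge -addrA; case: eqP; rewrite ?addr0. Qed.

Lemma nudge0 i z : nudge i 0 z = z.
Proof. by apply/funext => k; rewrite /nudge; case: eqP; rewrite addr0. Qed.

Definition bounded_lipschitz M F :=
  (forall z, `|F z| <= M) /\
  (forall z z', `|F z - F z'| <= M * \sum_i `|z i - z' i|).

Lemma bl_ge0 M F : bounded_lipschitz M F -> 0 <= M.
Proof. by move=> [FM _]; apply: le_trans (FM (fun=> 0)). Qed.

Lemma sum_nudge_dist i a b z z' :
  \sum_j `|nudge i a z j - nudge i b z' j| <= \sum_j `|z j - z' j| + `|a - b|.
Proof.
rewrite (bigD1 i) //= [X in _ <= X + _](bigD1 i) //= [leRHS]addrAC.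
have E : \sum_(j | j != i) `|nudge i a z j - nudge i b z' j| =
         \sum_(j | j != i) `|z j - z' j|.
  by apply: eq_bigr => j /negbTE ji; rewrite /nudge ji !addr0.
rewrite E lerD2r /nudge eqxx.
rewrite (_ : _ - _ = (z i - z' i) + (a - b)); last by ring.
exact: ler_normD.
Qed.

Lemma bl_line M F i z : bounded_lipschitz M F ->
  bounded_lipschitz1 M (fun x => F (nudge i x z)).
Proof.
move=> FM; split=> [x|x y]; first exact: FM.1.
apply: (le_trans (FM.2 _ _)); rewrite ler_wpM2l ?(bl_ge0 FM) //.
apply: (le_trans (sum_nudge_dist _ _ _ _ _)).
by rewrite big1 ?add0r // => j _; rewrite subrr normr0.
Qed.

Lemma bl_nudge M F i a : bounded_lipschitz M F ->
  bounded_lipschitz M (fun z => F (nudge i a z)).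
Proof.
move=> FM; split=> [z|z z']; first exact: FM.1.
apply: (le_trans (FM.2 _ _)); rewrite ler_wpM2l ?(bl_ge0 FM) //.
by apply: (le_trans (sum_nudge_dist _ _ _ _ _)); rewrite subrr normr0 addr0.
Qed.

(** Heat flow along the coordinate [i]: the mean of [F] when an independent
    centred Gaussian variable of standard deviation [s] is added to [z i]. *)
Definition smooth s i F : (I -> R) -> R :=
  fun z => gmean (fun x => F (nudge i (s * x) z)).

Lemma bl_smooth_line M F i s z : `|s| <= 1 -> bounded_lipschitz M F ->
  bounded_lipschitz1 M (fun x => F (nudge i (s * x) z)).
Proof.
move=> s1 FM; have := @bl1_affine _ M _ s 0 s1 (bl_line i z FM).
by under eq_fun do rewrite add0r.
Qed.

Lemma smooth_integrable M F i s z : `|s| <= 1 -> bounded_lipschitz M F ->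
  N.-integrable setT (EFin \o (fun x => F (nudge i (s * x) z))).
Proof. by move=> s1 FM; exact: bl1_integrable (bl_smooth_line i z s1 FM). Qed.

Lemma bl_smooth M F i s : `|s| <= 1 -> bounded_lipschitz M F ->
  bounded_lipschitz M (smooth s i F).
Proof.
move=> s1 FM; split=> [z|z z'].
  have := @gmean_dist _ (fun x => F (nudge i (s * x) z)) (cst 0) (cst M).
  rewrite !gmean_cst subr0; apply; do ?exact: normal_integrable_cst.
    exact: smooth_integrable FM.
  by move=> x; rewrite /= subr0; exact: FM.1.
have := @gmean_dist _ (fun x => F (nudge i (s * x) z))
  (fun x => F (nudge i (s * x) z')) (cst (M * \sum_j `|z j - z' j|)).
rewrite gmean_cst; apply; do ?exact: smooth_integrable FM.
  exact: normal_integrable_cst.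
by move=> x; exact: (bl_nudge i (s * x) FM).2.
Qed.

Lemma smooth_le M M' F G i s : `|s| <= 1 ->
  bounded_lipschitz M F -> bounded_lipschitz M' G ->
  (forall z, F z <= G z) -> forall z, smooth s i F z <= smooth s i G z.
Proof.
move=> s1 FM GM FG z; apply: gmean_le => //; [exact: smooth_integrable FM|].
exact: smooth_integrable GM.
Qed.

Lemma smoothDc M F i s c : `|s| <= 1 -> bounded_lipschitz M F ->
  forall z, smooth s i (fun z => F z + c) z = smooth s i F z + c.
Proof. by move=> s1 FM z; exact: gmeanDc (bl_smooth_line i z s1 FM). Qed.

(** The semigroup property of the heat flow: variances add up. *)
Lemma smooth_stable M F i s t : 0 < s <= 1 -> 0 < t <= 1 ->
  Num.sqrt (s ^+ 2 + t ^+ 2) <= 1 -> bounded_lipschitz M F ->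
  smooth s i (smooth t i F) = smooth (Num.sqrt (s ^+ 2 + t ^+ 2)) i F.
Proof.
move=> s1 t1 r1 FM; apply/funext => z; rewrite /smooth.
have := @gmean_stable _ M (fun x => F (nudge i x z)) s t s1 t1 (bl_line i z FM) r1.
by move=> <-; congr gmean; apply/funext => x; congr gmean; apply/funext => y; rewrite nudgeD.
Qed.

Lemma bl_trunc_dist M F i s x y z : `|s| <= 1 -> bounded_lipschitz M F ->
  `|F (nudge i (s * x) z) - F (nudge i (s * y) z)| <= 2 * M * trunc_dist x y.
Proof.
move=> s1 FM; have M0 := bl_ge0 FM.
have h1 : `|F (nudge i (s * x) z) - F (nudge i (s * y) z)| <= M * `|x - y|.
  have := (bl_smooth_line i z s1 FM).2 x y; exact.
have h2 : `|F (nudge i (s * x) z) - F (nudge i (s * y) z)| <= 2 * M.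
  apply: (le_trans (ler_normB _ _)); rewrite mulr2n mulrDl mul1r.
  by apply: lerD; exact: FM.1.
rewrite /trunc_dist /Num.min; case: ifP => _; first by rewrite mulr1.
apply: (le_trans h1); rewrite ler_wpM2r // mulr2n mulrDl mul1r.
by rewrite lerDl.
Qed.

Lemma smooth_discretize M F i s (q : R -> R) z : `|s| <= 1 ->
  bounded_lipschitz M F -> measurable_fun setT q ->
  `|smooth s i F z - gmean (fun x => F (nudge i (s * q x) z))| <=
  2 * M * gmean (fun x => trunc_dist x (q x)).
Proof.
move=> s1 FM mq; have it := trunc_dist_integrable mq.
rewrite -gmeanZ //; apply: gmean_dist.
- exact: smooth_integrable FM.
- apply: (@normal_bounded_integrable _ _ M); last by move=> x; exact: FM.1.
  apply: (measurableT_comp (f := fun x => F (nudge i (s * x) z))) => //.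
  exact: bl1_measurable (bl_smooth_line i z s1 FM).
- by have := integrableZl measurableT (2 * M) it.
- by move=> x; exact: bl_trunc_dist.
Qed.

(** Fubini's theorem for two coordinates.  Replacing the Gaussian variables by
    finite-valued approximations turns both iterated integrals into the same
    finite sum, up to an error that the Lipschitz constant controls. *)
Lemma smoothC M F i j s t : `|s| <= 1 -> `|t| <= 1 -> bounded_lipschitz M F ->
  smooth s i (smooth t j F) = smooth t j (smooth s i F).
Proof.
move=> s1 t1 FM; apply/funext => z; apply/eqP; rewrite -subr_eq0 -normr_le0.
have M0 := bl_ge0 FM.
apply/ler_addgt0Pl => e e0; rewrite addr0.
have e1 : 0 < e / (8 * M + 1) by rewrite divr_gt0 // ltr_wpDl // mulr_ge0.
have [q [S [mq uS qS qe]]] := exists_discretization e1.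
have mq' c : measurable (q @^-1` [set c]).
  by rewrite -[_ @^-1` _]setTI; exact: mq.
pose p c : R := fine (N (q @^-1` [set c])).
have qsum (g : R -> R) : gmean (fun x => g (q x)) = \sum_(c <- S) g c * p c.
  exact: (@Rintegral_finite_range _ _ _ (normal_prob 0 1) _ q S g mq' uS qS).
have p0 c : 0 <= p c by rewrite fine_ge0.
have p1 : \sum_(c <- S) p c = 1.
  by have := qsum (fun=> 1); rewrite gmean_cst => ->; apply: eq_bigr => c _; rewrite mul1r.
pose D := 2 * M * (e / (8 * M + 1)).
have approx a b k l : `|a| <= 1 -> `|b| <= 1 ->
    `|smooth a k (smooth b l F) z -
      \sum_(c <- S) (\sum_(c' <- S) F (nudge l (b * c') (nudge k (a * c) z)) * p c') * p c|
      <= D + D.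
  move=> a1 b1.
  have := @smooth_discretize M (smooth b l F) k a q z a1 (bl_smooth l b1 FM) mq.
  rewrite (qsum (fun c => smooth b l F (nudge k (a * c) z))) => h1.
  rewrite -[X in X - _](subrK (\sum_(c <- S) smooth b l F (nudge k (a * c) z) * p c)).
  rewrite -addrA; apply: (le_trans (ler_normD _ _)); apply: lerD.
    by apply: (le_trans h1); rewrite ler_wpM2l // mulr_ge0.
  rewrite -sumrB; apply: (le_trans (ler_norm_sum _ _ _)).
  rewrite -[leRHS]mulr1 -p1 mulr_sumr; apply: ler_sum => c _.
  rewrite -mulrBl normrM (ger0_norm (p0 c)) ler_wpM2r //.
  rewrite -(qsum (fun c' => F (nudge l (b * c') (nudge k (a * c) z)))).
  have h2 := smooth_discretize l (nudge k (a * c) z) b1 FM mq.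
  rewrite (le_trans h2) //; by rewrite ler_wpM2l // mulr_ge0.
have h1 := approx s t i j s1 t1; have h2 := approx t s j i t1 s1.
have E : \sum_(c <- S) (\sum_(c' <- S) F (nudge j (t * c') (nudge i (s * c) z)) * p c') * p c
  = \sum_(c <- S) (\sum_(c' <- S) F (nudge i (s * c') (nudge j (t * c) z)) * p c') * p c.
  under eq_bigr do rewrite mulr_suml.
  under [RHS]eq_bigr do rewrite mulr_suml.
  rewrite exchange_big /=; apply: eq_bigr => c _; apply: eq_bigr => c' _.
  by rewrite nudgeC -!mulrA (mulrC (p c)).
rewrite E in h1; rewrite distrC in h2.
apply: (le_trans (ler_distD _ _ _)); apply: (le_trans (lerD h1 h2)).
rewrite /D [leLHS](_ : _ = (8 * M) * e / (8 * M + 1)); last by field; rewrite gt_eqF // ltr_wpDl // mulr_ge0.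
by rewrite ler_pdivrMr ?ltr_wpDl ?mulr_ge0 // mulrDr mulr1 mulrC lerDl ltW.
Qed.

End GaussianSmoothing.

(** * Comparison of heat flows *)

Section Taylor.
Context {R : realType}.

Lemma mvt_bound (f f' : R -> R) (K t : R) :
  (forall x : R, is_derive x 1 f (f' x)) ->
  (forall x, `|x| <= `|t| -> `|f' x| <= K) -> `|f t - f 0| <= K * `|t|.
Proof.
move=> df f'K.
have cf : continuous f.
  move=> x; apply: differentiable_continuous; apply/derivable1_diffP.
  by have [] := df x.
have [t0|t0] := leP 0 t.
- have [c] := MVT_segment t0 (fun x _ => df x) (continuous_subspaceT cf).
  rewrite in_itv /= => /andP[c0 ct] ->; rewrite subr0 normrM ler_wpM2r //.
  by apply: f'K; rewrite !ger0_norm.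
- have [c] := MVT_segment (ltW t0) (fun x _ => df x) (continuous_subspaceT cf).
  rewrite in_itv /= => /andP[ct c0]; rewrite distrC => ->.
  rewrite sub0r normrM normrN ler_wpM2r //.
  by apply: f'K; rewrite !ler0_norm ?lerN2 // ltW.
Qed.

Lemma taylor2 (f f1 f2 : R -> R) (M t : R) :
  (forall x : R, is_derive x 1 f (f1 x)) -> (forall x : R, is_derive x 1 f1 (f2 x)) ->
  (forall x : R, `|f2 x - f2 0| <= M * `|x|) ->
  `|f t - (f 0 + t * f1 0 + t ^+ 2 / 2 * f2 0)| <= M * `|t| ^+ 3.
Proof.
move=> d1 d2 L.
have M0 : 0 <= M by have := L 1; rewrite normr1 mulr1; apply: le_trans.
have b1 x : `|x| <= `|t| -> `|f1 x - f1 0 - x * f2 0| <= M * `|t| ^+ 2.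
  move=> xt.
  have dr (y : R) : is_derive y 1 (fun y => f1 y - y * f2 0) (f2 y - f2 0).
    by apply: is_derive_eq; rewrite /GRing.scale /=; ring.
  have := @mvt_bound _ _ (M * `|t|) x dr.
  rewrite mul0r subr0 addrAC => /(_ _)/le_trans; apply.
    move=> y yx; apply: (le_trans (L y)); rewrite ler_wpM2l //; exact: le_trans yx xt.
  by rewrite -mulrA ler_wpM2l // expr2 ler_wpM2l.
have dr (y : R) : is_derive y 1 (fun y => f y - (y * f1 0 + y ^+ 2 / 2 * f2 0))
    (f1 y - f1 0 - y * f2 0).
  apply: is_derive_eq; rewrite /GRing.scale /= !mulr0 !mulr1 add0r; lra.
have := mvt_bound dr b1; rewrite (_ : M * `|t| ^+ 3 = M * `|t| ^+ 2 * `|t|); last by ring.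
congr (`|_| <= _); by ring.
Qed.

End Taylor.

Section SecondOrder.
Context {R : realType} {I : finType}.
Implicit Types (F : (I -> R) -> R) (z : I -> R) (i j : I) (s t M : R).
Local Notation N := (@normal_prob R 0 1).

Definition smooths s (l : seq I) F := foldr (smooth s) F l.

Lemma bl_smooths M s l F : `|s| <= 1 -> bounded_lipschitz M F ->
  bounded_lipschitz M (smooths s l F).
Proof. by move=> s1 FM; elim: l => //= i l IH; apply: bl_smooth. Qed.

Lemma smooths_le M M' F G s l : `|s| <= 1 ->
  bounded_lipschitz M F -> bounded_lipschitz M' G ->
  (forall z, F z <= G z) -> forall z, smooths s l F z <= smooths s l G z.
Proof.
move=> s1 FM GM FG; elim: l => //= i l IH.
by apply: (@smooth_le _ _ M M') => //; exact: bl_smooths.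
Qed.

Lemma smoothsDc M F s l c : `|s| <= 1 -> bounded_lipschitz M F ->
  smooths s l (fun z => F z + c) = (fun z => smooths s l F z + c).
Proof.
move=> s1 FM; elim: l => //= i l ->.
by apply/funext => z; rewrite (smoothDc _ _ s1 (bl_smooths l s1 FM)).
Qed.

Lemma smooth_smoothsC M F s t i l : `|s| <= 1 -> `|t| <= 1 ->
  bounded_lipschitz M F ->
  smooth s i (smooths t l F) = smooths t l (smooth s i F).
Proof.
move=> s1 t1 FM; elim: l => //= j l <-.
by rewrite (smoothC _ _ s1 t1 (bl_smooths l t1 FM)).
Qed.

Lemma smoothsC M F s t k l : `|s| <= 1 -> `|t| <= 1 ->
  bounded_lipschitz M F ->
  smooths s k (smooths t l F) = smooths t l (smooths s k F).
Proof.
move=> s1 t1 FM; elim: k => //= i k ->.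
by rewrite (smooth_smoothsC _ _ s1 t1 (bl_smooths k s1 FM)).
Qed.

Lemma smooths_stable M F s t l : 0 < s <= 1 -> 0 < t <= 1 ->
  Num.sqrt (s ^+ 2 + t ^+ 2) <= 1 -> bounded_lipschitz M F ->
  smooths s l (smooths t l F) = smooths (Num.sqrt (s ^+ 2 + t ^+ 2)) l F.
Proof.
move=> s01 t01 r1 FM; elim: l => //= i l IH.
have s1 : `|s| <= 1 by case/andP: s01 => s0 s1; rewrite gtr0_norm.
have t1 : `|t| <= 1 by case/andP: t01 => t0 t1; rewrite gtr0_norm.
rewrite -(smooth_smoothsC _ _ t1 s1 (bl_smooths l t1 FM)) IH.
rewrite (@smooth_stable _ _ M) //; apply: bl_smooths => //.
by rewrite ger0_norm // sqrtr_ge0.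
Qed.

Lemma iter_smooths M F s l k : 0 < s -> s * Num.sqrt k.+1%:R <= 1 ->
  bounded_lipschitz M F ->
  iter k.+1 (smooths s l) F = smooths (s * Num.sqrt k.+1%:R) l F.
Proof.
move=> s0 + FM; elim: k => [|k IH] sk; first by rewrite sqrtr1 mulr1.
have k0 : 0 < Num.sqrt k.+1%:R :> R by rewrite sqrtr_gt0.
have kk : Num.sqrt k.+1%:R <= Num.sqrt k.+2%:R :> R by rewrite ler_wsqrtr // ler_nat.
have sk1 : s * Num.sqrt k.+1%:R <= 1 by apply: le_trans sk; rewrite ler_wpM2l // ltW.
have s1 : s <= 1.
  apply: le_trans sk; apply: ler_peMr; first exact: ltW.
  by rewrite -[X in X <= _]sqrtr1 ler_wsqrtr // ler1n.
have E : Num.sqrt (s ^+ 2 + (s * Num.sqrt k.+1%:R) ^+ 2) = s * Num.sqrt k.+2%:R.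
  rewrite exprMn sqr_sqrtr // -[X in X + _]mulr1 -mulrDr nat1r.
  by rewrite sqrtrM ?sqr_ge0 // sqrtr_sqr gtr0_norm.
rewrite iterS IH // (@smooths_stable M) ?E //.
- by rewrite s0.
- by rewrite sk1 mulr_gt0.
Qed.

(** What a second-order Taylor expansion of [F] with uniform remainder requires: [F2] is
    Lipschitz, with the same constant [M] along every coordinate. *)
Record second_order F (F1 F2 : I -> (I -> R) -> R) (M : R) := SecondOrder {
  so_derive1 : forall i z (t : R), is_derive t 1 (fun t => F (nudge i t z)) (F1 i (nudge i t z));
  so_derive2 : forall i z (t : R), is_derive t 1 (fun t => F1 i (nudge i t z)) (F2 i (nudge i t z));
  so_bl : bounded_lipschitz M F;
  so_bl2 : forall i, bounded_lipschitz M (F2 i) }.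

(** The variance of the standard Gaussian law.  Its value cancels out, being a factor
    common to the generators that are compared. *)
Definition gvar : R := gmean (fun x => x ^+ 2).

Lemma gvar_ge0 : 0 <= gvar.
Proof. by apply: Rintegral_ge0 => x _; exact: sqr_ge0. Qed.

Lemma gvar_coef_ge0 s : 0 <= s ^+ 2 * gvar / 2.
Proof.
by apply: divr_ge0 => //; apply: mulr_ge0; [exact: sqr_ge0|exact: gvar_ge0].
Qed.

Lemma norm_le_cube (x : R) : `|x| <= 1 + `|x| ^+ 3.
Proof.
set y := `|x|; have y0 : 0 <= y by rewrite normr_ge0.
have : 0 <= y * (y - 1) ^+ 2 by rewrite mulr_ge0 // sqr_ge0.
have : 0 <= (y - 1) ^+ 2 by exact: sqr_ge0.
nra.
Qed.

Lemma sqr_le_cube (x : R) : x ^+ 2 <= 1 + `|x| ^+ 3.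
Proof.
rewrite -[x ^+ 2]ger0_norm ?sqr_ge0 // normrX.
set y := `|x|; have y0 : 0 <= y by rewrite normr_ge0.
have : 0 <= y * (y - 1) ^+ 2 by rewrite mulr_ge0 // sqr_ge0.
have : 0 <= (y - 1) ^+ 2 by exact: sqr_ge0.
nra.
Qed.

(** Second-order expansion of the heat flow over short times: the first-order
    terms vanish because the Gaussian law is centred. *)
Lemma smooths_expansion F (F1 F2 : I -> (I -> R) -> R) M l : second_order F F1 F2 M ->
  exists2 C, 0 <= C & forall s z, 0 < s <= 1 ->
  `|smooths s l F z - (F z + s ^+ 2 * gvar / 2 * \sum_(i <- l) F2 i z)| <= C * s ^+ 3.
Proof.
move=> so; have M0 := bl_ge0 (so_bl so).
elim: l => [|i l [C C0 IH]].
  exists 0 => // s z _; by rewrite big_nil mulr0 addr0 subrr normr0 mul0r.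
(* The three terms bound the error of the induction hypothesis, the Taylor remainder
   along [i], and the variation of the other second derivatives along [i]. *)
pose K := C + M + gvar / 2 * (size l)%:R * M.
have K0 : 0 <= K.
  rewrite /K; apply: addr_ge0; first exact: addr_ge0.
  do 2 apply: mulr_ge0 => //; apply: divr_ge0 => //. exact: gvar_ge0.
pose k (x : R) := 1 + `|x| ^+ 3.
have mk : measurable_fun [set: R] k.
  apply: measurable_funD => //; apply: measurable_funX.
  exact: normr_measurable.
have k0 x : 0 <= k x by rewrite addr_ge0 // exprn_ge0.
have ik : N.-integrable setT (EFin \o k).
  apply: (@normal_poly_integrable _ k 1) => // x.
  by rewrite mul1r ger0_norm.
exists (K * gmean k); first by rewrite mulr_ge0 // Rintegral_ge0.
move=> s z /andP[s0 s1]; have sn : `|s| <= 1 by rewrite gtr0_norm.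
have ix : N.-integrable setT (EFin \o (fun x : R => x)).
  apply: (@normal_poly_integrable _ (fun x => x) 1) => // x.
  by rewrite mul1r norm_le_cube.
have ix2 : N.-integrable setT (EFin \o (fun x : R => x ^+ 2)).
  apply: (@normal_poly_integrable _ (fun x => x ^+ 2) 1) => // x.
  by rewrite mul1r ger0_norm ?sqr_ge0 // sqr_le_cube.
pose c := F z + s ^+ 2 * gvar / 2 * \sum_(j <- l) F2 j z.
pose h (x : R) := (s * F1 i z) * x + (s ^+ 2 / 2 * F2 i z) * x ^+ 2 + c.
have ia : N.-integrable setT (EFin \o (fun x : R => (s * F1 i z) * x)).
  by have := integrableZl measurableT (s * F1 i z) ix.
have ib : N.-integrable setT (EFin \o (fun x : R => (s ^+ 2 / 2 * F2 i z) * x ^+ 2)).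
  by have := integrableZl measurableT (s ^+ 2 / 2 * F2 i z) ix2.
have iab : N.-integrable setT (EFin \o (fun x : R => (s * F1 i z) * x + (s ^+ 2 / 2 * F2 i z) * x ^+ 2)).
  by have := integrableD measurableT ia ib.
have ih : N.-integrable setT (EFin \o h).
  by have := integrableD measurableT iab (normal_integrable_cst c).
have Eh : gmean h = F z + s ^+ 2 * gvar / 2 * \sum_(j <- i :: l) F2 j z.
  rewrite /h (gmeanD iab (normal_integrable_cst c)) gmean_cst.
  rewrite (gmeanD ia ib) !gmeanZ // /gmean normal_mean0 mulr0 add0r.
  by rewrite -/(gmean _) -/gvar big_cons /c; ring.
rewrite -Eh (_ : K * gmean k * s ^+ 3 = (K * s ^+ 3) * gmean k); last by ring.
rewrite -gmeanZ //; apply: gmean_dist => //.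
- exact: smooth_integrable (bl_smooths l sn (so_bl so)).
- by have := integrableZl measurableT (K * s ^+ 3) ik.
suff key (x : R) : `|smooths s l F (nudge i (s * x) z) - h x| <= K * s ^+ 3 * k x.
  by move=> x; exact: key.
set y := nudge i (s * x) z.
have H1 := IH s y; rewrite s0 s1 in H1; move/(_ isT) in H1.
have H2 : `|F y - (F z + (s * x) * F1 i z + (s * x) ^+ 2 / 2 * F2 i z)| <= M * `|s * x| ^+ 3.
  have := taylor2 (s * x) (so_derive1 so i z) (so_derive2 so i z).
  rewrite !nudge0; apply => a; have := (bl_line i z (so_bl2 so i)).2 a 0.
  by rewrite !nudge0 subr0.
have H3 : `|\sum_(j <- l) F2 j y - \sum_(j <- l) F2 j z| <= (size l)%:R * (M * (s * `|x|)).
  rewrite -sumrB; apply: (le_trans (ler_norm_sum _ _ _)).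
  have <- : \sum_(j <- l) (M * (s * `|x|)) = (size l)%:R * (M * (s * `|x|)).
    by rewrite big_const_seq count_predT iter_addr_0 mulr_natl.
  apply: ler_sum => j _.
  have := (bl_line i z (so_bl2 so j)).2 (s * x) 0.
  by rewrite !nudge0 subr0 normrM (gtr0_norm s0).
rewrite (_ : _ - h x =
  (smooths s l F y - (F y + s ^+ 2 * gvar / 2 * \sum_(j <- l) F2 j y)) +
  (F y - (F z + (s * x) * F1 i z + (s * x) ^+ 2 / 2 * F2 i z)) +
  s ^+ 2 * gvar / 2 * (\sum_(j <- l) F2 j y - \sum_(j <- l) F2 j z)); last first.
  by rewrite /h /c; ring.
apply: (le_trans (ler_normD _ _)).
apply: (le_trans (lerD (ler_normD _ _) (lexx _))).
rewrite normrM (@ger0_norm _ (s ^+ 2 * gvar / 2)); last first.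
  exact: gvar_coef_ge0.
apply: (le_trans (lerD (lerD H1 H2) (ler_wpM2l _ H3))).
  exact: gvar_coef_ge0.
rewrite normrM (gtr0_norm s0).
have e1 : C * s ^+ 3 <= C * s ^+ 3 * k x.
  apply: ler_peMr; first by rewrite mulr_ge0 // exprn_ge0 // ltW.
  by rewrite /k lerDl exprn_ge0.
have e2 : M * (s * `|x|) ^+ 3 <= M * s ^+ 3 * k x.
  rewrite exprMn mulrA; apply: ler_wpM2l; first by rewrite mulr_ge0 // exprn_ge0 // ltW.
  by rewrite /k lerDr.
have e3 : s ^+ 2 * gvar / 2 * ((size l)%:R * (M * (s * `|x|))) <=
   gvar / 2 * (size l)%:R * M * s ^+ 3 * k x.
  rewrite (_ : s ^+ 2 * gvar / 2 * ((size l)%:R * (M * (s * `|x|))) =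
    gvar / 2 * (size l)%:R * M * s ^+ 3 * `|x|); last by ring.
  apply: ler_wpM2l; last exact: norm_le_cube.
  by rewrite !mulr_ge0 ?invr_ge0 ?gvar_ge0 ?exprn_ge0 // ltW.
apply: (le_trans (lerD (lerD e1 e2) e3)).
by rewrite -!mulrDl.
Qed.

(** Comparison principle.  If the generator of one heat flow is dominated by
    that of another at every point, then the flows compare at time one:
    cut the unit of time into [n] steps of length [1 / n]; commutation lets the
    steps be exchanged one by one, each exchange costing [O (n ^- (3 / 2))]. *)
Theorem smooths_comparison F (F1 F2 : I -> (I -> R) -> R) M l1 l2 : second_order F F1 F2 M ->
  (forall z, \sum_(i <- l1) F2 i z <= \sum_(i <- l2) F2 i z) ->
  forall z, smooths 1 l1 F z <= smooths 1 l2 F z.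
Proof.
move=> so le12; have FM := so_bl so.
have [C1 C10 H1] := smooths_expansion l1 so.
have [C2 C20 H2] := smooths_expansion l2 so.
have step s z : 0 < s <= 1 -> smooths s l1 F z <= smooths s l2 F z + (C1 + C2) * s ^+ 3.
  move=> s01; have := H1 s z s01; have := H2 s z s01.
  rewrite !ler_norml => /andP[a _] /andP[_ b].
  have : s ^+ 2 * gvar / 2 * \sum_(i <- l1) F2 i z <= s ^+ 2 * gvar / 2 * \sum_(i <- l2) F2 i z.
    apply: ler_wpM2l; last exact: le12.
    exact: gvar_coef_ge0.
  rewrite mulrDl; lra.
have iters s k : 0 < s <= 1 -> forall z,
    iter k (smooths s l1) F z <= iter k (smooths s l2) F z + k%:R * ((C1 + C2) * s ^+ 3).
  move=> s01; have sn : `|s| <= 1 by case/andP: s01 => s0 s1; rewrite gtr0_norm.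
  set e := (C1 + C2) * s ^+ 3.
  have bli l G (j : nat) : bounded_lipschitz M G -> bounded_lipschitz M (iter j (smooths s l) G).
    by move=> GM; elim: j => //= j IH; exact: bl_smooths.
  have blc G c : bounded_lipschitz M G -> bounded_lipschitz (M + `|c|) (fun z => G z + c).
    move=> GM; split=> [x|x y].
      by apply: (le_trans (ler_normD _ _)); rewrite lerD2r; exact: GM.1.
    rewrite opprD addrACA subrr addr0; apply: (le_trans (GM.2 _ _)).
    by rewrite ler_wpM2r ?sumr_ge0 // lerDl.
  have itc l (j : nat) G c : bounded_lipschitz M G ->
      iter j (smooths s l) (fun z => G z + c) = (fun z => iter j (smooths s l) G z + c).
    move=> GM; elim: j => //= j ->; exact: (smoothsDc l c sn (bli l G j GM)).
  have ile l (j : nat) G G' M1 M2 : bounded_lipschitz M1 G -> bounded_lipschitz M2 G' ->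
      (forall z, G z <= G' z) -> forall z, iter j (smooths s l) G z <= iter j (smooths s l) G' z.
    move=> GM GM' GG'.
    have b1 n : bounded_lipschitz M1 (iter n (smooths s l) G) by elim: n => //= n IH; exact: bl_smooths.
    have b2 n : bounded_lipschitz M2 (iter n (smooths s l) G') by elim: n => //= n IH; exact: bl_smooths.
    by elim: j => //= j IH; exact: (smooths_le l sn (b1 j) (b2 j)).
  have itC (j : nat) : smooths s l1 (iter j (smooths s l2) F) = iter j (smooths s l2) (smooths s l1 F).
    by elim: j => //= j <-; rewrite (smoothsC _ _ sn sn (bli l2 F j FM)).
  elim: k => [|k IH] z; first by rewrite mul0r addr0.
  rewrite iterS.
  apply: (le_trans (smooths_le l1 sn (bli l1 F k FM) (blc _ _ (bli l2 F k FM)) IH z)).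
  rewrite (smoothsDc _ _ sn (bli l2 F k FM)) itC -nat1r mulrDl mul1r addrA lerD2r.
  have := ile l2 k _ _ _ _ (bl_smooths l1 sn FM) (blc _ e (bl_smooths l2 sn FM)) (fun z => step s z s01) z.
  by rewrite itc; [rewrite -iterSr|exact: bl_smooths].
move=> z; apply/ler_addgt0Pr => e e0.
(* The [(k + 1) ^ 2] steps of standard deviation [1 / (k + 1)] cost
   [(C1 + C2) / (k + 1)] altogether. *)
pose k := Num.trunc ((C1 + C2) / e).
have ke : (C1 + C2) / k.+1%:R <= e.
  rewrite ler_pdivrMr // mulrC -ler_pdivrMr // ltW //.
  by apply: Num.Theory.truncnS_gt.
pose s : R := k.+1%:R^-1.
have s0 : 0 < s by rewrite invr_gt0.
have s1 : s <= 1 by rewrite invf_le1 // ler1n.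
have Esq : s * Num.sqrt ((k.+1 ^ 2)%N.-1.+1)%:R = 1.
  by rewrite prednK ?expn_gt0 // natrX sqrtr_sqr ger0_norm // mulVf.
have := iters s (k.+1 ^ 2)%N.-1.+1 _ z; rewrite s0 s1 => /(_ isT).
rewrite !(iter_smooths _ s0 _ FM) ?Esq //.
move/le_trans; apply; rewrite lerD2l; apply: le_trans ke.
rewrite prednK ?expn_gt0 // natrX /s [leLHS](_ : _ = (C1 + C2) / k.+1%:R) //.
have x0 : k.+1%:R != 0 :> R by rewrite pnatr_eq0.
by move: x0; set x := k.+1%:R => x0; field.
Qed.

End SecondOrder.

(** * Functions with bounded Lipschitz partial derivatives *)

Section Calculus.
Context {R : realType} {I : finType}.
Implicit Types (F G u : (I -> R) -> R) (z : I -> R) (i j : I).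

Definition Lip F := exists2 L, 0 <= L & forall z z', `|F z - F z'| <= L * \sum_i `|z i - z' i|.
Definition Bnd F := exists2 M, 0 <= M & forall z, `|F z| <= M.
Definition BL F := Bnd F /\ Lip F.

Lemma BL_bounded_lipschitz F : BL F <-> exists M, bounded_lipschitz M F.
Proof.
split=> [[[M M0 FM] [L L0 FL]]|[M FM]].
  exists (M + L); split=> [z|z z']; first by apply: (le_trans (FM z)); rewrite lerDl.
  by apply: (le_trans (FL z z')); rewrite ler_wpM2r ?sumr_ge0 // lerDr.
have M0 := bl_ge0 FM.
by split; exists M => //; case: FM.
Qed.

Lemma Lip_cst (c : R) : Lip (fun=> c).
Proof. by exists 0 => // z z'; rewrite subrr normr0 mul0r. Qed.

Lemma Lip_coord i : Lip (fun z => z i).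
Proof.
exists 1 => // z z'; rewrite mul1r (bigD1 i) //= lerDl; exact: sumr_ge0.
Qed.

Lemma LipD F G : Lip F -> Lip G -> Lip (fun z => F z + G z).
Proof.
move=> [L L0 FL] [L' L'0 GL]; exists (L + L'); first exact: addr_ge0.
move=> z z'; rewrite opprD addrACA mulrDl.
by apply: (le_trans (ler_normD _ _)); apply: lerD.
Qed.

Lemma LipZ (c : R) F : Lip F -> Lip (fun z => c * F z).
Proof.
move=> [L L0 FL]; exists (`|c| * L); first exact: mulr_ge0.
by move=> z z'; rewrite -mulrBr normrM -mulrA ler_wpM2l.
Qed.

Lemma Lip_sum (J : Type) (l : seq J) (f : J -> (I -> R) -> R) :
  (forall k, Lip (f k)) -> Lip (fun z => \sum_(k <- l) f k z).
Proof.
move=> fL; elim: l => [|k l IH].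
  by under eq_fun do rewrite big_nil; exact: Lip_cst.
by under eq_fun do rewrite big_cons; exact: LipD.
Qed.

Lemma BL_cst (c : R) : BL (fun=> c).
Proof. by split; [by exists (`|c|)%R | exact: Lip_cst]. Qed.

Lemma BLD F G : BL F -> BL G -> BL (fun z => F z + G z).
Proof.
move=> [[M M0 FM] FL] [[M' M'0 GM] GL]; split; last exact: LipD.
exists (M + M'); first exact: addr_ge0.
by move=> z; apply: (le_trans (ler_normD _ _)); apply: lerD.
Qed.

Lemma BLM F G : BL F -> BL G -> BL (fun z => F z * G z).
Proof.
move=> [[M M0 FM] [L L0 FL]] [[M' M'0 GM] [L' L'0 GL]]; split.
  exists (M * M'); first exact: mulr_ge0.
  by move=> z; rewrite normrM ler_pM.
exists (L * M' + M * L'); first by rewrite addr_ge0 // mulr_ge0.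
move=> z z'; set S := \sum_i _; have S0 : 0 <= S by exact: sumr_ge0.
rewrite (_ : _ - _ = (F z - F z') * G z + F z' * (G z - G z')); last by ring.
apply: (le_trans (ler_normD _ _)); rewrite !normrM.
rewrite (_ : (L * M' + M * L') * S = (L * S) * M' + M * (L' * S)); last by ring.
by apply: lerD; apply: ler_pM.
Qed.

Lemma BLZ (c : R) F : BL F -> BL (fun z => c * F z).
Proof. by apply: BLM; exact: BL_cst. Qed.

Lemma BLN F : BL F -> BL (fun z => - F z).
Proof. by move=> /(BLZ (-1)); under eq_fun do rewrite mulN1r. Qed.

Lemma BL_sum (J : Type) (l : seq J) (f : J -> (I -> R) -> R) :
  (forall k, BL (f k)) -> BL (fun z => \sum_(k <- l) f k z).
Proof.
move=> fL; elim: l => [|k l IH].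
  by under eq_fun do rewrite big_nil; exact: BL_cst.
by under eq_fun do rewrite big_cons; exact: BLD.
Qed.

Lemma BL_comp M (g : R -> R) u : bounded_lipschitz1 M g -> Lip u -> BL (fun z => g (u z)).
Proof.
move=> [gM gL] [L L0 uL].
have M0 : 0 <= M by apply: le_trans (gM 0).
split; first by exists M.
exists (M * L); first exact: mulr_ge0.
by move=> z z'; apply: (le_trans (gL _ _)); rewrite -mulrA ler_wpM2l.
Qed.

(** Unlike [second_order], this allows [F] to be unbounded, as the functions under the
    logistic are; and it bounds the first derivatives too, which makes it stable under
    products of bounded functions and under composition with the logistic. *)
Record partials F (F1 F2 : I -> (I -> R) -> R) := Partials {
  pt_derive1 : forall i z (t : R),
    is_derive t 1 (fun t => F (nudge i t z)) (F1 i (nudge i t z));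
  pt_derive2 : forall i z (t : R),
    is_derive t 1 (fun t => F1 i (nudge i t z)) (F2 i (nudge i t z));
  pt_bl1 : forall i, BL (F1 i);
  pt_bl2 : forall i, BL (F2 i) }.

Lemma partials_second_order F (F1 F2 : I -> (I -> R) -> R) :
  partials F F1 F2 -> BL F -> exists M, second_order F F1 F2 M.
Proof.
move=> pF /BL_bounded_lipschitz[M0 F0].
have /choice[M MF] : forall i, exists M, bounded_lipschitz M (F2 i).
  by move=> i; apply/BL_bounded_lipschitz; exact: pt_bl2 pF i.
have Mi i : 0 <= M i by exact: bl_ge0 (MF i).
have mono G (a b : R) : a <= b -> bounded_lipschitz a G -> bounded_lipschitz b G.
  move=> ab [GM GL]; split=> [z|z z']; first exact: le_trans (GM z) ab.
  by apply: (le_trans (GL z z')); rewrite ler_wpM2r // sumr_ge0.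
exists (M0 + \sum_i M i); split.
- exact: pt_derive1 pF.
- exact: pt_derive2 pF.
- by apply: mono F0; rewrite lerDl sumr_ge0.
- move=> i; apply: mono (MF i); rewrite (bigD1 i) //= addrCA lerDl.
  by rewrite addr_ge0 ?(bl_ge0 F0) // sumr_ge0.
Qed.

Lemma partials_mul F (F1 F2 : I -> (I -> R) -> R) G (G1 G2 : I -> (I -> R) -> R) :
  BL F -> BL G -> partials F F1 F2 -> partials G G1 G2 ->
  partials (fun z => F z * G z) (fun i z => F1 i z * G z + F z * G1 i z)
    (fun i z => F2 i z * G z + F z * G2 i z + 2 * (F1 i z * G1 i z)).
Proof.
move=> bF bG pF pG; split=> [i z t|i z t|i|i].
- have d1 := pt_derive1 pF i z t; have d2 := pt_derive1 pG i z t.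
  by apply: is_derive_eq; rewrite /GRing.scale /=; ring.
- have d1 := pt_derive1 pF i z t; have d2 := pt_derive1 pG i z t.
  have d3 := pt_derive2 pF i z t; have d4 := pt_derive2 pG i z t.
  by apply: is_derive_eq; rewrite /GRing.scale /=; ring.
- by apply: BLD; apply: BLM => //; [exact: pt_bl1 pF i|exact: pt_bl1 pG i].
- apply: BLD; last first.
    by apply: BLZ; apply: BLM; [exact: pt_bl1 pF i|exact: pt_bl1 pG i].
  by apply: BLD; apply: BLM => //; [exact: pt_bl2 pF i|exact: pt_bl2 pG i].
Qed.

Lemma partials_opp F (F1 F2 : I -> (I -> R) -> R) (c : R) :
  partials F F1 F2 ->
  partials (fun z => c - F z) (fun i z => - F1 i z) (fun i z => - F2 i z).
Proof.
move=> pF; split=> [i z t|i z t|i|i].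
- have d1 := pt_derive1 pF i z t.
  by apply: is_derive_eq; ring.
- have d1 := pt_derive2 pF i z t.
  by apply: is_derive_eq.
- exact: BLN (pt_bl1 pF i).
- exact: BLN (pt_bl2 pF i).
Qed.

(** A smooth approximation of the indicator of the positive half-line, with an
    exponential rate of approximation ([one_minus_logistic]). *)
Definition logistic (x : R) : R := (1 + expR (- x))^-1.

Lemma logistic_gt0 x : 0 < logistic x.
Proof. by rewrite invr_gt0 addr_gt0 // expR_gt0. Qed.

Lemma logistic_lt1 x : logistic x < 1.
Proof. by rewrite invf_lt1 ?addr_gt0 ?expR_gt0 // ltrDl expR_gt0. Qed.

Lemma logistic_le_half (x : R) : x <= 0 -> logistic x <= 2^-1.
Proof.
move=> x0; rewrite lef_pV2 ?posrE ?addr_gt0 ?expR_gt0 //.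
by rewrite (_ : 2 = 1 + 1 :> R) // lerD2l -expR0 ler_expR oppr_ge0.
Qed.

Lemma logistic_derive (x : R) :
  is_derive x 1 logistic (logistic x * (1 - logistic x)).
Proof.
have e0 : 1 + expR (- x) != 0 by rewrite gt_eqF // addr_gt0 // expR_gt0.
have dN : is_derive x 1 (fun x => expR (- x)) (- expR (- x)).
  have d1 : is_derive (- x) 1 (@expR R) (expR (- x)) by exact: is_derive_expR.
  have d2 : is_derive x 1 (fun x : R => - x) (-1).
    by apply: is_derive_eq.
  have d3 := @is_derive1_comp _ (@expR R) (fun x => - x) x _ _ d1 d2.
  by apply: (is_derive_eq d3); rewrite mulrN1.
have d3 : is_derive x 1 (fun x => 1 + expR (- x)) (- expR (- x)).
  by apply: is_derive_eq; rewrite /GRing.scale /=; ring.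
have d4 := @is_deriveV _ (fun x => 1 + expR (- x)) x _ 1 e0 d3.
apply: (is_derive_eq d4).
by rewrite /logistic /GRing.scale /=; field.
Qed.

Lemma logistic_bl : bounded_lipschitz1 1 logistic.
Proof.
split=> [x|x y]; first by rewrite gtr0_norm ?logistic_gt0 // ltW // logistic_lt1.
have d (t : R) : is_derive t 1 (fun t => logistic (y + t))
    (logistic (y + t) * (1 - logistic (y + t))).
  have d1 := logistic_derive (y + t).
  have d2 : is_derive t 1 (fun t => y + t) 1 by apply: is_derive_eq; ring.
  have d3 := @is_derive1_comp _ logistic (fun t => y + t) t _ _ d1 d2.
  by apply: (is_derive_eq d3); rewrite mulr1.
have := @mvt_bound _ _ _ 1 (x - y) d; rewrite addr0 (addrC y) subrK; apply => t _.
have := logistic_gt0 (y + t); have := logistic_lt1 (y + t).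
set l := logistic _ => l1 l0; rewrite ger0_norm; nra.
Qed.

Lemma one_minus_logistic x : 1 - logistic x <= expR (- x).
Proof.
have e0 := expR_gt0 (- x); rewrite /logistic lerBlDr -lerBlDl.
rewrite -[leLHS]mulr1 -[X in _ * X](@mulfV _ (1 + expR (- x))) ?gt_eqF ?addr_gt0 //.
rewrite mulrA ler_piMl ?invr_ge0 ?addr_ge0 ?ltW //.
nra.
Qed.

Lemma partials_logistic u (u1 u2 : I -> (I -> R) -> R) :
  Lip u -> partials u u1 u2 ->
  let L z := logistic (u z) in
  partials L (fun i z => L z * (1 - L z) * u1 i z)
   (fun i z => L z * (1 - L z) * ((1 - 2 * L z) * u1 i z ^+ 2 + u2 i z)).
Proof.
move=> Lu pu L.
have bL : BL L by exact: BL_comp logistic_bl Lu.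
have bL1 : BL (fun z => 1 - L z) by apply: BLD; [exact: BL_cst|exact: BLN].
have bL2 : BL (fun z => 1 - 2 * L z).
  by apply: BLD; [exact: BL_cst|apply: BLN; exact: BLZ].
have dL i z (t : R) : is_derive t 1 (fun t => L (nudge i t z))
    (L (nudge i t z) * (1 - L (nudge i t z)) * u1 i (nudge i t z)).
  have d1 := logistic_derive (u (nudge i t z)).
  exact: (@is_derive1_comp _ _ _ _ _ _ d1 (pt_derive1 pu i z t)).
split=> [i z t|i z t|i|i].
- exact: dL.
- have d1 := dL i z t; have d2 := pt_derive2 pu i z t.
  by apply: is_derive_eq; rewrite /GRing.scale /=; ring.
- by apply: BLM; [exact: BLM|exact: pt_bl1 pu i].
- apply: BLM; first exact: BLM.
  apply: BLD; last exact: pt_bl2 pu i.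
  by apply: BLM => //; under eq_fun do rewrite expr2; apply: BLM; exact: pt_bl1 pu i.
Qed.

End Calculus.

(** * The Euclidean norm *)

Section EuclideanNorm.
Context {R : realType}.

Lemma dot_le1 (J : finType) (p q : J -> R) :
  \sum_i p i ^+ 2 <= 1 -> \sum_i q i ^+ 2 <= 1 -> \sum_i p i * q i <= 1.
Proof.
move=> p1 q1; rewrite -(ler_pM2l (ltr0n _ 2)) mulr1.
apply: (@le_trans _ _ (\sum_i p i ^+ 2 + \sum_i q i ^+ 2)); last by lra.
rewrite -big_split /= mulr_sumr; apply: ler_sum => i _.
have := sqr_ge0 (p i - q i); rewrite -subr_ge0; nra.
Qed.

Definition norm2 (k : nat) (v : 'I_k -> R) : R := Num.sqrt (\sum_i v i ^+ 2).

Lemma norm2_ge0 k (v : 'I_k -> R) : 0 <= norm2 v.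
Proof. exact: sqrtr_ge0. Qed.

Lemma norm2_sqr k (v : 'I_k -> R) : norm2 v ^+ 2 = \sum_i v i ^+ 2.
Proof. by rewrite sqr_sqrtr // sumr_ge0 // => i _; exact: sqr_ge0. Qed.

Lemma cauchy_schwarz k (v w : 'I_k -> R) : \sum_i v i * w i <= norm2 v * norm2 w.
Proof.
have [v0|v0] := eqVneq (norm2 v) 0.
  rewrite v0 mul0r big1 // => i _.
  have : \sum_i v i ^+ 2 = 0 by rewrite -norm2_sqr v0 expr0n.
  move/psumr_eq0P => /(_ (fun i _ => sqr_ge0 (v i)) i isT)/eqP.
  by rewrite sqrf_eq0 => /eqP ->; rewrite mul0r.
have [w0|w0] := eqVneq (norm2 w) 0.
  rewrite w0 mulr0 big1 // => i _.
  have : \sum_i w i ^+ 2 = 0 by rewrite -norm2_sqr w0 expr0n.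
  move/psumr_eq0P => /(_ (fun i _ => sqr_ge0 (w i)) i isT)/eqP.
  by rewrite sqrf_eq0 => /eqP ->; rewrite mulr0.
have vp : 0 < norm2 v by rewrite lt_def v0 norm2_ge0.
have wp : 0 < norm2 w by rewrite lt_def w0 norm2_ge0.
have := @dot_le1 _ (fun i => v i / norm2 v) (fun i => w i / norm2 w).
have unit u : 0 < norm2 u -> \sum_(i < k) (u i / norm2 u) ^+ 2 <= 1.
  move=> u0; under eq_bigr do rewrite expr_div_n.
  by rewrite -mulr_suml -norm2_sqr mulfV // expf_neq0 // gt_eqF.
move=> /(_ (unit v vp) (unit w wp)).
under eq_bigr do rewrite mulrACA -invfM.
by rewrite -mulr_suml ler_pdivrMr ?mulr_gt0 // mul1r.
Qed.

Lemma sqrt_add_le (e v : R) : 0 <= e -> 0 <= v -> Num.sqrt (e ^+ 2 + v) <= e + Num.sqrt v.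
Proof.
move=> e0 v0; have s0 := sqrtr_ge0 v.
rewrite -[leRHS]ger0_norm ?addr_ge0 // -sqrtr_sqr ler_wsqrtr //.
have := sqr_sqrtr v0; set s := Num.sqrt v in s0 *; nra.
Qed.

Lemma le_norm2 (k : nat) (v w : 'I_k -> R) : (forall i, `|v i| <= `|w i|) -> norm2 v <= norm2 w.
Proof.
move=> vw; rewrite ler_wsqrtr // ler_sum // => i _.
by rewrite -[v i ^+ 2]ger0_norm ?sqr_ge0 // -[w i ^+ 2]ger0_norm ?sqr_ge0 // !normrX lerXn2r ?nnegrE.
Qed.

Lemma norm2Z (k : nat) (c : R) (v : 'I_k -> R) : norm2 (fun i => c * v i) = `|c| * norm2 v.
Proof.
rewrite /norm2; under eq_bigr do rewrite exprMn.
by rewrite -mulr_sumr sqrtrM ?sqr_ge0 // sqrtr_sqr.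
Qed.

Lemma norm2D (k : nat) (v w : 'I_k -> R) : norm2 (fun i => v i + w i) <= norm2 v + norm2 w.
Proof.
have s0 : 0 <= norm2 v + norm2 w by rewrite addr_ge0 ?norm2_ge0.
rewrite -[leRHS]ger0_norm // -sqrtr_sqr ler_wsqrtr //.
rewrite sqrrD !norm2_sqr.
have := cauchy_schwarz v w.
have -> : \sum_i (v i + w i) ^+ 2 = \sum_i v i ^+ 2 + \sum_i w i ^+ 2 + 2 * \sum_i v i * w i.
  by rewrite mulr_sumr -!big_split /=; apply: eq_bigr => i _; ring.
move=> h; rewrite mulr2n; lra.
Qed.

Definition unit_vector n (x : 'I_n -> R) := \sum_j x j ^+ 2 = 1.

Lemma unit_vector_norm2 n (x : 'I_n -> R) : unit_vector x <-> norm2 x = 1.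
Proof.
rewrite /unit_vector /norm2; split=> [->|h]; first exact: sqrtr1.
have S0 : 0 <= \sum_j x j ^+ 2 by apply: sumr_ge0 => j _; exact: sqr_ge0.
by rewrite -(sqr_sqrtr S0) h expr1n.
Qed.

Definition matvec m n (B : 'I_m -> 'I_n -> R) (x : 'I_n -> R) : 'I_m -> R :=
  fun i => \sum_j B i j * x j.

Definition basis_vector k (k0 : (0 < k)%N) : 'I_k -> R := fun j => (j == Ordinal k0)%:R.

Lemma basis_vector_unit k (k0 : (0 < k)%N) : unit_vector (basis_vector k0).
Proof.
rewrite /unit_vector (bigD1 (Ordinal k0)) //= /basis_vector eqxx expr1n.
by rewrite big1 ?addr0 // => j /negbTE ->; rewrite expr0n.
Qed.

End EuclideanNorm.

(** * Gordon's functional and its generators *)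

Section SmoothNorm.
Context {R : realType}.

(** Along a line the square of the smoothed norm is a quadratic polynomial, so this
    computes its first two derivatives in every direction. *)
Lemma sqrt_quadratic_derive (A B C t : R) : (forall t, 0 < A + 2 * t * B + t ^+ 2 * C) ->
  let q t := Num.sqrt (A + 2 * t * B + t ^+ 2 * C) in
  is_derive t 1 q ((B + t * C) / q t) /\
  is_derive t 1 (fun t => (B + t * C) / q t) ((q t)^-1 * (C - ((B + t * C) / q t) ^+ 2)).
Proof.
move=> q0 q.
have qt0 : 0 < q t by rewrite sqrtr_gt0.
have d1 : is_derive t 1 (fun t => A + 2 * t * B + t ^+ 2 * C) (2 * B + 2 * t * C).
  by apply: is_derive_eq; rewrite /GRing.scale /=; ring.
have d2 := @is_derive1_comp _ Num.sqrt (fun t => A + 2 * t * B + t ^+ 2 * C) t _ _ (is_derive1_sqrt (q0 t)) d1.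
have d3 : is_derive t 1 q ((B + t * C) / q t).
  apply: (is_derive_eq d2); rewrite -/(q t).
  by field; rewrite gt_eqF.
split=> //.
have qn0 : q t != 0 by rewrite gt_eqF.
have d4 : is_derive t 1 (fun t => B + t * C) C.
  by apply: is_derive_eq; rewrite /GRing.scale /=; ring.
have d5 := @is_deriveV _ q t _ 1 qn0 d3.
have d6 : is_derive t 1 (fun t => (B + t * C) * (q t)^-1) _ := is_deriveM d4 d5.
apply: (is_derive_eq d6); rewrite /GRing.scale /=.
by field.
Qed.

End SmoothNorm.

Section GordonFunction.
Context {R : realType} {m n : nat}.
Variables (eps K a : R).
Hypothesis eps0 : 0 < eps.
Local Notation I := ('I_m * 'I_n + unit + ('I_m + 'I_n))%type.
Implicit Types (z : I -> R) (x y : 'I_n -> R) (c : I).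

(** The coordinates of the space that carries both processes: the entries of the matrix
    [A], the scalar variable [gam], and the two vectors [g] and [h]. *)
Definition slotA (i : 'I_m) (j : 'I_n) : I := inl (inl (i, j)).
Definition slot0 : I := inl (inr tt).
Definition slotg (i : 'I_m) : I := inr (inl i).
Definition sloth (j : 'I_n) : I := inr (inr j).

(** For [z] made of [A], [gam], [g] and [h] these are [A x + g] and [gam + <h, x>].  Letting
    both processes enter the same expression makes them the values of one function, seen
    along two sets of coordinates. *)
Definition noisy_image x z (i : 'I_m) : R := \sum_j z (slotA i j) * x j + z (slotg i).
Definition noisy_offset x z : R := z slot0 + \sum_j z (sloth j) * x j.

(** The functions are affine in [z]: their partial derivatives do not depend on [z]. *)
Definition d_noisy_image x c (i : 'I_m) : R :=
  match c with
  | inl (inl ij) => if i == ij.1 then x ij.2 else 0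
  | inr (inl i') => if i == i' then 1 else 0
  | _ => 0
  end.
Definition d_noisy_offset x c : R :=
  match c with inl (inr _) => 1 | inr (inr j) => x j | _ => 0 end.

Lemma noisy_image_nudge x c t z i :
  noisy_image x (nudge c t z) i = noisy_image x z i + t * d_noisy_image x c i.
Proof.
rewrite /noisy_image /nudge; case: c => [[[i' j']|[]]|[i'|j']] /=.
- rewrite addr0 addrAC; congr (_ + _).
  under eq_bigr do rewrite mulrDl.
  rewrite big_split /=; congr (_ + _).
  under eq_bigr => j _ do rewrite (_ : _ == _ = (i == i') && (j == j')) //.
  case: eqP => [_|_] /=; last by rewrite mulr0 big1 // => j _; rewrite mul0r.
  rewrite (bigD1 j') //= eqxx big1 ?addr0 // => j /negbTE ->; exact: mul0r.
- by rewrite mulr0 !addr0; congr (_ + _); apply: eq_bigr => j _; rewrite addr0.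
- rewrite -addrA; congr (_ + _); first by apply: eq_bigr => j _; rewrite addr0.
  by congr (_ + _); rewrite (_ : _ == _ = (i == i')) //; case: eqP; rewrite ?mulr1 ?mulr0.
- by rewrite mulr0 !addr0; congr (_ + _); apply: eq_bigr => j _; rewrite addr0.
Qed.

Lemma noisy_offset_nudge x c t z :
  noisy_offset x (nudge c t z) = noisy_offset x z + t * d_noisy_offset x c.
Proof.
rewrite /noisy_offset /nudge; case: c => [[[i' j']|[]]|[i'|j']] /=.
- by rewrite mulr0 !addr0; congr (_ + _); apply: eq_bigr => j _; rewrite addr0.
- rewrite ?eqxx mulr1 addrAC; congr (_ + _ + _).
  by apply: eq_bigr => j _; rewrite addr0.
- by rewrite mulr0 !addr0; congr (_ + _); apply: eq_bigr => j _; rewrite addr0.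
- rewrite addr0 -addrA; congr (_ + _).
  under eq_bigr do rewrite mulrDl.
  rewrite big_split /=; congr (_ + _).
  under eq_bigr => j _ do rewrite (_ : _ == _ = (j == j')) //.
  by rewrite (bigD1 j') //= eqxx big1 ?addr0 // => j /negbTE ->; exact: mul0r.
Qed.

(** The Euclidean norm is not differentiable at [0]; [eps] removes the singularity. *)
Definition soft_norm x z : R := Num.sqrt (eps ^+ 2 + \sum_i noisy_image x z i ^+ 2).
Definition soft_dir x z i : R := noisy_image x z i / soft_norm x z.

Lemma soft_norm_ge_eps x z : eps <= soft_norm x z.
Proof.
rewrite /soft_norm -[leLHS](gtr0_norm eps0) -sqrtr_sqr ler_wsqrtr // lerDl.
by apply: sumr_ge0 => i _; exact: sqr_ge0.
Qed.

Lemma soft_norm_gt0 x z : 0 < soft_norm x z.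
Proof. exact: lt_le_trans eps0 (soft_norm_ge_eps x z). Qed.

Lemma soft_norm_sqr x z : soft_norm x z ^+ 2 = eps ^+ 2 + \sum_i noisy_image x z i ^+ 2.
Proof.
rewrite sqr_sqrtr // addr_ge0 ?sqr_ge0 //.
by apply: sumr_ge0 => i _; exact: sqr_ge0.
Qed.

Lemma noisy_image_le_soft_norm x z i : `|noisy_image x z i| <= soft_norm x z.
Proof.
rewrite /soft_norm -sqrtr_sqr ler_wsqrtr // (bigD1 i) //= addrCA lerDl addr_ge0 ?sqr_ge0 //.
by apply: sumr_ge0 => k _; exact: sqr_ge0.
Qed.

Lemma soft_dir_sqr_sum x z : \sum_i soft_dir x z i ^+ 2 <= 1.
Proof.
under eq_bigr do rewrite expr_div_n.
rewrite -mulr_suml ler_pdivrMr ?exprn_gt0 ?soft_norm_gt0 // mul1r soft_norm_sqr lerDr.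
exact: sqr_ge0.
Qed.

Lemma Lip_noisy_image x i : Lip (fun z => noisy_image x z i).
Proof.
apply: LipD; last exact: Lip_coord.
by apply: Lip_sum => j; under eq_fun do rewrite mulrC; apply: LipZ; exact: Lip_coord.
Qed.

Lemma Lip_noisy_offset x : Lip (noisy_offset x).
Proof.
apply: LipD; first exact: Lip_coord.
by apply: Lip_sum => j; under eq_fun do rewrite mulrC; apply: LipZ; exact: Lip_coord.
Qed.

Lemma soft_norm_dist x z z' :
  `|soft_norm x z - soft_norm x z'| <=
  \sum_i `|noisy_image x z i - noisy_image x z' i|.
Proof.
have s0 : 0 < soft_norm x z + soft_norm x z' by rewrite addr_gt0 ?soft_norm_gt0.
rewrite -(ler_pM2r s0) -[X in _ * X](gtr0_norm s0) -normrM.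
rewrite (_ : _ * _ = \sum_i (noisy_image x z i - noisy_image x z' i) *
    (noisy_image x z i + noisy_image x z' i)); last first.
  rewrite -subr_sqr !soft_norm_sqr opprD addrACA subrr add0r -sumrB.
  by apply: eq_bigr => i _; rewrite subr_sqr.
apply: (le_trans (ler_norm_sum _ _ _)); rewrite mulr_suml; apply: ler_sum => i _.
rewrite normrM ler_wpM2l //; apply: (le_trans (ler_normD _ _)).
by apply: lerD; exact: noisy_image_le_soft_norm.
Qed.

Lemma Lip_soft_norm x : Lip (soft_norm x).
Proof.
have [L L0 HL] : exists2 L, 0 <= L & forall z z',
    \sum_i `|noisy_image x z i - noisy_image x z' i| <= L * \sum_c `|z c - z' c|.
  have /choice[L HL] : forall i, exists L, 0 <= L /\
      forall z z', `|noisy_image x z i - noisy_image x z' i| <= L * \sum_c `|z c - z' c|.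
    by move=> i; have [L L0 HL] := Lip_noisy_image x i; exists L.
  exists (\sum_i L i); first by apply: sumr_ge0 => i _; exact: (HL i).1.
  by move=> z z'; rewrite mulr_suml; apply: ler_sum => i _; exact: (HL i).2.
by exists L => // z z'; apply: le_trans (HL z z'); exact: soft_norm_dist.
Qed.

Lemma BL_inv_soft_norm x : BL (fun z => (soft_norm x z)^-1).
Proof.
have r0 := soft_norm_gt0 x; have re := soft_norm_ge_eps x.
have ie z : (soft_norm x z)^-1 <= eps^-1 by rewrite lef_pV2 ?posrE.
split; first by exists eps^-1; [rewrite invr_ge0 ltW|move=> z; rewrite gtr0_norm ?invr_gt0].
have [L L0 HL] := Lip_soft_norm x; exists (L / eps ^+ 2).
  by rewrite divr_ge0 // sqr_ge0.
move=> z z'.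
have -> : (soft_norm x z)^-1 - (soft_norm x z')^-1 =
    (soft_norm x z' - soft_norm x z) * ((soft_norm x z)^-1 * (soft_norm x z')^-1).
  by field; rewrite !gt_eqF.
rewrite normrM distrC mulrAC expr2 invfM.
apply: ler_pM => //; rewrite gtr0_norm ?mulr_gt0 ?invr_gt0 //.
by apply: ler_pM => //; rewrite invr_ge0 ltW.
Qed.

Lemma BL_soft_dir x i : BL (fun z => soft_dir x z i).
Proof.
have r0 := soft_norm_gt0 x; have re := soft_norm_ge_eps x.
have ie z : (soft_norm x z)^-1 <= eps^-1 by rewrite lef_pV2 ?posrE.
have p1 z : `|soft_dir x z i| <= 1.
  by rewrite normrM normfV (gtr0_norm (r0 z)) ler_pdivrMr // mul1r noisy_image_le_soft_norm.
split; first by exists 1.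
have [L L0 HL] := Lip_soft_norm x; have [L' L'0 HL'] := Lip_noisy_image x i.
exists ((L' + L) / eps); first by rewrite divr_ge0 ?addr_ge0 // ltW.
move=> z z'; set S := \sum_c _.
have -> : soft_dir x z i - soft_dir x z' i =
    ((noisy_image x z i - noisy_image x z' i) + soft_dir x z' i * (soft_norm x z' - soft_norm x z)) *
    (soft_norm x z)^-1.
  by rewrite /soft_dir; field; rewrite !gt_eqF.
rewrite normrM [leRHS]mulrAC (gtr0_norm (_ : 0 < (soft_norm x z)^-1)) ?invr_gt0 //.
apply: ler_pM => //; first by rewrite invr_ge0 ltW.
rewrite [leRHS]mulrDl; apply: (le_trans (ler_normD _ _)); apply: lerD => //.
rewrite normrM -[leRHS]mul1r; apply: ler_pM => //.
by rewrite distrC.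
Qed.

Definition exceed x z : R := K * (soft_norm x z + noisy_offset x z - a).
Definition d_exceed x c z : R :=
  K * (\sum_i d_noisy_image x c i * soft_dir x z i + d_noisy_offset x c).
Definition dd_exceed x c z : R :=
  K * ((soft_norm x z)^-1 * (\sum_i d_noisy_image x c i ^+ 2 -
     (\sum_i d_noisy_image x c i * soft_dir x z i) ^+ 2)).

Lemma Lip_exceed x : Lip (exceed x).
Proof.
apply: LipZ; apply: LipD; last exact: Lip_cst.
by apply: LipD; [exact: Lip_soft_norm|exact: Lip_noisy_offset].
Qed.

Lemma partials_exceed x : partials (exceed x) (d_exceed x) (dd_exceed x).
Proof.
have BL1 c : BL (fun z => \sum_i d_noisy_image x c i * soft_dir x z i).
  by apply: BL_sum => i; apply: BLZ; exact: BL_soft_dir.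
pose A z := eps ^+ 2 + \sum_i noisy_image x z i ^+ 2.
pose B c z := \sum_i d_noisy_image x c i * noisy_image x z i.
pose C c := \sum_i d_noisy_image x c i ^+ 2.
have AE c z t : A (nudge c t z) = A z + 2 * t * B c z + t ^+ 2 * C c.
  rewrite /A /B /C !mulr_sumr -!addrA -!big_split /=; congr (_ + _).
  by apply: eq_bigr => i _; rewrite noisy_image_nudge; ring.
have BE c z t : B c (nudge c t z) = B c z + t * C c.
  rewrite /B /C mulr_sumr -big_split /=.
  by apply: eq_bigr => i _; rewrite noisy_image_nudge; ring.
have rE z : soft_norm x z = Num.sqrt (A z) by [].
have pE c z : \sum_i d_noisy_image x c i * soft_dir x z i = B c z / soft_norm x z.
  by rewrite mulr_suml; apply: eq_bigr => i _; rewrite mulrA.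
have A0 c z t : 0 < A z + 2 * t * B c z + t ^+ 2 * C c.
  by rewrite -AE -sqrtr_gt0 -rE soft_norm_gt0.
split=> [c z t|c z t|c|c].
- have [d1 _] := @sqrt_quadratic_derive _ (A z) (B c z) (C c) t (A0 c z).
  rewrite (_ : (fun t => _) = (fun t => K * (Num.sqrt (A z + 2 * t * B c z + t ^+ 2 * C c)
     + (noisy_offset x z + t * d_noisy_offset x c) - a))); last first.
    by apply/funext => s; rewrite /exceed rE AE noisy_offset_nudge.
  apply: is_derive_eq; rewrite /d_exceed pE BE rE AE /GRing.scale /=; ring.
- have [_ d2] := @sqrt_quadratic_derive _ (A z) (B c z) (C c) t (A0 c z).
  rewrite (_ : (fun t => _) = (fun t => K * ((B c z + t * C c) / Num.sqrt (A z + 2 * t * B c z + t ^+ 2 * C c)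
     + d_noisy_offset x c))); last first.
    by apply/funext => s; rewrite /d_exceed pE BE rE AE.
  apply: is_derive_eq; rewrite /dd_exceed pE BE rE AE /GRing.scale /=; by rewrite addr0.
- by apply: BLZ; apply: BLD; [|exact: BL_cst].
- apply: BLZ; apply: BLM; first exact: BL_inv_soft_norm.
  apply: BLD; first exact: BL_cst.
  by apply: BLN; under eq_fun do rewrite expr2; exact: BLM.
Qed.

(** The coordinates on which the process [norm (A x) + gam] depends, and those on which
    [norm g + <h, x>] depends. *)
Definition joint_coords : seq I :=
  slot0 :: [seq slotA ij.1 ij.2 | ij <- index_enum {: 'I_m * 'I_n}].
Definition split_coords : seq I :=
  [seq slotg i | i <- index_enum 'I_m] ++ [seq sloth j | j <- index_enum 'I_n].

Lemma sum_joint_coords (f : I -> R) :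
  \sum_(c <- joint_coords) f c = f slot0 + \sum_i \sum_j f (slotA i j).
Proof.
by rewrite big_cons big_map (pair_bigA _ (fun i j => f (slotA i j))).
Qed.

Lemma sum_split_coords (f : I -> R) :
  \sum_(c <- split_coords) f c = \sum_i f (slotg i) + \sum_j f (sloth j).
Proof. by rewrite big_cat !big_map. Qed.

Lemma sum_delta (i : 'I_m) (f : 'I_m -> R) (b : R) :
  \sum_k (if k == i then b else 0) * f k = b * f i.
Proof.
rewrite (bigD1 i) //= eqxx big1 ?addr0 // => k /negbTE ->; exact: mul0r.
Qed.

Lemma d_noisy_image_sum x c (f : 'I_m -> R) : \sum_k d_noisy_image x c k * f k =
  match c with
  | inl (inl ij) => x ij.2 * f ij.1 | inr (inl i) => f i | _ => 0
  end.
Proof.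
case: c => [[[i j]|[]]|[i|j]] /=.
- exact: sum_delta.
- by rewrite big1 // => k _; rewrite mul0r.
- by rewrite sum_delta mul1r.
- by rewrite big1 // => k _; rewrite mul0r.
Qed.

Lemma d_noisy_image_sqr_sum x c : \sum_k d_noisy_image x c k ^+ 2 =
  match c with
  | inl (inl ij) => x ij.2 ^+ 2 | inr (inl i) => 1 | _ => 0
  end.
Proof.
under eq_bigr do rewrite expr2.
rewrite d_noisy_image_sum; case: c => [[[i j]|[]]|[i|j]] //=; by rewrite eqxx.
Qed.

(** The carre du champ measures the covariance of the increments at [x] and [y].  Here
    [soft_dir x z] is the gradient of the smoothed norm, of length at most one, so both
    factors on the right are nonnegative for unit vectors [x] and [y], and the first one
    vanishes for [x = y]. *)
Lemma carre_du_champ x y z :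
  \sum_(c <- joint_coords) d_exceed x c z * d_exceed y c z -
  \sum_(c <- split_coords) d_exceed x c z * d_exceed y c z =
  K ^+ 2 * ((1 - \sum_j x j * y j) * (1 - \sum_i soft_dir x z i * soft_dir y z i)).
Proof.
have EA : \sum_i \sum_j d_exceed x (slotA i j) z * d_exceed y (slotA i j) z =
    K ^+ 2 * ((\sum_j x j * y j) * (\sum_i soft_dir x z i * soft_dir y z i)).
  rewrite (mulrC (\sum_j _)) mulr_suml mulr_sumr; apply: eq_bigr => i _.
  rewrite !mulr_sumr; apply: eq_bigr => j _.
  by rewrite /d_exceed !d_noisy_image_sum /=; ring.
have Eg : \sum_i d_exceed x (slotg i) z * d_exceed y (slotg i) z =
    K ^+ 2 * (\sum_i soft_dir x z i * soft_dir y z i).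
  by rewrite mulr_sumr; apply: eq_bigr => i _; rewrite /d_exceed !d_noisy_image_sum /=; ring.
have Eh : \sum_j d_exceed x (sloth j) z * d_exceed y (sloth j) z = K ^+ 2 * (\sum_j x j * y j).
  by rewrite mulr_sumr; apply: eq_bigr => i _; rewrite /d_exceed !d_noisy_image_sum /=; ring.
have Ec : d_exceed x slot0 z * d_exceed y slot0 z = K ^+ 2.
  by rewrite /d_exceed !d_noisy_image_sum /=; ring.
by rewrite sum_joint_coords sum_split_coords EA Eg Eh Ec; ring.
Qed.

Lemma carre_du_champ_ge0 x y z : unit_vector x -> unit_vector y ->
  \sum_(c <- split_coords) d_exceed x c z * d_exceed y c z <=
  \sum_(c <- joint_coords) d_exceed x c z * d_exceed y c z.
Proof.
move=> x1 y1; rewrite -subr_ge0 carre_du_champ.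
rewrite mulr_ge0 ?sqr_ge0 // mulr_ge0 // subr_ge0; apply: dot_le1.
- by rewrite x1.
- by rewrite y1.
- exact: soft_dir_sqr_sum.
- exact: soft_dir_sqr_sum.
Qed.

Lemma carre_du_champ_diag x z : unit_vector x ->
  \sum_(c <- split_coords) d_exceed x c z ^+ 2 = \sum_(c <- joint_coords) d_exceed x c z ^+ 2.
Proof.
move=> x1; apply/esym/eqP; rewrite -subr_eq0.
under eq_bigr do rewrite expr2; under [X in _ - X]eq_bigr do rewrite expr2.
rewrite carre_du_champ; under eq_bigr do rewrite -expr2.
by rewrite x1 subrr mul0r mulr0.
Qed.

(** The processes have the same generator on functions of a single [x]: for a unit vector
    [x], the vectors [A x] and [g] have the same law. *)
Lemma laplacian_exceed x z : unit_vector x ->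
  \sum_(c <- split_coords) dd_exceed x c z = \sum_(c <- joint_coords) dd_exceed x c z.
Proof.
move=> x1; rewrite sum_joint_coords sum_split_coords.
have EA i : \sum_j dd_exceed x (slotA i j) z = K * ((soft_norm x z)^-1 * (1 - soft_dir x z i ^+ 2)).
  rewrite -[RHS]mulr1 -[X in _ = _ * X]x1 mulr_sumr; apply: eq_bigr => j _.
  by rewrite /dd_exceed d_noisy_image_sum d_noisy_image_sqr_sum /=; ring.
have Eg i : dd_exceed x (slotg i) z = K * ((soft_norm x z)^-1 * (1 - soft_dir x z i ^+ 2)).
  by rewrite /dd_exceed d_noisy_image_sum d_noisy_image_sqr_sum.
have Eh j : dd_exceed x (sloth j) z = 0 by rewrite /dd_exceed d_noisy_image_sum d_noisy_image_sqr_sum /=; ring.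
have Ec : dd_exceed x slot0 z = 0 by rewrite /dd_exceed d_noisy_image_sum d_noisy_image_sqr_sum /=; ring.
under eq_bigr do rewrite Eg.
under [in RHS]eq_bigr do rewrite EA.
by rewrite Ec add0r [X in _ + X]big1 ?addr0.
Qed.

(** A smoothed indicator of the event that the process exceeds [a] at every point of [X]. *)
Definition soft_all (X : seq ('I_n -> R)) z : R := \prod_(x <- X) logistic (exceed x z).

Lemma soft_all_ge0 X z : 0 <= soft_all X z.
Proof. by apply: prodr_ge0 => x _; exact: ltW (logistic_gt0 _). Qed.

Lemma BL_logistic_exceed x : BL (fun z => logistic (exceed x z)).
Proof. by apply: (BL_comp logistic_bl); exact: Lip_exceed. Qed.

Lemma BL_soft_all X : BL (soft_all X).
Proof.
elim: X => [|x Y IH]; first by rewrite /soft_all; under eq_fun do rewrite big_nil; exact: BL_cst.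
by rewrite /soft_all; under eq_fun do rewrite big_cons; apply: BLM => //; exact: BL_logistic_exceed.
Qed.

(** [soft_all X] is subharmonic for the difference of the two generators.  The induction
    on [X] carries along its correlation with the factors still to come. *)
Lemma soft_all_subharmonic (X : seq ('I_n -> R)) : (forall x, List.In x X -> unit_vector x) ->
  exists F1 F2, [/\ partials (soft_all X) F1 F2,
    (forall z, \sum_(c <- split_coords) F2 c z <= \sum_(c <- joint_coords) F2 c z) &
    forall y z, unit_vector y ->
      \sum_(c <- split_coords) F1 c z * d_exceed y c z <=
      \sum_(c <- joint_coords) F1 c z * d_exceed y c z].
Proof.
elim: X => [_|x X IH xX].
  exists (fun _ _ => 0), (fun _ _ => 0); split.
  - rewrite /soft_all; under eq_fun do rewrite big_nil.
    split=> *; by [exact: is_derive_cst | exact: BL_cst].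
  - by move=> z; rewrite !big1.
  - by move=> y z _; rewrite !big1 // => c _; rewrite mul0r.
have [F1 [F2 [pF hF gF1]]] := IH (fun y yX => xX y (or_intror yX)).
have x1 : unit_vector x by apply: xX; left.
pose l z := logistic (exceed x z).
have l01 z : 0 < l z /\ 0 < 1 - l z.
  by rewrite subr_gt0; split; [exact: logistic_gt0|exact: logistic_lt1].
have pl := partials_logistic (Lip_exceed x) (partials_exceed x).
have pFl := partials_mul (BL_logistic_exceed x) (BL_soft_all X) pl pF.
exists (fun c z => l z * (1 - l z) * d_exceed x c z * soft_all X z + l z * F1 c z).
exists (fun c z =>
  l z * (1 - l z) * ((1 - 2 * l z) * d_exceed x c z ^+ 2 + dd_exceed x c z) * soft_all X z +
  l z * F2 c z + 2 * ((l z * (1 - l z) * d_exceed x c z) * F1 c z)).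
split.
- rewrite (_ : soft_all (x :: X) = fun z => l z * soft_all X z) //.
  by apply/funext => z; rewrite /soft_all big_cons.
- move=> z; have [l0 l1] := l01 z.
  have split_sum (s : seq I) : \sum_(c <- s)
     (l z * (1 - l z) * ((1 - 2 * l z) * d_exceed x c z ^+ 2 + dd_exceed x c z) * soft_all X z +
     l z * F2 c z + 2 * ((l z * (1 - l z) * d_exceed x c z) * F1 c z)) =
     l z * (1 - l z) * soft_all X z * (1 - 2 * l z) * (\sum_(c <- s) d_exceed x c z ^+ 2)
     + l z * (1 - l z) * soft_all X z * (\sum_(c <- s) dd_exceed x c z)
     + l z * (\sum_(c <- s) F2 c z)
     + 2 * l z * (1 - l z) * (\sum_(c <- s) F1 c z * d_exceed x c z).
    rewrite !mulr_sumr -!big_split /=; apply: eq_bigr => c _; ring.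
  rewrite !split_sum (carre_du_champ_diag z x1) (laplacian_exceed z x1) -!addrA.
  rewrite !lerD2l; apply: lerD; rewrite ler_wpM2l //; first exact: ltW.
    by rewrite !mulr_ge0 ?soft_all_ge0 // ltW.
  exact: gF1.
- move=> y z y1; have [l0 l1] := l01 z.
  have split_sum (s : seq I) : \sum_(c <- s)
     (l z * (1 - l z) * d_exceed x c z * soft_all X z + l z * F1 c z) * d_exceed y c z =
     l z * (1 - l z) * soft_all X z * (\sum_(c <- s) d_exceed x c z * d_exceed y c z)
     + l z * (\sum_(c <- s) F1 c z * d_exceed y c z).
    rewrite !mulr_sumr -!big_split /=; apply: eq_bigr => c _; ring.
  rewrite !split_sum; apply: lerD; rewrite ler_wpM2l //.
  + by rewrite !mulr_ge0 ?soft_all_ge0 // ltW.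
  + exact: carre_du_champ_ge0.
  + exact: ltW.
  + exact: gF1.
Qed.

(** The first heat flow describes the process [norm (A x) + gam], the second one the
    process [norm g + <h, x>]; subharmonicity is the hypothesis of [smooths_comparison]
    up to the sign brought by the complement to [1]. *)
Theorem gordon_comparison (X : seq ('I_n -> R)) z :
  (forall x, List.In x X -> unit_vector x) ->
  smooths 1 joint_coords (fun z => 1 - soft_all X z) z <=
  smooths 1 split_coords (fun z => 1 - soft_all X z) z.
Proof.
move=> X1; have [F1 [F2 [pF hF _]]] := soft_all_subharmonic X1.
have bF : BL (fun z => 1 - soft_all X z).
  by apply: BLD; [exact: BL_cst|apply: BLN; exact: BL_soft_all].
have [M so] := partials_second_order (partials_opp 1 pF) bF.
apply: (smooths_comparison so) => {}z.
by rewrite !sumrN lerN2.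
Qed.

End GordonFunction.

(** * Heat flow as a mean over independent variables *)

Section Independence.
Context {R : realType} {I J : finType} {d : measure_display} {T : measurableType d}.
Variables (P : probability T R) (X : J -> {RV P >-> R}) (e : J -> I).
Hypothesis hN : forall k, standard_normal (X k).
Hypothesis hI : mutually_independent X.
Local Notation N := (@normal_prob R 0 1).

Definition place (f : J -> R) (l : seq J) (z : I -> R) : I -> R :=
  foldl (fun z k => nudge (e k) (f k) z) z l.

Lemma place_nudge f l i a z : place f l (nudge i a z) = nudge i a (place f l z).
Proof. by elim: l z => //= k l IH z; rewrite nudgeC IH. Qed.

Definition event (D : {set J}) (B : J -> set R) : set T :=
  \bigcap_(i in [set` D]) (X i @^-1` B i).

Lemma measurable_event D B : (forall i, measurable (B i)) -> measurable (event D B).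
Proof.
move=> mB; apply: fin_bigcap_measurable => // i _.
by rewrite -[_ @^-1` _]setTI; exact: measurable_funP.
Qed.

Lemma event_add (k : J) (D : {set J}) (B : J -> set R) (C : set R) : k \notin D ->
  event (k |: D) (fun i => if i == k then C else B i) = event D B `&` X k @^-1` C.
Proof.
move=> kD; apply/seteqP; split=> w /=.
  move=> H; split; last by have := H k; rewrite /= setU11 eqxx; apply.
  move=> i /= iD; have := H i; rewrite /= setU1r //.
  by case: eqP iD kD => [-> ->//|_ _ _]; apply.
move=> [H1 H2] i /=; rewrite in_setU1; case: eqP => [->//|_] /= iD.
exact: H1.
Qed.

Lemma event_add_prob (k : J) (D : {set J}) (B : J -> set R) (C : set R) :
  k \notin D -> (forall i, measurable (B i)) ->
  measurable C ->
  fine (P (event (k |: D) (fun i => if i == k then C else B i))) =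
  fine (P (event D B)) * fine (N C).
Proof.
move=> kD mB mC; rewrite /event !hI //; last by move=> i; case: ifP.
rewrite big_setU1 //= eqxx fineM //; last first.
- by apply: prode_fin_num => i _; apply: fin_num_measure; case: ifP => _;
    rewrite -[_ @^-1` _]setTI; exact: measurable_funP.
- by apply: fin_num_measure; rewrite -[_ @^-1` _]setTI; exact: measurable_funP.
rewrite mulrC; congr (_ * _); last by rewrite -(hN k mC).
by congr fine; apply: eq_bigr => i iD; case: eqP iD kD => // -> ->.
Qed.

Variables (q : R -> R) (S : seq R).
Hypotheses (mq : measurable_fun setT q) (uS : uniq S) (qS : forall x, q x \in S).
Let p c : R := fine (N (q @^-1` [set c])).

Fixpoint discrete_mean (l : seq J) (G : (I -> R) -> R) (z : I -> R) : R :=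
  if l is k :: l' then \sum_(c <- S) discrete_mean l' G (nudge (e k) c z) * p c
  else G z.

Lemma measurable_q c : measurable (q @^-1` [set c]).
Proof. by rewrite -[_ @^-1` _]setTI; exact: mq. Qed.

(** Independence is used through the events [X i \in B i].  The induction on [l] fixes the
    rounded value of one variable after the other, and [D], [B] record the variables that
    have been fixed. *)
Lemma mean_discrete (l : seq J) (D : {set J}) (B : J -> set R) G z :
  uniq l -> (forall k, k \in l -> k \notin D) -> (forall i, measurable (B i)) ->
  let h w := \1_(event D B) w * G (place (fun k => q (X k w)) l z) in
  P.-integrable setT (EFin \o h) /\
  \int[P]_w h w = fine (P (event D B)) * discrete_mean l G z.
Proof.
elim: l D B z => [|k l IH] D B z /= ul lD mB.
  have iE : P.-integrable setT (EFin \o (\1_(event D B) : T -> R)).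
    by apply: integrable_indic => //; exact: measurable_event.
  split.
    have := integrableZr measurableT (G z) iE; congr (P.-integrable _ _).
  rewrite RintegralZr //; congr (_ * _).
  by rewrite /Rintegral integral_indic ?setIT //; exact: measurable_event.
have /andP[kl ul'] := ul.
pose B' c i := if i == k then q @^-1` [set c] else B i.
have mB' c i : measurable (B' c i).
  by rewrite /B'; case: ifP => // _; exact: measurable_q.
have kD : k \notin D by apply: lD; rewrite mem_head.
pose h c w := \1_(event (k |: D) (B' c)) w * G (place (fun k => q (X k w)) l (nudge (e k) c z)).
have lD' j : j \in l -> j \notin k |: D.
  move=> jl; rewrite in_setU1 negb_or lD ?inE ?jl ?orbT // andbT.
  by apply: contraNneq kl => <-.
have IHc c := IH (k |: D) (B' c) (nudge (e k) c z) ul' lD' (mB' c).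
have E w : \1_(event D B) w * G (place (fun k => q (X k w)) l (nudge (e k) (q (X k w)) z)) =
    \sum_(c <- S) h c w.
  rewrite (bigD1_seq (q (X k w))) //= big1 ?addr0.
    rewrite /h /B' event_add // indicI /= (_ : \1_(X k @^-1` _) w = 1) ?mulr1 //.
    by rewrite indicE mem_set.
  move=> c cq; rewrite /h /B' event_add // indicI /= (_ : \1_(X k @^-1` _) w = 0) ?mulr0 ?mul0r //.
  by rewrite indicE memNset //= => /esym/eqP; rewrite (negbTE cq).
have isum : P.-integrable setT (EFin \o (fun w => \sum_(c <- S) h c w)).
  rewrite (_ : EFin \o _ = fun w => (\sum_(c <- S) (EFin \o h c) w)%E).
    by apply: integrable_sum => // c _; exact: (IHc c).1.
  by apply/funext => w; rewrite /= sumEFin.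
split; first by under eq_fun do rewrite E.
under eq_Rintegral do rewrite E.
have -> : \int[P]_w (\sum_(c <- S) h c w) = \sum_(c <- S) \int[P]_w h c w.
  elim: S => [|c s IHs].
    by under eq_Rintegral do rewrite big_nil; rewrite big_nil Rintegral_cst // mul0r.
  under eq_Rintegral do rewrite big_cons.
  rewrite big_cons RintegralD //; first by rewrite IHs.
    exact: (IHc c).1.
  rewrite (_ : EFin \o _ = fun w => (\sum_(c <- s) (EFin \o h c) w)%E).
    by apply: integrable_sum => // c' _; exact: (IHc c').1.
  by apply/funext => w; rewrite /= sumEFin.
rewrite mulr_sumr; apply: eq_bigr => c _.
by rewrite (IHc c).2 event_add_prob //; [rewrite -mulrA (mulrC (fine (N _)))|exact: measurable_q].
Qed.

Lemma discrete_mean_smooths M F l z : bounded_lipschitz M F ->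
  `|smooths 1 (map e l) F z - discrete_mean l F z| <=
  (size l)%:R * (2 * M * gmean (fun x => trunc_dist x (q x))).
Proof.
move=> FM; have M0 := bl_ge0 FM; elim: l z => [|k l IH] z.
  by rewrite /= subrr normr0 mul0r.
set D := 2 * M * _ in IH *; rewrite /= -nat1r mulrDl mul1r.
have bs := bl_smooths (map e l) (_ : `|1| <= 1) FM.
have n1 : `|1 : R| <= 1 by rewrite normr1.
have h1 := smooth_discretize (e k) z n1 (bs n1) mq.
apply: le_trans (ler_distD _ _ _) (lerD h1 _).
have qsum (g : R -> R) : gmean (fun x => g (q x)) = \sum_(c <- S) g c * p c.
  exact: (@Rintegral_finite_range _ _ _ (normal_prob 0 1) _ q S g measurable_q uS qS).
rewrite (qsum (fun c => smooths 1 (map e l) F (nudge (e k) (1 * c) z))) -sumrB.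
apply: (le_trans (ler_norm_sum _ _ _)).
have p0 c : 0 <= p c by rewrite fine_ge0.
have p1 : \sum_(c <- S) p c = 1.
  by have := qsum (fun=> 1); rewrite gmean_cst => ->; apply: eq_bigr => c _; rewrite mul1r.
rewrite -[leRHS]mulr1 -[X in _ <= _ * X]p1 mulr_sumr; apply: ler_sum => c _.
rewrite -mulrBl normrM (ger0_norm (p0 c)); apply: ler_wpM2r => //.
by have := IH (nudge (e k) c z); rewrite /= ?mul1r.
Qed.

Lemma place_dist M F l z (f : J -> R) : bounded_lipschitz M F ->
  `|F (place f l z) - F (place (fun k => q (f k)) l z)| <=
  2 * M * \sum_(k <- l) trunc_dist (f k) (q (f k)).
Proof.
move=> FM; elim: l z => [|k l IH] z /=.
  by rewrite subrr normr0 big_nil mulr0.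
rewrite -/(place f l (nudge (e k) (f k) z)).
rewrite -/(place (fun k => q (f k)) l (nudge (e k) (q (f k)) z)).
rewrite big_cons mulrDr [leRHS]addrC.
apply: (le_trans (ler_distD (F (place (fun k => q (f k)) l (nudge (e k) (f k) z))) _ _)).
apply: (lerD (IH _)); rewrite !place_nudge.
have := @bl_trunc_dist _ _ M F (e k) 1 (f k) (q (f k)) (place (fun k => q (f k)) l z).
by rewrite !mul1r; apply => //; rewrite normr1.
Qed.

Lemma mean_trunc_dist k :
  P.-integrable setT (EFin \o (fun w => trunc_dist (X k w) (q (X k w)))) /\
  \int[P]_w trunc_dist (X k w) (q (X k w)) = gmean (fun x => trunc_dist x (q x)).
Proof.
have mt : measurable_fun setT (fun x => trunc_dist x (q x)).
  exact: measurable_trunc_dist.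
have mtX : measurable_fun setT (fun w => trunc_dist (X k w) (q (X k w))).
  by apply: (measurableT_comp (f := fun x => trunc_dist x (q x))).
split.
  apply: measurable_bounded_integrable => //.
    exact: le_lt_trans (probability_le1 P measurableT) (ltry _).
  exists 1; split; first exact: num_real.
  move=> a a1 w _; rewrite /= ger0_norm ?trunc_dist_ge0 //.
  exact: le_trans (trunc_dist_le1 _ _) (ltW a1).
rewrite /gmean /Rintegral; congr fine.
have mX : measurable_fun setT (X k : T -> R) by exact: measurable_funP.
have mtE : measurable_fun [set: R] (EFin \o (fun x => trunc_dist x (q x))).
  exact/measurable_EFinP.
have t0 : {in [set: R], forall y, (0 <= (EFin \o (fun x => trunc_dist x (q x))) y)%E}.
  by move=> y _; rewrite lee_fin trunc_dist_ge0.
have E := @ge0_integral_pushforward _ _ T (measurableTypeR R) R (X k) mX P setT _ measurableT mtE t0.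
rewrite preimage_setT in E; apply: (etrans (esym E)).
by apply: eq_measure_integral => A mA _; exact: (hN k mA).
Qed.

End Independence.

Section IndependentLowerBound.
Context {R : realType} {I J : finType} {d : measure_display} {T : measurableType d}.
Variables (P : probability T R) (X : J -> {RV P >-> R}) (e : J -> I).
Hypothesis hN : forall k, standard_normal (X k).
Hypothesis hI : mutually_independent X.

(** As [F] is nonnegative, an event on which it is at least [c0] bounds its heat flow from
    below, since the flow is the mean of [F] over the values of the independent variables.  Both are
    compared with the mean of [F] over rounded variables. *)
Lemma independent_lower_bound M F (l : seq J) (E : set T) (c0 : R) z :
  uniq l -> bounded_lipschitz M F -> measurable E ->
  (forall w, 0 <= F w) ->
  (forall w, E w -> c0 <= F (place e (fun k => X k w) l z)) ->
  c0 * fine (P E) <= smooths 1 (map e l) F z.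
Proof.
move=> ul FM mE F0 EF; have M0 := bl_ge0 FM.
apply/ler_addgt0Pr => eps eps0.
(* Each of the two comparisons costs at most [2 * M * size l * (eps / L) <= eps / 2]. *)
pose L : R := 4 * M * (size l)%:R + 1.
have L0 : 0 < L by rewrite ltr_wpDl // !mulr_ge0.
have e1 : 0 < eps / L by rewrite divr_gt0.
have [q [S [mq uS qS qe]]] := exists_discretization e1.
set tau := gmean _ in qe.
have mT (i : J) : measurable [set: R] by exact: measurableT.
have l0 k : k \in l -> k \notin (finset.set0 : {set J}) by rewrite finset.in_set0.
have [ih Eh] := mean_discrete e hN hI mq uS qS F z ul l0 mT.
rewrite /= in ih Eh.
have eT : event X finset.set0 (fun=> setT) = setT.
  by apply/seteqP; split=> // w _ i /=; rewrite finset.in_set0.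
have PT : fine (P setT) = 1 by rewrite probability_setT.
rewrite eT PT mul1r in Eh; rewrite eT in ih.
pose t (k : J) (w : T) := trunc_dist (X k w) (q (X k w)).
have isum (s : seq J) : P.-integrable setT (EFin \o (fun w => \sum_(k <- s) t k w)) /\
    \int[P]_w (\sum_(k <- s) t k w) = (size s)%:R * tau.
  elim: s => [|k s [IH1 IH2]].
    have -> : (fun w => \sum_(k <- [::]) t k w) = fun=> 0.
      by apply/funext => w; rewrite big_nil.
    rewrite mul0r Rintegral_cst // mul0r; split=> //.
    exact: finite_measure_integrable_cst.
  have [i1 i2] := mean_trunc_dist hN mq k.
  have -> : (fun w => \sum_(j <- k :: s) t j w) = fun w => t k w + \sum_(j <- s) t j w.
    by apply/funext => w; rewrite big_cons.
  split; first by have := integrableD measurableT i1 IH1.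
  by rewrite RintegralD // IH2 i2 /= -nat1r mulrDl mul1r.
have [is1 is2] := isum l.
have iE : P.-integrable setT (EFin \o (\1_E : T -> R)) by exact: integrable_indic.
have cE : \int[P]_w (c0 * \1_E w) = c0 * fine (P E).
  by rewrite RintegralZl // /Rintegral integral_indic // setIT.
have is3 : P.-integrable setT (EFin \o (fun w => 2 * M * \sum_(k <- l) t k w)).
  by have := integrableZl measurableT (2 * M) is1.
have H : c0 * fine (P E) <=
    discrete_mean e q S l F z + 2 * M * ((size l)%:R * tau).
  rewrite -cE -Eh -is2 -RintegralZl // -RintegralD //.
  apply: le_Rintegral => //.
  - by have := integrableZl measurableT c0 iE.
  - by have := integrableD measurableT ih is3.
  - move=> w _; rewrite indicT mul1r.
    have := place_dist e q l z (fun k => X k w) FM; rewrite ler_norml => /andP[_ h].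
    rewrite indicE; case: (boolP (w \in E)) => wE.
      rewrite mulr1; have := EF w (set_mem wE); rewrite -/(t _ w) in h *; lra.
    rewrite mulr0 addr_ge0 // !mulr_ge0 // sumr_ge0 // => k _.
    exact: trunc_dist_ge0.
have := discrete_mean_smooths e mq uS qS l z FM; rewrite ler_norml => /andP[h2 _].
have tau0 : (size l)%:R * (2 * M * tau) <= eps / 2.
  apply: (@le_trans _ _ ((size l)%:R * (2 * M * (eps / L)))).
    by rewrite ler_wpM2l // ler_wpM2l // mulr_ge0.
  rewrite (_ : _ * _ = (L - 1) * eps / L / 2); last by rewrite /L; field; rewrite gt_eqF.
  rewrite ler_pM2r // ler_pdivrMr //; nra.
move: H h2; rewrite -/tau; lra.
Qed.

End IndependentLowerBound.

(** * Heat flow of functions dominated by Gaussian exponentials *)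

Section Domination.
Context {R : realType} {I : finType}.
Local Notation N := (@normal_prob R 0 1).

Lemma gmean_exp_sqr (k : R) : k < 2^-1 ->
  gmean (fun x => expR (k * x ^+ 2)) = (Num.sqrt (1 - 2 * k))^-1.
Proof. by move=> k2; rewrite /gmean /Rintegral normal_exp_sqr. Qed.

(** Gaussian exponentials factor over the coordinates, and each factor has an exact mean.
    The point [z] lies at the origin of the coordinates in [l], so that the flow is the
    mean over a standard Gaussian vector. *)
Lemma smooths_dominated M F (l : seq I) (s : seq (R * (I -> R))) z :
  uniq l -> bounded_lipschitz M F -> (forall i, i \in l -> z i = 0) ->
  (forall p, List.In p s -> forall i, p.2 i < 2^-1) ->
  (forall z', (forall i, i \notin l -> z' i = z i) ->
     F z' <= \sum_(p <- s) p.1 * \prod_(i <- l) expR (p.2 i * z' i ^+ 2)) ->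
  smooths 1 l F z <=
    \sum_(p <- s) p.1 * \prod_(i <- l) (Num.sqrt (1 - 2 * p.2 i))^-1.
Proof.
move=> + FM; elim: l s z => [|i l IH] s z /=.
  move=> _ _ _ H; have := H z (fun _ _ => erefl).
  by move/le_trans; apply; apply: ler_sum => p _; rewrite !big_nil.
move=> /andP[il ul] z0 s2 H.
have n1 : `|1 : R| <= 1 by rewrite normr1.
have Hx (x : R) : smooths 1 l F (nudge i (1 * x) z) <=
    \sum_(p <- s) (p.1 * \prod_(j <- l) (Num.sqrt (1 - 2 * p.2 j))^-1) * expR (p.2 i * x ^+ 2).
  pose s' := [seq (p.1 * expR (p.2 i * x ^+ 2), p.2) | p <- s].
  have := IH s' (nudge i (1 * x) z) ul.
  rewrite big_map /= => /(_ _ _ _)/le_trans; apply.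
  - move=> j jl; rewrite /nudge z0 ?inE ?jl ?orbT // add0r.
    by case: eqP jl il => // -> ->.
  - by move=> p /(@List.in_map_iff _ _ _ s p)[p' [<- p's]] j; exact: (s2 p' p's j).
  - move=> z' z'E; rewrite big_map /=.
    have z'i : z' i = x by rewrite (z'E _ il) /nudge eqxx (z0 _ (mem_head _ _)) add0r mul1r.
    have := H z' _; move/(_ _)/le_trans; apply.
      move=> j; rewrite inE negb_or => /andP[ji jl].
      by rewrite (z'E _ jl) /nudge (negbTE ji) addr0.
    by apply: ler_sum => p _; rewrite big_cons z'i mulrA.
  - by apply: ler_sum => p _; rewrite mulrAC.
pose w (p : R * (I -> R)) := p.1 * \prod_(j <- l) (Num.sqrt (1 - 2 * p.2 j))^-1.
have ig (s' : seq (R * (I -> R))) : (forall p, List.In p s' -> forall i, p.2 i < 2^-1) ->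
  N.-integrable setT (EFin \o (fun x => \sum_(p <- s') w p * expR (p.2 i * x ^+ 2))) /\
  gmean (fun x => \sum_(p <- s') w p * expR (p.2 i * x ^+ 2)) =
  \sum_(p <- s') p.1 * \prod_(j <- i :: l) (Num.sqrt (1 - 2 * p.2 j))^-1.
  elim: s' => [|p s' IHs] sp.
    have -> : (fun x : R => \sum_(p <- [::] : seq (R * (I -> R))) w p * expR (p.2 i * x ^+ 2)) =
        (fun=> 0).
      by apply/funext => x; rewrite big_nil.
    rewrite big_nil; split; last exact: gmean_cst.
    exact: normal_integrable_cst.
  have [i1 i2] := IHs (fun p' p's => sp p' (or_intror p's)).
  have pi2 := sp p (or_introl erefl) i.
  have i3 := normal_exp_integrable pi2; have i4 := gmean_exp_sqr pi2.
  have i5 : N.-integrable setT (EFin \o (fun x => w p * expR (p.2 i * x ^+ 2))).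
    by have := integrableZl measurableT (w p) i3.
  have -> : (fun x : R => \sum_(p' <- p :: s') w p' * expR (p'.2 i * x ^+ 2)) =
    fun x => w p * expR (p.2 i * x ^+ 2) + \sum_(p' <- s') w p' * expR (p'.2 i * x ^+ 2).
    by apply/funext => x; rewrite big_cons.
  split.
    by have := integrableD measurableT i5 i1.
  rewrite gmeanD // i2 gmeanZ // i4 [RHS]big_cons; congr (_ + _).
  by rewrite /w big_cons; ring.
have [i1 <-] := ig s s2.
apply: gmean_le => //.
exact: smooth_integrable (bl_smooths l n1 FM).
Qed.

End Domination.

(** * Gordon's inequality for probabilities *)

Section FiniteProducts.
Context {R : realType}.

Lemma prod01_le (U : Type) (X : seq U) (l : U -> R) x : List.In x X ->
  (forall y, 0 <= l y <= 1) -> \prod_(y <- X) l y <= l x.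
Proof.
move=> + l01; have P01 (Y : seq U) : 0 <= \prod_(y <- Y) l y <= 1.
  elim: Y => [|y Y IH]; first by rewrite big_nil ler01 lexx.
  rewrite big_cons; case/andP: (l01 y) => y0 y1; case/andP: IH => Y0 Y1.
  by rewrite mulr_ge0 //= mulr_ile1.
elim: X => //= y Y IH [->|xY]; rewrite big_cons.
  by case/andP: (l01 x) => x0 _; case/andP: (P01 Y) => _ Y1; rewrite ler_piMr.
apply: le_trans (IH xY); case/andP: (l01 y) => _ y1; case/andP: (P01 Y) => Y0 _.
by rewrite ler_piMl.
Qed.

Lemma one_minus_prod (U : Type) (X : seq U) (l : U -> R) (c : R) :
  (forall y, 0 <= l y <= 1) -> (forall y, List.In y X -> 1 - l y <= c) ->
  1 - \prod_(y <- X) l y <= (size X)%:R * c.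
Proof.
move=> l01; elim: X => [|y Y IH] H; first by rewrite big_nil subrr mul0r.
rewrite big_cons /= -nat1r mulrDl mul1r.
have h1 := H y (or_introl erefl).
have h2 := IH (fun x xY => H x (or_intror xY)).
case/andP: (l01 y) => y0 y1.
have P01 : \prod_(y <- Y) l y <= 1.
  elim: (Y) => [|x Z IHZ]; first by rewrite big_nil.
  rewrite big_cons; case/andP: (l01 x) => x0 x1; rewrite mulr_ile1 //.
  by apply: prodr_ge0 => w _; case/andP: (l01 w).
apply: le_trans (lerD h1 h2); nra.
Qed.

End FiniteProducts.

Section GordonProbability.
Context {R : realType} {m n : nat} {d : measure_display} {T : measurableType d}.
Variables (P : probability T R) (A : 'I_m -> 'I_n -> {RV P >-> R}).
Hypothesis hA : standard_gaussian_matrix A.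
Local Notation N := (@normal_prob R 0 1).
Local Notation sample w := (fun i j => A i j w).
Local Notation I := ('I_m * 'I_n + unit + ('I_m + 'I_n))%type.

Lemma placeE (J : finType) (e : J -> I) (f : J -> R) l z c :
  place e f l z c = z c + \sum_(k <- l) (if c == e k then f k else 0).
Proof.
elim: l z => [|k l IH] z; first by rewrite big_nil addr0.
by rewrite big_cons /place /= -/(place e f l _) IH /nudge addrA.
Qed.

Let eA (ij : 'I_m * 'I_n) : I := slotA ij.1 ij.2.
Let pA (w : T) (t : R) : I -> R :=
  place eA (fun ij => A ij.1 ij.2 w) (index_enum _) (nudge (slot0 : I) t (fun=> 0)).

Lemma pA_values w t : [/\ forall i j, pA w t (slotA i j) = A i j w, pA w t slot0 = t,
  forall i, pA w t (slotg i) = 0 & forall j, pA w t (sloth j) = 0].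
Proof.
split=> [i j| |i|j]; rewrite /pA placeE /nudge /= ?add0r.
- rewrite (bigD1 (i, j)) //= /eA /= eqxx big1 ?addr0 // => -[i' j'] /= ne.
  case: eqP => // -[ii jj]; by rewrite ii jj eqxx in ne.
- by rewrite big1 ?addr0.
- by rewrite big1.
- by rewrite big1.
Qed.

(** A factor of the product with a nonpositive exponent is at most one half, and so is the
    whole product. *)
Lemma gordon_lower_event eps K a t (X : seq ('I_n -> R)) w x : 0 < eps -> 0 < K ->
  List.In x X -> eps + norm2 (matvec (sample w) x) + t <= a ->
  2^-1 <= 1 - soft_all eps K a X (pA w t).
Proof.
move=> e0 K0 xX h; have [hA1 hcc hg hh] := pA_values w t.
have l01 y : 0 <= logistic (exceed eps K a y (pA w t)) <= 1.
  by rewrite ltW ?logistic_gt0 //= ltW // logistic_lt1.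
have := prod01_le xX l01; rewrite -/(soft_all _ _ _ _ _) => h1.
have h2 : logistic (exceed eps K a x (pA w t)) <= 2^-1.
  apply: logistic_le_half; rewrite /exceed pmulr_rle0 // subr_le0.
  apply: le_trans h; rewrite /noisy_offset hcc big1 ?addr0; last first.
    by move=> j _; rewrite hh mul0r.
  rewrite lerD2r /soft_norm.
  rewrite (_ : \sum_i _ = \sum_i matvec (sample w) x i ^+ 2); last first.
    apply: eq_bigr => i _; rewrite /noisy_image hg addr0; congr (_ ^+ 2).
    by apply: eq_bigr => j _; rewrite hA1.
  apply: sqrt_add_le; first exact: ltW.
  by apply: sumr_ge0 => i _; exact: sqr_ge0.
lra.
Qed.

(** By Cauchy-Schwarz every exponent is at least [K * (norm g - norm h - a)].  When
    [norm g - norm h] exceeds [a + dl], the factor [size X] of the union bound is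
    absorbed by the part [size X / dl] of the slope [K]; otherwise the right-hand side is
    at least [1]. *)
Lemma gordon_upper_bound eps K a lam dl (X : seq ('I_n -> R)) (z : I -> R) :
  0 < eps -> 0 <= lam -> 0 < dl -> lam + (size X)%:R / dl <= K ->
  (forall x, List.In x X -> unit_vector x) ->
  (forall i j, z (slotA i j) = 0) -> z slot0 = 0 ->
  1 - soft_all eps K a X z <=
  expR (lam * (a + dl)) *
  expR (lam * (norm2 (fun j => z (sloth j)) - norm2 (fun i => z (slotg i)))).
Proof.
move=> e0 l0 d0 KE X1 zA zc; set s := norm2 (fun j => _); set r := norm2 _.
have K0 : 0 <= K by apply: le_trans KE; rewrite addr_ge0 // divr_ge0 // ltW.
rewrite -expRD -mulrDr.
have l01 y : 0 <= logistic (exceed eps K a y z) <= 1.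
  by rewrite ltW ?logistic_gt0 //= ltW // logistic_lt1.
have F1 : 1 - soft_all eps K a X z <= 1.
  by rewrite lerBlDr lerDl; apply: prodr_ge0 => y _; case/andP: (l01 y).
have [h|h] := leP (r - s - a) dl.
  apply: (le_trans F1); rewrite -expR0 ler_expR mulr_ge0 //; lra.
have H x : List.In x X -> 1 - logistic (exceed eps K a x z) <= expR (- (K * (r - s - a))).
  move=> /X1 x1; apply: le_trans (one_minus_logistic _) _.
  rewrite ler_expR lerN2 /exceed ler_wpM2l // lerD2r.
  have h1 : r <= soft_norm eps x z.
    rewrite /soft_norm /r /norm2 ler_wsqrtr //.
    rewrite (_ : \sum_i noisy_image x z i ^+ 2 = \sum_i z (slotg i) ^+ 2).
      by rewrite lerDr sqr_ge0.
    apply: eq_bigr => i _; rewrite /noisy_image big1 ?add0r // => j _.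
    by rewrite zA mul0r.
  have h2 : - s <= noisy_offset x z.
    rewrite /noisy_offset zc add0r lerNl -sumrN.
    have := cauchy_schwarz (fun j => - z (sloth j)) x.
    have -> : norm2 x = 1 by rewrite /norm2 x1 sqrtr1.
    have -> : norm2 (fun j => - z (sloth j)) = s.
      by rewrite /s /norm2; congr Num.sqrt; apply: eq_bigr => j _; rewrite sqrrN.
    rewrite mulr1; apply: le_trans; rewrite le_eqVlt; apply/orP; left; apply/eqP.
    by apply: eq_bigr => j _; rewrite mulNr.
  lra.
have := one_minus_prod l01 H; rewrite -/(soft_all _ _ _ _ _) => /le_trans; apply.
have sz : (size X)%:R <= expR ((size X)%:R / dl * (r - s - a)).
  apply: (@le_trans _ _ (expR (size X)%:R)).
    by apply: le_trans (expR_ge1Dx _); rewrite lerDr.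
  rewrite ler_expR mulrAC -mulrA ler_peMr // ler_pdivlMr // mul1r; exact: ltW.
apply: (le_trans (ler_wpM2r (expR_ge0 _) sz)).
rewrite -expRD ler_expR.
have x0 : 0 <= r - s - a by rewrite ltW // (lt_trans d0 h).
have := ler_wpM2r x0 KE; rewrite mulrDl => h1.
have h2 := mulr_ge0 l0 (ltW d0).
lra.
Qed.

Lemma uniq_split_coords : uniq (split_coords : seq I).
Proof.
rewrite /split_coords cat_uniq !map_inj_uniq ?index_enum_uniq ?andbT /=.
- by apply/hasPn => _ /mapP[j _ ->]; apply/negP => /mapP[i _].
- by move=> i j [].
- by move=> i j [].
Qed.

Lemma prod_split_coords (f : I -> R) :
  \prod_(c <- split_coords) f c = (\prod_i f (slotg i)) * (\prod_j f (sloth j)).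
Proof. by rewrite big_cat !big_map. Qed.

(** The exponents of the quadratic form [- a * norm g ^ 2 + b * norm h ^ 2]. *)
Definition weight (ab : R * R) (c : I) : R :=
  match c with inr (inl _) => - ab.1 | inr (inr _) => ab.2 | _ => 0 end.

(** [gordon_comparison] as a bound on probabilities.  The right-hand side replaces
    the least norm by the difference of two independent Gaussian norms, whose
    exponential moment is controlled by any majorant of [expR (lam * (q - r))]
    that is a sum of Gaussian exponentials. *)
Theorem gordon_probability (X : seq ('I_n -> R)) (E : set T) (b t0 lam dl : R)
    (s : seq (R * (R * R))) :
  (forall x, List.In x X -> unit_vector x) -> measurable E ->
  (forall w, E w -> exists2 x, List.In x X & norm2 (matvec (sample w) x) <= b) ->
  0 <= lam -> 0 < dl ->
  (forall p, List.In p s -> 0 <= p.2.1 /\ p.2.2 < 2^-1) ->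
  (forall r q, 0 <= r -> 0 <= q -> expR (lam * (q - r)) <=
     \sum_(p <- s) p.1 * expR (- p.2.1 * r ^+ 2 + p.2.2 * q ^+ 2)) ->
  fine (P E) * fine (N `]-oo, (- t0)%R]) <=
  2 * expR (lam * (b - t0 + 2 * dl)) * \sum_(p <- s) p.1 *
    ((Num.sqrt (1 + 2 * p.2.1))^-1 ^+ m * (Num.sqrt (1 - 2 * p.2.2))^-1 ^+ n).
Proof.
move=> X1 mE EX l0 d0 sp sdom.
have n1 : `|1 : R| <= 1 by rewrite normr1.
(* The summand [1] makes [K] positive even for [lam = 0] and empty [X]. *)
pose K := lam + ((size X)%:R + 1) / dl.
have K0 : 0 < K by rewrite ltr_wpDl // divr_gt0 // ltr_wpDl.
(* One [dl] pays for the smoothing of the norm, a second one for the smoothing of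
   the indicator. *)
pose a := b - t0 + dl.
pose Phi (z : I -> R) := 1 - soft_all dl K a X z.
have [M FM] : exists M, bounded_lipschitz M Phi.
  apply/BL_bounded_lipschitz.
  by apply: BLD; [exact: BL_cst|apply: BLN; exact: BL_soft_all].
have Phi0 z : 0 <= Phi z.
  rewrite subr_ge0; elim: (X) => [|x Y IH]; first by rewrite /soft_all big_nil.
  rewrite /soft_all big_cons mulr_ile1 //.
  - exact: ltW (logistic_gt0 _).
  - by apply: prodr_ge0 => y _; exact: ltW (logistic_gt0 _).
  - exact: ltW (logistic_lt1 _).
have comp := @gordon_comparison R m n dl K a d0 X (fun=> 0) X1.
have [hN hI] := hA.
have lower t : 2^-1 * fine (P E) * \1_(`]-oo, (- t0)%R]) t <=
    smooths 1 (map eA (index_enum _)) Phi (nudge (slot0 : I) t (fun=> 0)).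
  rewrite indicE; case: (boolP (t \in _)) => [|_]; last first.
    rewrite mulr0.
    have := @independent_lower_bound R I _ _ _ P (fun ij => A ij.1 ij.2) eA
      (fun ij => hN ij.1 ij.2) hI M Phi (index_enum _) setT 0
      (nudge (slot0 : I) t (fun=> 0)) (index_enum_uniq _) FM measurableT Phi0.
    by rewrite mul0r; apply => w _; exact: Phi0.
  rewrite inE /= in_itv /= => tt0; rewrite mulr1.
  apply: (@independent_lower_bound R I _ _ _ P (fun ij => A ij.1 ij.2) eA
      (fun ij => hN ij.1 ij.2) hI M) => //; first exact: index_enum_uniq.
  move=> w /EX[x xX xb]; apply: gordon_lower_event xX _ => //.
  rewrite /a; lra.
have i1 : N.-integrable setT (EFin \o (fun t => 2^-1 * fine (P E) * \1_(`]-oo, (- t0)%R]) t)).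
  have i0 : N.-integrable setT (EFin \o (\1_(`]-oo, (- t0)%R]) : R -> R)).
    exact: integrable_indic.
  by have := integrableZl measurableT (2^-1 * fine (P E)) i0.
have h1 : 2^-1 * fine (P E) * fine (N `]-oo, (- t0)%R]) <= smooths 1 joint_coords Phi (fun=> 0).
  have -> : 2^-1 * fine (P E) * fine (N `]-oo, (- t0)%R]) =
      gmean (fun t => 2^-1 * fine (P E) * \1_(`]-oo, (- t0)%R]) t).
    rewrite gmeanZ //; last exact: integrable_indic.
    by rewrite /gmean /Rintegral integral_indic // setIT.
  have := gmean_le i1 (smooth_integrable (slot0 : I) (fun=> 0) n1 (bl_smooths (map eA (index_enum _)) n1 FM)).
  by apply => t; rewrite mul1r; exact: lower.
have h2 : smooths 1 split_coords Phi (fun=> 0) <= expR (lam * (a + dl)) *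
  \sum_(p <- s) p.1 * ((Num.sqrt (1 + 2 * p.2.1))^-1 ^+ m * (Num.sqrt (1 - 2 * p.2.2))^-1 ^+ n).
  pose s' := [seq (expR (lam * (a + dl)) * p.1, weight p.2) | p <- s].
  have := @smooths_dominated R I M Phi split_coords s' (fun=> 0) uniq_split_coords FM (fun _ _ => erefl).
  rewrite !big_map /= mulr_sumr.
  have -> : \sum_(p <- s) expR (lam * (a + dl)) * p.1 *
      \prod_(c <- split_coords) (Num.sqrt (1 - 2 * weight p.2 c))^-1 =
    \sum_(p <- s) expR (lam * (a + dl)) * (p.1 * ((Num.sqrt (1 + 2 * p.2.1))^-1 ^+ m *
      (Num.sqrt (1 - 2 * p.2.2))^-1 ^+ n)).
    apply: eq_bigr => p _; rewrite prod_split_coords /= -mulrA !prodr_const !card_ord.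
    by rewrite mulrN opprK.
  apply.
    move=> p /(@List.in_map_iff _ _ _ s p)[[c ab] [<- /sp[/= al be]]] [[?|?]|[?|?]] //=.
    by apply: le_lt_trans (_ : 0 < _) => //; rewrite oppr_le0.
  move=> z' z'0.
  have zA i j : z' (slotA i j) = 0.
    by apply: z'0; rewrite mem_cat negb_or; apply/andP; split; apply/negP => /mapP[].
  have zc : z' slot0 = 0.
    by apply: z'0; rewrite mem_cat negb_or; apply/andP; split; apply/negP => /mapP[].
  rewrite big_map /=.
  have KE : lam + (size X)%:R / dl <= K.
    by rewrite lerD2l ler_pM2r ?invr_gt0 // lerDl.
  apply: (le_trans (gordon_upper_bound a d0 l0 d0 KE X1 zA zc)).
  have := sdom _ _ (norm2_ge0 (fun i => z' (slotg i))) (norm2_ge0 (fun j => z' (sloth j))).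
  move=> /(ler_wpM2l (expR_ge0 (lam * (a + dl)))); move/le_trans; apply.
  rewrite mulr_sumr le_eqVlt; apply/orP; left; apply/eqP; apply: eq_bigr => p _.
  rewrite prod_split_coords /= -mulrA; congr (_ * (_ * _)).
  rewrite -!expR_sum -expRD !norm2_sqr; congr expR.
  by rewrite !mulr_sumr; congr (_ + _); apply: eq_bigr => i _; ring.
apply: (@le_trans _ _ (2 * (2^-1 * fine (P E) * fine (N `]-oo, (- t0)%R])))); first lra.
rewrite -[leRHS]mulrA ler_pM2l //; apply: (le_trans h1); apply: (le_trans comp).
apply: (le_trans h2); rewrite (_ : a + dl = b - t0 + 2 * dl) //.
by rewrite /a; ring.
Qed.

End GordonProbability.

(** * Unit vectors of a countable dense family *)

Section Directions.
Context {R : realType}.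
Variables (n : nat) (v0 : 'I_n -> R).
Hypothesis v01 : unit_vector v0.

(** A countable dense family of unit vectors: the directions of the integer
    vectors. *)
Definition direction (k : nat) : 'I_n -> R :=
  if unpickle k is Some q then
    let v (j : 'I_n) : R := ((q : {ffun 'I_n -> int}) j)%:~R in
    if norm2 v == 0 then v0 else fun j => (norm2 v)^-1 * v j
  else v0.

Lemma direction_unit k : unit_vector (direction k).
Proof.
rewrite /direction; case: unpickle => // q; case: eqP => // /eqP v0'.
apply/unit_vector_norm2; rewrite norm2Z normfV ger0_norm ?norm2_ge0 //.
by rewrite mulVf.
Qed.

(** The integer part of [N * x] has a direction that tends to [x] as [N] grows.  The
    rounding error has norm at most [sqrt n], which gives an explicit choice of [N]. *)
Lemma direction_dense m (B : 'I_m -> 'I_n -> R) (x : 'I_n -> R) (b : R) :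
  unit_vector x -> norm2 (matvec B x) < b -> exists k, norm2 (matvec B (direction k)) < b.
Proof.
move=> x1 xb.
pose K := norm2 (fun i => \sum_j `|B i j|).
pose s := Num.sqrt (n%:R : R).
have b0 : 0 < b by apply: le_lt_trans xb; exact: norm2_ge0.
have gap : 0 < b - norm2 (matvec B x) by rewrite subr_gt0.
pose k := Num.trunc ((K + b * s) / (b - norm2 (matvec B x)) + s).
pose N : R := k.+1%:R.
have NE : (K + b * s) / (b - norm2 (matvec B x)) + s < N.
  by apply: Num.Theory.truncnS_gt.
have K0 : 0 <= K by exact: norm2_ge0.
have s0 : 0 <= s by exact: sqrtr_ge0.
have q0 : 0 <= (K + b * s) / (b - norm2 (matvec B x)).
  by apply: divr_ge0; [apply: addr_ge0 => //; apply: mulr_ge0 => //; exact: ltW|exact: ltW].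
have Ns : s < N by lra.
have N0 : 0 < N by rewrite ltr0n.
have NK : K + b * s < N * (b - norm2 (matvec B x)).
  rewrite -ltr_pdivrMr //; lra.
pose q : {ffun 'I_n -> int} := [ffun j => Num.floor (N * x j)].
pose v (j : 'I_n) : R := (q j)%:~R.
pose r (j : 'I_n) : R := v j - N * x j.
have r1 j : `|r j| <= 1.
  rewrite /r /v ffunE; have /andP[h1 h2] := floor_itv (N * x j).
  rewrite intrD in h2.
  rewrite ler_norml; apply/andP; split; lra.
have vE : v = fun j => N * x j + r j.
  by apply/funext => j; rewrite /r addrC subrK.
have rs : norm2 r <= s.
  rewrite ler_wsqrtr //; apply: (@le_trans _ _ (\sum_(j < n) 1)).
    apply: ler_sum => j _; have := r1 j; rewrite -(expr1n _ 2) -[r j ^+ 2]ger0_norm ?sqr_ge0 //.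
    by rewrite normrX => h; rewrite lerXn2r ?nnegrE.
  by rewrite sumr_const card_ord.
have x1' : norm2 x = 1 by apply/unit_vector_norm2.
have vN : N - s <= norm2 v.
  have := norm2D v (fun j => - r j).
  have -> : norm2 (fun j => - r j) = norm2 r.
    by rewrite -[RHS]mul1r -(normr1 R) -normrN -norm2Z; congr norm2; apply/funext => j; rewrite mulN1r.
  have -> : (fun j => v j + - r j) = (fun j => N * x j).
    by apply/funext => j; rewrite vE addrK.
  rewrite norm2Z x1' mulr1 (gtr0_norm N0); lra.
have v0' : 0 < norm2 v by lra.
have Bv : norm2 (matvec B v) <= N * norm2 (matvec B x) + K.
  have -> : matvec B v = fun i => N * matvec B x i + matvec B r i.
    apply/funext => i; rewrite /matvec mulr_sumr -big_split /=; apply: eq_bigr => j _.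
    by rewrite vE; ring.
  apply: (le_trans (norm2D _ _)); rewrite norm2Z (gtr0_norm N0) lerD2l.
  apply: le_norm2 => i; have S0 : 0 <= \sum_j `|B i j| by apply: sumr_ge0.
  rewrite (ger0_norm S0).
  rewrite /matvec; apply: (le_trans (ler_norm_sum _ _ _)); apply: ler_sum => j _.
  by rewrite normrM ler_piMr.
exists (pickle q); rewrite /direction pickleK -/v (gt_eqF v0').
have -> : matvec B (fun j => (norm2 v)^-1 * v j) = fun i => (norm2 v)^-1 * matvec B v i.
  by apply/funext => i; rewrite /matvec mulr_sumr; apply: eq_bigr => j _; ring.
rewrite norm2Z normfV (gtr0_norm v0') mulrC ltr_pdivrMr //.
apply: (le_lt_trans Bv).
have := ler_wpM2l (ltW b0) vN; lra.
Qed.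

End Directions.

(** * The least singular value *)

Section XiMinus.
Context {R : realType} {m n : nat}.
Hypotheses (m0 : (0 < m)%N) (n0 : (0 < n)%N).

Lemma enorm_norm2 k (x : 'cV[R]_k) : enorm x = norm2 (fun i => x i 0).
Proof. by []. Qed.

Lemma sphere_col k (v : 'I_k -> R) : unit_vector v -> sphere (\col_i v i).
Proof.
move=> /unit_vector_norm2 v1; rewrite /sphere /= enorm_norm2 -v1; congr norm2.
by apply/funext => i; rewrite mxE.
Qed.

Lemma bilinearE (M : 'M[R]_(m, n)) (y : 'cV[R]_m) (x : 'cV[R]_n) :
  (y^T *m M *m x) 0 0 = \sum_i y i 0 * matvec M (fun j => x j 0) i.
Proof.
rewrite -mulmxA mxE; apply: eq_bigr => i _; rewrite mxE; congr (_ * _).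
by rewrite mxE.
Qed.

(** The Cauchy-Schwarz inequality, with equality at the normalized image of [x]. *)
Lemma sup_bilinear (M : 'M[R]_(m, n)) (x : 'cV[R]_n) :
  sup [set (y^T *m M *m x) 0 0 | y in @sphere R m] = norm2 (matvec M (fun j => x j 0)).
Proof.
set S := [set _ | _ in _]; set v := matvec _ _.
have ubS : ubound S (norm2 v).
  move=> _ [y y1 <-]; rewrite bilinearE -/v.
  have := cauchy_schwarz (fun i => y i 0) v.
  by rewrite -enorm_norm2 (y1 : enorm y = 1) mul1r.
have neS : S !=set0.
  pose y0 : 'cV[R]_m := \col_i (basis_vector m0) i.
  exists ((y0^T *m M *m x) 0 0); rewrite /S /=; exists y0 => //.
  by apply: sphere_col; exact: basis_vector_unit.
have hS : has_sup S by split=> //; exists (norm2 v).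
apply/eqP; rewrite eq_le; apply/andP; split; first exact: ge_sup.
have [v0|v0] := eqVneq (norm2 v) 0.
  rewrite v0; have [z Sz] := neS; apply: le_trans (ub_le_sup hS.2 Sz).
  case: Sz => y y1 <-; rewrite bilinearE -/v.
  rewrite big1 // => i _.
  have : \sum_i v i ^+ 2 = 0 by rewrite -norm2_sqr v0 expr0n.
  move/psumr_eq0P => /(_ (fun i _ => sqr_ge0 (v i)) i isT)/eqP.
  by rewrite sqrf_eq0 => /eqP ->; rewrite mulr0.
apply: ub_le_sup; first exact: hS.2.
rewrite /S /=; exists (\col_i ((norm2 v)^-1 * v i)).
  apply: sphere_col; apply/unit_vector_norm2.
  by rewrite norm2Z normfV ger0_norm ?norm2_ge0 // mulVf.
rewrite bilinearE -/v; under eq_bigr do rewrite mxE -mulrA -expr2.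
by rewrite -mulr_sumr -norm2_sqr expr2 mulrA mulVf // mul1r.
Qed.

(** The event is expressed by countably many strict inequalities: this gives both its
    measurability and its approximation by finitely many directions. *)
Lemma xi_minus_le (M : 'M[R]_(m, n)) (u : R) :
  xi_minus M <= u <-> forall i : nat, exists k,
    norm2 (matvec M (direction (basis_vector n0) k)) < u * Num.sqrt n%:R + i.+1%:R^-1.
Proof.
have sn : 0 < Num.sqrt n%:R :> R by rewrite sqrtr_gt0 ltr0n.
rewrite /xi_minus mulrC ler_pdivrMr //.
set S := [set _ | _ in _].
have lbS : lbound S 0.
  by move=> _ [x _ <-]; rewrite sup_bilinear; exact: norm2_ge0.
have dS k : S (norm2 (matvec M (direction (basis_vector n0) k))).
  rewrite /S /=; exists (\col_j (direction (basis_vector n0) k) j).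
    by apply: sphere_col; apply: direction_unit; exact: basis_vector_unit.
  rewrite sup_bilinear; congr (norm2 (matvec M _)).
  by apply/funext => j; rewrite mxE.
have hS : has_inf S by split; [eexists; exact: (dS 0%N)|exists 0].
split=> [h i|h].
  have : inf S < u * Num.sqrt n%:R + i.+1%:R^-1.
    by apply: (le_lt_trans h); rewrite ltrDl invr_gt0.
  case/(inf_lt hS.1) => _ [x x1 <-]; rewrite sup_bilinear => hx.
  apply: (direction_dense _ _ hx).
  by apply/unit_vector_norm2; rewrite -enorm_norm2.
apply/ler_addgt0Pr => e e0.
pose i := Num.trunc (e^-1).
have ie : i.+1%:R^-1 <= e.
  rewrite -[leRHS]invrK lef_pV2 ?posrE ?invr_gt0 //; apply: ltW.
  by apply: Num.Theory.truncnS_gt.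
have [k hk] := h i.
apply: (@le_trans _ _ (norm2 (matvec M (direction (basis_vector n0) k)))).
  by apply: ge_inf => //; exists 0.
by apply: (le_trans (ltW hk)); rewrite lerD2l.
Qed.

End XiMinus.

Lemma mem_In (S : eqType) (x : S) (s : seq S) : x \in s -> List.In x s.
Proof.
elim: s => //= y s IH; rewrite inE => /orP[/eqP ->|/IH]; first by left.
by right.
Qed.

Section XiProbability.
Context {R : realType} {m n : nat} {d : measure_display} {T : measurableType d}.
Variables (P : probability T R) (A : 'I_m -> 'I_n -> {RV P >-> R}).
Hypothesis hA : standard_gaussian_matrix A.
Hypotheses (m0 : (0 < m)%N) (n0 : (0 < n)%N).
Local Notation N := (@normal_prob R 0 1).
Local Notation sample w := (fun i j => A i j w).

Let small (b : R) (k : nat) : set T :=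
  [set w | norm2 (matvec (sample w) (direction (basis_vector n0) k)) < b].

Lemma measurable_small b k : measurable (small b k).
Proof.
have ms : measurable_fun [set: R] (@Num.sqrt R).
  by apply: continuous_measurable_fun; exact: sqrt_continuous.
have mS : measurable_fun [set: T]
    (fun w => \sum_i matvec (sample w) (direction (basis_vector n0) k) i ^+ 2).
  apply: measurable_sum => i; apply: measurable_funX.
  by apply: measurable_sum => j; apply: measurable_funM.
have mf := measurableT_comp ms mS.
rewrite /small -[X in measurable X]setTI.
rewrite (_ : [set w | _] = (fun w => norm2 (matvec (sample w) (direction (basis_vector n0) k))) @^-1` `]-oo, b[%classic).
  by apply: mf => //; exact: measurable_itv.
by apply/seteqP; split=> w /=; rewrite in_itv.
Qed.

Lemma xi_event u : [set w | xi_minus_rv A w <= u] =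
  \bigcap_(i in [set: nat]) \bigcup_(k in [set: nat]) small (u * Num.sqrt n%:R + i.+1%:R^-1) k.
Proof.
have E w x : matvec (\matrix_(i < m, j < n) A i j w) x = matvec (sample w) x.
  by apply/funext => i; rewrite /matvec; apply: eq_bigr => j _; rewrite mxE.
apply/seteqP; split=> w /=.
  move/(xi_minus_le m0 n0) => h i _; have [k hk] := h i.
  by exists k => //; rewrite /small /= -E.
move=> h; apply/(xi_minus_le m0 n0) => i; have [k _ hk] := h i I.
by exists k; rewrite E.
Qed.

Lemma measurable_xi_event u : measurable [set w | xi_minus_rv A w <= u].
Proof.
rewrite xi_event; apply: bigcap_measurable => // i _.
by apply: bigcup_measurable => k _; exact: measurable_small.
Qed.

(** Finitely many directions are treated by [gordon_probability], whose bound does not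
    depend on their number; continuity of [P] along increasing events does the rest.
    The terms [1] and [2] of the exponent come from the slack in [xi_event] and from
    [dl = 1]: both are negligible against [sqrt n]. *)
Theorem xi_probability (u t0 lam : R) (s : seq (R * (R * R))) :
  0 <= lam ->
  (forall p, List.In p s -> 0 <= p.2.1 /\ p.2.2 < 2^-1) ->
  (forall r q, 0 <= r -> 0 <= q -> expR (lam * (q - r)) <=
     \sum_(p <- s) p.1 * expR (- p.2.1 * r ^+ 2 + p.2.2 * q ^+ 2)) ->
  fine (P [set w | xi_minus_rv A w <= u]) * fine (N `]-oo, (- t0)%R]) <=
  2 * expR (lam * (u * Num.sqrt n%:R + 1 - t0 + 2)) * \sum_(p <- s) p.1 *
    ((Num.sqrt (1 + 2 * p.2.1))^-1 ^+ m * (Num.sqrt (1 - 2 * p.2.2))^-1 ^+ n).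
Proof.
move=> l0 sp sdom; set B := 2 * _ * _; set nu := fine (N _).
pose b := u * Num.sqrt n%:R + 1.
pose F (K : nat) := \big[setU/set0]_(k < K) small b k.
have mF K : measurable (F K) by apply: bigsetU_measurable => k _; exact: measurable_small.
have FB K : fine (P (F K)) * nu <= B.
  have := @gordon_probability R m n d T P A hA
    [seq direction (basis_vector n0) k | k <- iota 0 K] (F K) b t0 lam 1 s.
  rewrite /B mulr1; apply => //.
    move=> x /(@List.in_map_iff _ _ _ (iota 0 K) x)[k [<- _]].
    by apply: direction_unit; exact: basis_vector_unit.
  move=> w; rewrite /F -bigcup_mkord => -[k /= kK wk].
  exists (direction (basis_vector n0) k); last exact: ltW.
  by apply/List.in_map/mem_In; rewrite mem_iota add0n.
have sub : [set w | xi_minus_rv A w <= u] `<=` \bigcup_K F K.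
  rewrite xi_event => w /(_ 0%N I)[k _ wk]; exists k.+1 => //.
  by rewrite /F -bigcup_mkord; exists k => //=; move: wk; rewrite invr1.
have nu0 : 0 <= nu by rewrite fine_ge0.
have mU : measurable (\bigcup_K F K) by apply: bigcup_measurable => K _.
apply: (@le_trans _ _ (fine (P (\bigcup_K F K)) * nu)).
  apply: ler_wpM2r => //; apply: fine_le.
  - by apply: fin_num_measure; exact: measurable_xi_event.
  - exact: fin_num_measure.
  - by apply: le_measure => //; rewrite inE //; exact: measurable_xi_event.
have cF : (fun K => P (F K)) @ \oo --> P (\bigcup_K F K).
  apply: nondecreasing_cvg_mu => // i j ij.
  by apply/subsetPset; apply: subset_bigsetU.
have cR : (fun K => fine (P (F K)) * nu) @ \oo --> fine (P (\bigcup_K F K)) * nu.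
  apply: cvgMl; apply: fine_cvg; rewrite fineK //; exact: fin_num_measure.
rewrite -(cvg_lim _ cR) //; apply: limr_le; first by apply/cvg_ex; eexists; exact: cR.
by apply: nearW => K; exact: FB.
Qed.

End XiProbability.

(** * The rate function *)

Section RateFunction.
Context {R : realType}.
Implicit Types (alpha c g h u : R).

Lemma gamma1l_gt0 alpha c : 0 < alpha -> 0 <= c -> 0 < gamma1l alpha c.
Proof.
move=> a0 c0; rewrite /gamma1l divr_gt0 // addrC subr_gt0.
rewrite -[ltLHS](ger0_norm c0) -sqrtr_sqr ltr_sqrt; last first.
  by rewrite ltr_wpDl ?sqr_ge0 // mulr_gt0.
by rewrite ltrDl mulr_gt0.
Qed.

(** The equation of the critical points of [phi1l]. *)
Lemma gamma1lE alpha c : 0 < alpha -> 0 <= c ->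
  2 * gamma1l alpha c * (2 * gamma1l alpha c + c) = alpha.
Proof.
move=> a0 c0; rewrite /gamma1l; set s := Num.sqrt _.
have s2 : s ^+ 2 = c ^+ 2 + 4 * alpha.
  by rewrite sqr_sqrtr // addr_ge0 ?sqr_ge0 // mulr_ge0 // ltW.
have -> : 2 * ((- c + s) / 4) * (2 * ((- c + s) / 4) + c) = (s ^+ 2 - c ^+ 2) / 4.
  by field.
by rewrite s2; field.
Qed.

Lemma gamma2_gt c : 0 <= c -> c < 2 * gamma2 c.
Proof.
move=> c0; rewrite /gamma2; have : c < Num.sqrt (c ^+ 2 + 4).
  rewrite -[ltLHS](ger0_norm c0) -sqrtr_sqr ltr_sqrt; last first.
    by rewrite ltr_wpDl ?sqr_ge0.
  by rewrite ltrDl.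
lra.
Qed.

(** [gamma1l] maximises [phi1l]: this is the tangent-line bound [ln y <= y - 1]
    together with the stationarity equation [gamma1lE]. *)
Lemma phi1l_max alpha c g : 0 < alpha -> 0 <= c -> 0 < g ->
  phi1l alpha c g <= phi1l alpha c (gamma1l alpha c).
Proof.
move=> a0 c0 g0; have e0 := gamma1l_gt0 a0 c0; have eE := gamma1lE a0 c0.
set e := gamma1l alpha c in e0 eE *.
rewrite /phi1l.
pose a := 1 + c / (2 * e); pose b := 1 + c / (2 * g).
have ap : 0 < a by rewrite ltr_wpDr // divr_ge0 // ltW // mulr_gt0.
have bp : 0 < b by rewrite ltr_wpDr // divr_ge0 // ltW // mulr_gt0.
have h1 : ln a - ln b <= a / b - 1.
  rewrite -ln_div ?posrE //; have := @le_ln1Dx R (a / b - 1).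
  by rewrite addrCA subrr addr0; apply; have := divr_gt0 ap bp; lra.
have abE : alpha / 2 * (a / b - 1) = c * (g - e) * (2 * e + c) / (2 * g + c).
  rewrite -eE /a /b; field.
  by rewrite !gt_eqF //; lra.
have h2 : c * (g - e) * (2 * e + c) / (2 * g + c) <= c * (g - e).
  rewrite ler_pdivrMr; last by lra.
  have : 0 <= c * (g - e) ^+ 2 by rewrite mulr_ge0 // sqr_ge0.
  nra.
have := ler_wpM2l (ltW (divr_gt0 a0 (ltr0n R 2))) h1; rewrite abE.
rewrite -/a -/b; lra.
Qed.

Lemma invsqrt_exp (y : R) k : 0 < y ->
  (Num.sqrt y)^-1 ^+ k = expR (- (k%:R / 2 * ln y)).
Proof.
move=> y0; have -> : Num.sqrt y = expR (ln y / 2).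
  rewrite -[in LHS](lnK y0) -[RHS]ger0_norm ?expR_ge0 // -sqrtr_sqr; congr Num.sqrt.
  by rewrite -expRM_natl; congr expR; field.
by rewrite -expRN -expRM_natl; congr expR; field.
Qed.

Section Family.
Variables (alpha c h : R) (L m n : nat).
Hypotheses (a1 : 0 < alpha) (c0 : 0 < c) (h0 : 0 < h) (n0 : (0 < n)%N).

Let gam (l : nat) : R := h * l.+1%:R / 2.
Let beta : R := c / (4 * gamma2 c).
Let sq : R := Num.sqrt n%:R.

(** Quadratic majorants of the exponent [c * sqrt n * (q - r)], obtained from tangent
    lines in the variables [q ^ 2] and [r ^ 2].  For [q] the tangent at
    [q = 2 * gamma2 c * sqrt n] is a majorant everywhere.  For [r] the tangent at
    [r = 2 * gam l * sqrt n] is a majorant, up to the error [n * c * h / 2], for [r / sqrt n]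
    between [l * h] and [(l + 1) * h]; the last member serves the values of [r] beyond
    [L * h * sqrt n], where [r] is replaced by that bound. *)
Definition gaussian_family : seq (R * (R * R)) :=
  [seq (expR (n%:R * (c * h / 2 - c * gam l + c * gamma2 c)), (c / (4 * gam l), beta))
    | l <- iota 0 L] ++
  [:: (expR (n%:R * (- (c * (L%:R * h)) + c * gamma2 c)), (0, beta))].

Lemma gam_ge l : h / 2 <= gam l.
Proof. by rewrite /gam ler_pM2r // ler_peMr ?ler1n // ltW. Qed.

Lemma gam_gt0 l : 0 < gam l.
Proof. by apply: lt_le_trans (gam_ge l); rewrite divr_gt0. Qed.

Lemma gaussian_family_exponents p : List.In p gaussian_family -> 0 <= p.2.1 /\ p.2.2 < 2^-1.
Proof.
have g2 := gamma2_gt (ltW c0).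
have g20 : 0 < gamma2 c by have := c0; lra.
have b2 : beta < 2^-1.
  rewrite /beta ltr_pdivrMr; last by rewrite mulr_gt0.
  by have -> : 2^-1 * (4 * gamma2 c) = 2 * gamma2 c by field.
move=> /(List.in_app_or _ _ p)[|[<-|//]] //=.
move=> /(@List.in_map_iff _ _ _ (iota 0 L) p)[l [<- _]] /=; split=> //.
by rewrite divr_ge0 ?ltW // mulr_gt0 // gam_gt0.
Qed.

Lemma gaussian_family_majorant r q : 0 <= r -> 0 <= q ->
  expR (c * sq * (q - r)) <=
  \sum_(p <- gaussian_family) p.1 * expR (- p.2.1 * r ^+ 2 + p.2.2 * q ^+ 2).
Proof.
move=> r0 q0.
have sq0 : 0 < sq by rewrite sqrtr_gt0 ltr0n.
have sq2 : sq ^+ 2 = n%:R by rewrite sqr_sqrtr.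
have g2 := gamma2_gt (ltW c0).
have g20 : 0 < gamma2 c by have := c0; lra.
(* The difference is a multiple of a square that vanishes at the point of tangency. *)
have hq : c * sq * q <= n%:R * (c * gamma2 c) + beta * q ^+ 2.
  have : 0 <= c / (4 * gamma2 c) * (2 * gamma2 c * sq - q) ^+ 2.
    by rewrite mulr_ge0 ?sqr_ge0 // divr_ge0 ?ltW // mulr_gt0.
  rewrite (_ : _ * _ = n%:R * (c * gamma2 c) + beta * q ^+ 2 - c * sq * q); first by lra.
  by rewrite -sq2 /beta; field; rewrite gt_eqF.
rewrite /gaussian_family big_cat big_map big_seq1 /=.
have S0 : 0 <= \sum_(l <- iota 0 L)
   expR (n%:R * (c * h / 2 - c * gam l + c * gamma2 c)) *
   expR (- (c / (4 * gam l)) * r ^+ 2 + beta * q ^+ 2).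
  by apply: sumr_ge0 => l _; rewrite mulr_ge0 // expR_ge0.
have [rL|rL] := leP (L%:R * h * sq) r.
  apply: (@le_trans _ _ (expR (n%:R * (- (c * (L%:R * h)) + c * gamma2 c)) *
     expR (- 0 * r ^+ 2 + beta * q ^+ 2))); last by rewrite lerDr.
  rewrite -expRD ler_expR.
  have : c * sq * (L%:R * h * sq) <= c * sq * r by rewrite ler_wpM2l // mulr_ge0 // ltW.
  rewrite (_ : c * sq * (L%:R * h * sq) = n%:R * (c * (L%:R * h))); last by rewrite -sq2; ring.
  lra.
pose l := Num.trunc (r / (sq * h)).
have sh0 : 0 < sq * h by rewrite mulr_gt0.
have /andP[l1 l2] : l%:R <= r / (sq * h) < l.+1%:R.
  by apply: Num.Theory.truncn_itv; rewrite divr_ge0 // ltW.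
have lL : (l < L)%N.
  rewrite -(ltr_nat R); apply: (le_lt_trans l1).
  by rewrite ltr_pdivrMr // (_ : L%:R * (sq * h) = L%:R * h * sq) //; ring.
rewrite ler_pdivlMr // in l1; rewrite ltr_pdivrMr // in l2.
have term : expR (c * sq * (q - r)) <=
   expR (n%:R * (c * h / 2 - c * gam l + c * gamma2 c)) *
   expR (- (c / (4 * gam l)) * r ^+ 2 + beta * q ^+ 2).
  rewrite -expRD ler_expR.
  have gl := gam_gt0 l; have glh := gam_ge l.
  have key : c / (4 * gam l) * (r - 2 * gam l * sq) ^+ 2 <= n%:R * (c * h / 2).
    apply: (@le_trans _ _ (c / (4 * gam l) * (h * sq) ^+ 2)).
      rewrite ler_wpM2l //; first by rewrite divr_ge0 ?ltW // mulr_gt0.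
      rewrite -[leLHS]ger0_norm ?sqr_ge0 // -[leRHS]ger0_norm ?sqr_ge0 // !normrX.
      rewrite lerXn2r ?nnegrE //.
      rewrite [leRHS]ger0_norm; last by rewrite ltW // mulr_gt0.
      have E : 2 * gam l * sq = (l%:R + 1) * (sq * h) by rewrite /gam -natr1; field.
      rewrite E ler_norml; rewrite -natr1 in l2; apply/andP; split; nra.
    rewrite exprMn sq2 mulrAC mulrA ler_pdivrMr ?mulr_gt0 //.
    have : 0 <= c * h * n%:R * (2 * gam l - h)
      by apply: mulr_ge0; [rewrite mulr_ge0 // mulr_ge0 // ltW|lra].
    nra.
  have E : c / (4 * gam l) * (r - 2 * gam l * sq) ^+ 2 =
     c / (4 * gam l) * r ^+ 2 - c * sq * r + n%:R * (c * gam l).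
    by rewrite -sq2; field; rewrite gt_eqF.
  rewrite E in key; lra.
apply: (le_trans term).
rewrite (bigD1_seq l) /= ?iota_uniq ?mem_iota ?add0n // -[leRHS]addrA lerDl.
apply: addr_ge0; last by rewrite mulr_ge0 // expR_ge0.
by apply: sumr_ge0 => k _; rewrite mulr_ge0 // expR_ge0.
Qed.

(** After integration the member at [gam l] has the exponent [phi1l alpha c (gam l)], which
    [phi1l_max] bounds.  The deviation of [m / n] below [alpha] is allowed to be
    [h ^ 2] because the logarithm that it multiplies is at most [c / h]: this costs
    [c * h / 2], the same as the net. *)
Lemma gaussian_family_sum :
  (alpha - h ^+ 2) * n%:R <= m%:R ->
  - phi1l alpha c (gamma1l alpha c) <= c * (L%:R * h) ->
  \sum_(p <- gaussian_family) p.1 *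
    ((Num.sqrt (1 + 2 * p.2.1))^-1 ^+ m * (Num.sqrt (1 - 2 * p.2.2))^-1 ^+ n) <=
  (L.+1)%:R * expR (n%:R * (phi1l alpha c (gamma1l alpha c) + phi2 c (gamma2 c) + c * h)).
Proof.
move=> mn cL.
set p1 := phi1l _ _ _ in cL *.
have g2 := gamma2_gt (ltW c0).
have g20 : 0 < gamma2 c by have := c0; lra.
have ch0 : 0 < c * h by rewrite mulr_gt0.
have n1 : 0 < n%:R :> R by rewrite ltr0n.
have b0 : 0 < 1 - c / (2 * gamma2 c).
  by rewrite subr_gt0 ltr_pdivrMr ?mul1r // mulr_gt0.
have bE : 1 - 2 * beta = 1 - c / (2 * gamma2 c).
  by rewrite /beta; field; rewrite gt_eqF.
have Eb : (Num.sqrt (1 - 2 * beta))^-1 ^+ n = expR (n%:R * (phi2 c (gamma2 c) - c * gamma2 c)).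
  by rewrite bE invsqrt_exp // /phi2; congr expR; field.
rewrite /gaussian_family big_cat big_map big_seq1 /= -[in leRHS]natr1 [leRHS]mulrDl [X in _ <= _ + X]mul1r; apply: lerD.
  have -> : L%:R * expR (n%:R * (p1 + phi2 c (gamma2 c) + c * h)) =
     \sum_(l <- iota 0 L) expR (n%:R * (p1 + phi2 c (gamma2 c) + c * h)).
    by rewrite big_const_seq count_predT size_iota iter_addr_0 mulr_natl.
  apply: ler_sum => l _.
  have gl := gam_gt0 l; have glh := gam_ge l.
  have aE : 1 + 2 * (c / (4 * gam l)) = 1 + c / (2 * gam l).
    by field; rewrite gt_eqF.
  have q0 : 0 <= c / (2 * gam l) by rewrite divr_ge0 ?ltW // mulr_gt0.
  have y0 : 0 < 1 + c / (2 * gam l) by lra.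
  rewrite aE invsqrt_exp // Eb -!expRD ler_expR.
  set ell := ln _.
  have l0 : 0 <= ell by rewrite ln_ge0 // lerDl.
  have l1 : ell <= c / h.
    apply: (@le_trans _ _ (c / (2 * gam l))); first by apply: le_ln1Dx; lra.
    apply: ler_wpM2l; first exact: ltW.
    rewrite lef_pV2 ?posrE //; lra.
  have pm : - (gam l * c) - alpha / 2 * ell <= p1 by exact: phi1l_max a1 (ltW c0) gl.
  have k1 : (alpha - h ^+ 2) * n%:R * ell <= m%:R * ell by rewrite ler_wpM2r.
  have k2 : h ^+ 2 * ell <= c * h.
    have -> : c * h = h ^+ 2 * (c / h) by field; rewrite gt_eqF.
    by rewrite ler_wpM2l // sqr_ge0.
  have k3 := ler_wpM2l (ltW n1) pm; have k4 := ler_wpM2l (ltW n1) k2.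
  lra.
rewrite mulr0 addr0 sqrtr1 invr1 expr1n mul1r Eb -expRD ler_expR -mulrDr ler_pM2l //.
lra.
Qed.

End Family.

End RateFunction.

(** * The large deviation bound *)

Section LargeDeviation.
Context {R : realType}.
Local Notation N := (@normal_prob R 0 1).

(** Dividing by the Gaussian tail, of exponent [(c * sqrt n + 1) ^ 2 / 2], turns
    [- c ^ 2 * n] into [- c ^ 2 / 2 * n] and leaves the terms of order [sqrt n]: one from
    the tail and three from [xi_probability]. *)
Lemma xi_exponential_bound (m n L : nat) (d : measure_display) (T : measurableType d)
    (P : probability T R) (A : 'I_m -> 'I_n -> {RV P >-> R}) (alpha c h u : R) :
  standard_gaussian_matrix A -> (0 < m)%N -> (0 < n)%N ->
  0 < alpha -> 0 < c -> 0 < h ->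
  (alpha - h ^+ 2) * n%:R <= m%:R ->
  - phi1l alpha c (gamma1l alpha c) <= c * (L%:R * h) ->
  fine (P [set w | xi_minus_rv A w <= u]) <=
    2 * Num.sqrt (pi *+ 2) * expR (2^-1) * L.+1%:R *
    expR (n%:R * (phil alpha c u + c * h) + 4 * c * Num.sqrt n%:R).
Proof.
move=> hA m0 n0 a0 c0 h0 mn cL.
set sq := Num.sqrt n%:R; set p := fine _.
have sq0 : 0 <= sq by exact: sqrtr_ge0.
have sq2 : sq ^+ 2 = n%:R by rewrite sqr_sqrtr.
have csq : 0 <= c * sq by rewrite mulr_ge0 // ltW.
have H := xi_probability hA m0 n0 u (c * sq) csq
  (gaussian_family_exponents (L := L) (n := n) c0 h0)
  (gaussian_family_majorant L c0 h0 n0).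
have S := gaussian_family_sum a0 c0 h0 n0 mn cL.
set B := expR (n%:R * _) in S.
pose K0 : R := (Num.sqrt (pi *+ 2))^-1 * expR (- ((c * sq + 1) ^+ 2 / 2)).
have q0 : 0 < Num.sqrt (pi *+ 2) :> R by rewrite sqrtr_gt0 pmulrn_rgt0 // pi_gt0.
have K0p : 0 < K0 by rewrite mulr_gt0 ?invr_gt0 ?expR_gt0.
have tail : K0 <= fine (N `]-oo, (- (c * sq))%R]).
  by rewrite -lee_fin fineK; [exact: normal_lower_tail|exact: fin_num_measure].
have p0 : 0 <= p by rewrite fine_ge0.
rewrite -(ler_pM2r K0p); apply: (le_trans (ler_wpM2l p0 tail)); apply: (le_trans H).
apply: (le_trans (ler_wpM2l _ S)); first by rewrite mulr_ge0 // expR_ge0.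
rewrite le_eqVlt; apply/orP; left; apply/eqP.
rewrite /K0 /B.
rewrite [RHS](_ : _ = 2 * L.+1%:R * (expR (2^-1) *
  expR (n%:R * (phil alpha c u + c * h) + 4 * c * sq) *
  expR (- ((c * sq + 1) ^+ 2 / 2)))); last by field; rewrite gt_eqF.
rewrite -!expRD [LHS](_ : forall x y : R, 2 * x * (L.+1%:R * y) = 2 * L.+1%:R * (x * y)); last by move=> x y; ring.
rewrite -expRD; congr (_ * expR _).
rewrite -/sq /phil -sq2; by field.
Qed.

Lemma limn_esup_le (v : (\bar R)^nat) (x : \bar R) :
  (\forall n \near \oo, (v n <= x)%E) -> (limn_esup v <= x)%E.
Proof.
move=> [k _ kv]; rewrite limn_esup_lim.
apply: lime_le; first exact: is_cvg_esups.
exists k => // j kj; apply: ge_ereal_sup => _ [i /= ji <-].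
by apply: kv; rewrite /= (leq_trans kj).
Qed.

End LargeDeviation.

Theorem theorem4 (R : realType) (alpha : R) (halpha : 1 < alpha)
    (m : nat -> nat)
    (hm : (fun n : nat => (m n)%:R / n%:R : R) @ \oo --> alpha)
    (d : nat -> measure_display)
    (T : forall n : nat, measurableType (d n))
    (P : forall n : nat, probability (T n) R)
    (A : forall n : nat, 'I_(m n) -> 'I_n -> {RV (P n) >-> R})
    (hA : forall n : nat, standard_gaussian_matrix (A n))
    (u : R)
    (hu : (u%:E <=
             limn (fun n : nat => 'E_(P n)[xi_minus_rv (A n)]))%E) :
  (limn_esup (fun n : nat =>
       lne (P n [set w | (xi_minus_rv (A n) w <= u)%R]) * (n%:R^-1)%:E)
   <= ereal_inf [set (phil alpha c3 u)%:E | c3 in [set c : R | (0 <= c)%R]])%E.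
Proof.
have a0 : 0 < alpha by apply: lt_trans halpha.
have pos : \forall n \near \oo, (0 < n)%N /\ (0 < m n)%N.
  have a1 : 0 < alpha - 1 by rewrite subr_gt0.
  move/cvgrPdist_lt : hm => /(_ _ a1) hm'; near=> n.
  have n0 : (0 < n)%N by near: n; exact: nbhs_infty_gt.
  split=> //; have : `|alpha - (m n)%:R / n%:R| < alpha - 1 by near: n.
  rewrite ltr_norml => /andP[_ hn]; rewrite -(ltr0n R).
  have : 1 < (m n)%:R / n%:R :> R by move: hn; rewrite ltrD2l ltrN2.
  by rewrite ltr_pdivlMr ?ltr0n // mul1r ltr_nat; apply: leq_ltn_trans.
apply: le_ereal_inf_tmp => _ [c /= cge0 <-].
have [->|cn] := eqVneq c 0.
  have -> : phil alpha 0 u = 0.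
    by rewrite /phil /phi1l /phi2 expr0n !mul0r !mulr0 !subr0 !addr0 ln1 !mulr0; ring.
  apply: limn_esup_le; near=> n.
  have [n0 m0] : (0 < n)%N /\ (0 < m n)%N by near: n.
  apply: mule_le0_ge0; last by rewrite lee_fin invr_ge0.
  by rewrite lne_le0; apply: probability_le1; exact: measurable_xi_event.
have {cn} c0 : 0 < c by rewrite lt_def cn.
apply/lee_addgt0Pr => e e0.
(* The error [c * h] of the net is half of [e], and [X] is chosen so that the terms of
   order [sqrt n] take the other half as soon as [X <= sqrt n]. *)
pose h := e / (2 * c).
have h0 : 0 < h by rewrite divr_gt0 // mulr_gt0.
pose L := (Num.trunc (- phi1l alpha c (gamma1l alpha c) / (c * h))).+1.
have cL : - phi1l alpha c (gamma1l alpha c) <= c * (L%:R * h).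
  have ch0 : 0 < c * h by rewrite mulr_gt0.
  rewrite mulrCA -(ler_pdivrMr _ _ ch0); apply: ltW.
  exact: Num.Theory.truncnS_gt.
pose C : R := 2 * Num.sqrt (pi *+ 2) * expR (2^-1) * L.+1%:R.
have C0 : 0 < C.
  by rewrite !mulr_gt0 ?expR_gt0 // sqrtr_gt0 pmulrn_rgt0 // pi_gt0.
pose X := 2 * (`|ln C| + 4 * c) / e.
have X0 : 0 <= X.
  apply: divr_ge0; last exact: ltW.
  by apply: mulr_ge0 => //; apply: addr_ge0 => //; apply: mulr_ge0.
have h20 : 0 < h ^+ 2 by rewrite exprn_gt0.
apply: limn_esup_le.
move/cvgrPdist_le : hm => /(_ _ h20) hm'.
near=> n.
have [n0 m0] : (0 < n)%N /\ (0 < m n)%N by near: n.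
have nX : X ^+ 2 <= n%:R by near: n; exact: nbhs_infty_ger.
have hn : `|alpha - (m n)%:R / n%:R| <= h ^+ 2 by near: n.
have nn : 0 < n%:R :> R by rewrite ltr0n.
have mn : (alpha - h ^+ 2) * n%:R <= (m n)%:R.
  move: hn; rewrite ler_norml => /andP[_ hn].
  by rewrite -ler_pdivlMr // lerBlDr -lerBlDl.
have B := xi_exponential_bound u (hA n) m0 n0 a0 c0 h0 mn cL.
set E := [set w | _]; set p := fine (P n E) in B.
have PE : P n E = p%:E.
  by rewrite fineK //; apply: fin_num_measure; exact: measurable_xi_event.
rewrite PE.
have [p0|p0] := leP p 0.
  rewrite le0_lneNy ?lee_fin // gt0_mulNye ?leNye // lte_fin invr_gt0 //.
rewrite lne_EFin // -EFinM -EFinD lee_fin ler_pdivrMr //.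
have lp : ln p <= ln C + (n%:R * (phil alpha c u + c * h) + 4 * c * Num.sqrt n%:R).
  rewrite -[X in _ + X]expRK -lnM ?posrE ?expR_gt0 // ler_ln ?posrE //.
  by rewrite mulr_gt0 // expR_gt0.
apply: (le_trans lp).
set s := Num.sqrt n%:R.
have s1 : 1 <= s by rewrite -[leLHS]sqrtr1 ler_wsqrtr // ler1n.
have sX : X <= s by rewrite -[leLHS]ger0_norm // -sqrtr_sqr ler_wsqrtr.
have s2 : s ^+ 2 = n%:R by rewrite sqr_sqrtr.
have s0 : 0 <= s by lra.
have b1 : ln C <= `|ln C| * s.
  by apply: (le_trans (ler_norm _)); rewrite ler_peMr.
have b2 : (`|ln C| + 4 * c) * s <= e / 2 * n%:R.
  have -> : `|ln C| + 4 * c = e / 2 * X by rewrite /X; field; rewrite gt_eqF.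
  have e20 : 0 <= e / 2 by rewrite divr_ge0 // ltW.
  have := ler_wpM2l e20 (ler_wpM2r s0 sX).
  by rewrite mulrA -expr2 s2.
have b3 : c * h = e / 2 by rewrite /h; field; rewrite gt_eqF.
rewrite b3; lra.
Unshelve. all: end_near.
Qed.
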